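(* Let $\mathbf{c},\mathbf{d}\in\mathtt{T}_{\mathbf m}$. Then a set of representatives for the double cosets in $C_{\mathbf c}\backslash K/C_{\mathbf d}$ supporting (nonzero) elements of $\mathscr{H}(\chi_{\mathbf c},\chi_{\mathbf d})$ is $$\mathtt{S}_{\mathbf c,\mathbf d}=\bigcup_{w\in W_{\mathbf c,\mathbf d}}\mathtt{S}^w_{\mathbf c,\mathbf d},$$ where the subsets $\mathtt{S}^w_{\mathbf c,\mathbf d}\subseteq\mathtt{R}^w_{\mathbf c,\mathbf d}$ are as follows. (i) $\mathtt{S}^1_{\mathbf c,\mathbf d}$ is the set of all $t_{\mathbf a,x}$ with $\mathbf a\in\mathtt{T}_{\mathbf c,\mathbf d}$ and $x\in\mathtt{X}^{\mathbf a}_{\mathbf c,\mathbf d}$ such that one of the following holds: (1) $a_1\ge M$ and $a_2\ge N$; or (2) $a_1<M$ and $a_2\ge N$ and one of: (a) $a_1+a_2<a_3$ and $M\le\min\{\mathbf c-\mathbf a,\ \mathbf d-\mathbf a,\ c_2+a_1-a_3,\ d_1+a_2-a_3\}$; or (b) $a_1+a_2>a_3$ and $M\le\min\{\mathbf c-\mathbf a^{\mathrm{op}},\ \mathbf d-\mathbf a^{\mathrm{op}}\}$; or (c) $a_1+a_2=a_3$ and $M\le\min\{\mathbf c-\mathbf a,\ \mathbf d-\mathbf a\}$ and $\mathrm{val}(x-1)\le\mathbf a(\mathbf c,\mathbf d)'-M$; or (3) $a_1\ge N$ and $a_2<N$ and one of: (a) $a_1+a_2<a_3$ and $N\le\min\{\mathbf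 c-\mathbf a,\ \mathbf d-\mathbf a,\ c_2+a_1-a_3,\ d_1+a_2-a_3\}$; or (b) $a_1+a_2>a_3$ and $N\le\min\{\mathbf c-\mathbf a^{\mathrm{op}},\ \mathbf d-\mathbf a^{\mathrm{op}}\}$; or (c) $a_1+a_2=a_3$ and $N\le\min\{\mathbf c-\mathbf a,\ \mathbf d-\mathbf a\}$ and $\mathrm{val}(x-1)\le\mathbf a(\mathbf c,\mathbf d)'-N$. (ii) $\mathtt{S}^{s_1}_{\mathbf c,\mathbf d}$ is the set of all $s_1^{(\alpha,\beta)}$ such that $N\le\alpha\le\min\{d_2,c_3\}-M$, $N\le\beta\le\min\{c_2,d_3\}-M$ and $M-c_1\le\beta-\alpha\le d_1-M$. (iii) $\mathtt{S}^{s_2}_{\mathbf c,\mathbf d}$ is the set of all $s_2^{(\alpha,\beta)}$ such that $N\le\alpha\le\min\{d_1,c_3\}-N$, $N\le\beta\le\min\{c_1,d_3\}-N$ and $N-c_2\le\beta-\alpha\le d_2-N$. (iv) $\mathtt{S}^w_{\mathbf c,\mathbf d}=\emptyset$ for all other $w\in W_{\mathbf c,\mathbf d}$ and for any $w\notin W_{\mathbf c,\mathbf d}$.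
   Context: Let $k$ be a $p$-adic field of characteristic $0$ with residual characteristic $p>2$ and residue field of order $q>3$; $\mathcal R$ its integer ring, $\mathfrak p$ the maximal ideal, $\pi$ a uniformizer, $\mathrm{val}$ the valuation with $\mathrm{val}(\pi)=1$. $K=\mathrm{GL}(3,\mathcal R)$. Characters. Let $\chi_2,\chi_3$ be restrictions to $\mathcal R^\times$ of characters of $k^\times$. The conductor $\mathrm{cond}(\psi)$ is the least $m\ge0$ with $1+\mathfrak p^m\subseteq\ker\psi$, with the convention that $\mathrm{cond}(\psi)=0$ iff $\psi|_{\mathcal R^\times}=\mathbf 1$. Put $M=\mathrm{cond}(\chi_2)$, $N=\mathrm{cond}(\chi_3)$ and assume $0\le M\le N$, $N>0$, and $\mathrm{cond}(\chi_2\chi_3^{-1})=N$. Let $\mathbf m=(M,N,N)$. Triples. $\mathtt T=\{\mathbf c=(c_1,c_2,c_3)\in\mathbb Z^3:0\le c_1,c_2\le c_3\le c_1+c_2\}$, partially ordered componentwise ($\mathbf c\preceq\mathbf d$ iff $c_i\le d_i$ for all $i$); $\mathtt T_{\mathbf m}=\{\mathbf c\in\mathtt T:\mathbf c\succeq\mathbf m\}$ (so $c_2,c_3\ge N\ge1$). $C_{\mathbf c}$ is the subgroup of $g=(g_{ij})\in K$ with $g_{21}\in\mathfrak p^{c_1}$, $g_{32}\in\mathfrak p^{c_2}$, $g_{31}\in\mathfrak p^{c_3}$. For $\mathbf c\in\mathtt T_{\mathbf m}$, $\chi_{\mathbf c}(g)=\chi_2(g_{22})\chi_3(g_{33})$ is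 a character of $C_{\mathbf c}$ (the factor $\chi_2(g_{22})$ is read as $1$ if $M=0$). $$\mathscr H(\chi_{\mathbf c},\chi_{\mathbf d})=\{f:K\to\mathbb C: f(gkg')=\chi_{\mathbf c}(g)f(k)\chi_{\mathbf d}(g')\ \forall g\in C_{\mathbf c},k\in K,g'\in C_{\mathbf d}\}.$$ Notation for minima: a triple inside $\min\{\cdots\}$ stands for its three components. Put $\underline c_i=\max\{c_i,1\}$, $\underline{\mathbf c}=(\underline c_1,\underline c_2,\underline c_3)$. $\mathtt T^1=\{\mathbf a\in\mathbb Z^3:1\le a_1,a_2\le a_3\}$. For $\mathbf a\in\mathtt T^1$, $\mathbf a^{\mathrm{op}}=(a_3-a_2,\ a_3-a_1,\ (a_3-a_1)+(a_3-a_2))$. For $\mathbf c,\mathbf d\in\mathtt T_{\mathbf m}$ define: $\mathtt T_{\mathbf c,\mathbf d}=\{\mathbf a\in\mathtt T^1:\mathbf a\preceq\underline{\mathbf c},\ \mathbf a\preceq\underline{\mathbf d},\ a_3\le\min\{a_1+\underline c_2,\underline d_1+a_2\}\}$, except that if $c_1=d_1=0$ then $\mathtt T_{\mathbf c,\mathbf d}=\{(1,a,a):1\le a\le\min\{c_2,d_2\}\}$. For $\mathbf a\in\mathtt T_{\mathbf c,\mathbf d}$, $\mathbf a(\mathbf c,\mathbf d)=\max\{0,\min\{a_1,a_2,a_3-a_1,a_3-a_2,\mathbf c-\mathbf a,\mathbf d-\mathbf a,a_1+c_2-a_3,d_1+a_2-a_3\}\}$ and $\mathbf a(\mathbf c,\mathbf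 d)'=\max\{0,\min\{d_3-a_3,c_3-a_3,c_1-a_1,d_2-a_2\}\}\ge\mathbf a(\mathbf c,\mathbf d)$. $\mathtt X^{\mathbf a}_{\mathbf c,\mathbf d}$: if $a_1+a_2\ne a_3$ it is $(\mathcal R/\mathfrak p^{\mathbf a(\mathbf c,\mathbf d)})^\times$ (one element if $\mathbf a(\mathbf c,\mathbf d)=0$). If $a_1+a_2=a_3$, write $e=\mathbf a(\mathbf c,\mathbf d)$, $e'=\mathbf a(\mathbf c,\mathbf d)'$; it is the set of classes of $x\in\mathcal R^\times$ where $x\sim y$ iff $\min\{\mathrm{val}(x-1),e'\}=\min\{\mathrm{val}(y-1),e'\}=:i$ and $\mathrm{val}(x-y)\ge\min\{i+e,e'\}$; for such a class $\mathrm{val}(x-1)$ means this $i$. An element of $\mathtt X^{\mathbf a}_{\mathbf c,\mathbf d}$ is represented by a chosen $x\in\mathcal R^\times$. $W=\{1,s_1,s_2,s_1s_2,s_2s_1,w_0\}$ is the symmetric group $S_3$ ($s_i=(i\ \ i+1)$, $w_0$ longest). For $\mathbf c,\mathbf d\in\mathtt T_{\mathbf m}$: $W_{\mathbf c,\mathbf d}=W$ if $c_1d_1>0$; $\{1,s_2,w_0\}$ if $c_1d_1=0$ and $c_1+d_1>0$; $\{1,w_0\}$ if $c_1=d_1=0$. A complete set of distinct representatives of $C_{\mathbf c}\backslash K/C_{\mathbf d}$ (known) is $\mathtt R_{\mathbf c,\mathbf d}=\bigcup_{w\in W_{\mathbf c,\mathbf d}}\mathtt R^w_{\mathbf c,\mathbf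 d}$, where $\mathtt R^1_{\mathbf c,\mathbf d}=\{t_{\mathbf a,x}=\begin{pmatrix}1&0&0\\ \pi^{a_1}&1&0\\ x\pi^{a_3}&\pi^{a_2}&1\end{pmatrix}:\mathbf a\in\mathtt T_{\mathbf c,\mathbf d},x\in\mathtt X^{\mathbf a}_{\mathbf c,\mathbf d}\}$; $\mathtt R^{s_1}_{\mathbf c,\mathbf d}=\{s_1^{(\alpha,\beta)}=\begin{pmatrix}0&1&0\\1&0&0\\ \pi^\beta&\pi^\alpha&1\end{pmatrix}:1\le\alpha\le\min\{\underline d_2,c_3\},1\le\beta\le\min\{\underline c_2,d_3\},-c_1\le\beta-\alpha\le d_1\}$; $\mathtt R^{s_2}_{\mathbf c,\mathbf d}=\{s_2^{(\alpha,\beta)}=\begin{pmatrix}1&0&0\\ \pi^\beta&0&1\\ \pi^\alpha&1&0\end{pmatrix}:1\le\alpha\le\min\{\underline d_1,c_3\},1\le\beta\le\min\{\underline c_1,d_3\},-c_2\le\beta-\alpha\le d_2\}$; $\mathtt R^{s_1s_2}_{\mathbf c,\mathbf d}=\{\begin{pmatrix}0&0&1\\1&0&0\\ \pi^\alpha&1&0\end{pmatrix}:1\le\alpha\le\min\{d_1,c_2\}\}$; $\mathtt R^{s_2s_1}_{\mathbf c,\mathbf d}=\{\begin{pmatrix}0&1&0\\0&\pi^\alpha&1\\1&0&0\end{pmatrix}:1\le\alpha\le\min\{c_1,d_2\}\}$; $\mathtt R^{w_0}_{\mathbf c,\mathbf d}=\{\begin{pmatrix}0&0&1\\0&1&0\\1&0&0\end{pmatrix}\}$.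 *)

(* Defs.v *)
From mathcomp Require Import all_boot all_order all_fingroup all_algebra.
From mathcomp Require Import all_classical reals.
From mathcomp Require Import complex.

Set Implicit Arguments.
Unset Strict Implicit.
Unset Printing Implicit Defensive.

Import Order.TTheory GRing.Theory Num.Theory.
Local Open Scope classical_set_scope.
Local Open Scope ring_scope.

Definition idl_of (k : fieldType) (val : k -> int) (n : int) : set k :=
  [set x | x = 0 \/ n <= val x].

(* A nonarchimedean local field of characteristic 0.  [valk] is the normalized
   valuation; [valk 0] is unspecified, so that every statement about valuations
   goes through [idl] (powers of the maximal ideal) or [tval].  The residue
   field is given by reduction: [red] is meaningful on the integer ring only,
   where it is a surjective ring morphism with kernel the maximal ideal. *)
Record padicField := PadicField {
  carrier :> fieldType;
  valk : carrier -> int;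
  residue : finFieldType;
  red : carrier -> residue;
  valM : forall x y, x != 0 -> y != 0 -> valk (x * y) = valk x + valk y;
  valD : forall x y, x != 0 -> y != 0 -> x + y != 0 ->
    Num.min (valk x) (valk y) <= valk (x + y);
  val_normalized : exists2 x, x != 0 & valk x = 1;
  valk_char0 : [pchar carrier] =i pred0;
  val_complete : forall u : nat -> carrier,
    (forall n : int, exists m : nat, forall i j : nat,
       (m <= i)%N -> (m <= j)%N -> idl_of valk n (u i - u j)) ->
    exists l : carrier, forall n : int, exists m : nat, forall i : nat,
      (m <= i)%N -> idl_of valk n (u i - l);
  red1 : red 1 = 1;
  redD : forall x y, idl_of valk 0 x -> idl_of valk 0 y ->
    red (x + y) = red x + red y;
  redM : forall x y, idl_of valk 0 x -> idl_of valk 0 y ->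
    red (x * y) = red x * red y;
  red_surj : forall z, exists2 x, idl_of valk 0 x & red x = z;
  red_ker : forall x, idl_of valk 0 x -> (red x = 0 <-> idl_of valk 1 x)
}.

Section LocalField.
Variable k : padicField.

(* p^n; in particular p^0 is the integer ring. *)
Definition idl (n : int) : set k := idl_of (@valk k) n.

Definition runit : set k := [set x | x != 0 /\ valk x = 0].

Definition uniformizer (x : k) : Prop := x != 0 /\ valk x = 1.

(* min {valk x, n}, with valk 0 = +oo *)
Definition tval (x : k) (n : int) : int :=
  if x == 0 then n else Num.min (valk x) n.

Definition GL3R : set 'M[k]_3 :=
  [set g : 'M[k]_3 | (forall i j, idl 0 (g i j)) /\ runit (\det g)].

End LocalField.

Section Characters.
Variables (R : realType) (k : padicField).

(* The value at 0 is irrelevant; smoothness is part of [conductor], which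
   asserts that some 1 + p^m lies in the kernel. *)
Definition mul_char (psi : k -> R[i]) : Prop :=
  psi 1 = 1 /\ {in predC1 0 &, {morph psi : x y / x * y}}.

(* For m = 0, 1 + p^m is understood as the full unit group. *)
Definition trivial_on_level (psi : k -> R[i]) (m : nat) : Prop :=
  forall x : k, runit x -> idl m (x - 1) -> psi x = 1.

Definition conductor (psi : k -> R[i]) (m : nat) : Prop :=
  trivial_on_level psi m /\
  forall m' : nat, trivial_on_level psi m' -> (m <= m')%N.

End Characters.

Record triple := Triple { t1 : int; t2 : int; t3 : int }.

Definition le3 (c d : triple) : Prop :=
  [/\ c.(t1) <= d.(t1), c.(t2) <= d.(t2) & c.(t3) <= d.(t3)].

Definition sub3 (c d : triple) : seq int :=
  [:: c.(t1) - d.(t1); c.(t2) - d.(t2); c.(t3) - d.(t3)].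

(* Only meant for nonempty sequences. *)
Definition mins (s : seq int) : int := foldr Num.min (head 0 s) (behead s).

Definition TT : set triple :=
  [set c | [/\ 0 <= c.(t1), 0 <= c.(t2), c.(t1) <= c.(t3), c.(t2) <= c.(t3)
             & c.(t3) <= c.(t1) + c.(t2)]].

Definition TTm (m : triple) : set triple := [set c | TT c /\ le3 m c].

Definition TT1 : set triple :=
  [set a | [/\ 1 <= a.(t1), 1 <= a.(t2), a.(t1) <= a.(t3) & a.(t2) <= a.(t3)]].

Definition under (n : int) : int := Num.max n 1.
Definition under3 (c : triple) : triple :=
  Triple (under c.(t1)) (under c.(t2)) (under c.(t3)).

Definition op3 (a : triple) : triple :=
  Triple (a.(t3) - a.(t2)) (a.(t3) - a.(t1))
         ((a.(t3) - a.(t1)) + (a.(t3) - a.(t2))).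

Section Indices.
Variables c d : triple.

Definition Tcd : set triple :=
  if (c.(t1) == 0) && (d.(t1) == 0)
  then [set Triple 1 n n | n in
          [set n : int | 1 <= n /\ n <= Num.min c.(t2) d.(t2)]]
  else [set a | [/\ TT1 a, le3 a (under3 c), le3 a (under3 d)
        & a.(t3) <= Num.min (a.(t1) + under c.(t2)) (under d.(t1) + a.(t2))]].

Definition acd (a : triple) : int :=
  Num.max 0 (mins
    ([:: a.(t1); a.(t2); a.(t3) - a.(t1); a.(t3) - a.(t2)]
     ++ sub3 c a ++ sub3 d a
     ++ [:: a.(t1) + c.(t2) - a.(t3); d.(t1) + a.(t2) - a.(t3)])).

Definition acd' (a : triple) : int :=
  Num.max 0 (mins [:: d.(t3) - a.(t3); c.(t3) - a.(t3);
                      c.(t1) - a.(t1); d.(t2) - a.(t2)]).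

Definition s1 : 'S_3 := tperm 0 1.
Definition s2 : 'S_3 := tperm 1 2.
Definition w0 : 'S_3 := tperm 0 2.

Definition Wcd : set 'S_3 :=
  if 0 < c.(t1) * d.(t1) then setT
  else if 0 < c.(t1) + d.(t1) then [set w | w \in [:: 1%g; s2; w0]]
  else [set w | w \in [:: 1%g; w0]].

End Indices.

Section DoubleCosets.
Variable k : padicField.

Definition Cgrp (c : triple) : set 'M[k]_3 :=
  [set g : 'M[k]_3 | [/\ GL3R g, idl c.(t1) (g 1 0), idl c.(t2) (g 2 1)
             & idl c.(t3) (g 2 0)]].

Definition dcoset (c d : triple) (g : 'M[k]_3) : set 'M[k]_3 :=
  [set x : 'M[k]_3 | exists h h', [/\ Cgrp c h, Cgrp d h' & x = h *m g *m h']].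

(* The classes of units under Xeq form X^a_{c,d}. *)
Definition Xeq (c d a : triple) (x y : k) : Prop :=
  if a.(t1) + a.(t2) != a.(t3) then idl (acd c d a) (x - y)
  else tval (x - 1) (acd' c d a) = tval (y - 1) (acd' c d a) /\
       idl (Num.min (tval (x - 1) (acd' c d a) + acd c d a) (acd' c d a))
           (x - y).

(* X chooses one unit in every class of X^a_{c,d}, for all a. *)
Definition Xreps (c d : triple) (X : triple -> set k) : Prop :=
  forall a, Tcd c d a ->
    X a `<=` @runit k /\
    forall x, runit x -> exists! y, X a y /\ Xeq c d a x y.

Definition mx3 (s : seq (seq k)) : 'M[k]_3 :=
  \matrix_(i, j) nth 0 (nth [::] s i) j.

Variable pi : k.

Definition tmx (a : triple) (x : k) : 'M[k]_3 :=
  mx3 [:: [:: 1; 0; 0]; [:: pi ^ a.(t1); 1; 0];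
          [:: x * pi ^ a.(t3); pi ^ a.(t2); 1]].
Definition s1mx (al be : int) : 'M[k]_3 :=
  mx3 [:: [:: 0; 1; 0]; [:: 1; 0; 0]; [:: pi ^ be; pi ^ al; 1]].
Definition s2mx (al be : int) : 'M[k]_3 :=
  mx3 [:: [:: 1; 0; 0]; [:: pi ^ be; 0; 1]; [:: pi ^ al; 1; 0]].
Definition s12mx (al : int) : 'M[k]_3 :=
  mx3 [:: [:: 0; 0; 1]; [:: 1; 0; 0]; [:: pi ^ al; 1; 0]].
Definition s21mx (al : int) : 'M[k]_3 :=
  mx3 [:: [:: 0; 1; 0]; [:: 0; pi ^ al; 1]; [:: 1; 0; 0]].
Definition w0mx : 'M[k]_3 :=
  mx3 [:: [:: 0; 0; 1]; [:: 0; 1; 0]; [:: 1; 0; 0]].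

Variables (X : triple -> set k) (c d : triple).

Definition R1 : set 'M[k]_3 :=
  [set g : 'M[k]_3 | exists a x, [/\ Tcd c d a, X a x & g = tmx a x]].
Definition Rs1 : set 'M[k]_3 :=
  [set g : 'M[k]_3 | exists al be,
    [/\ 1 <= al <= Num.min (under d.(t2)) c.(t3),
        1 <= be <= Num.min (under c.(t2)) d.(t3),
        - c.(t1) <= be - al <= d.(t1) & g = s1mx al be]].
Definition Rs2 : set 'M[k]_3 :=
  [set g : 'M[k]_3 | exists al be,
    [/\ 1 <= al <= Num.min (under d.(t1)) c.(t3),
        1 <= be <= Num.min (under c.(t1)) d.(t3),
        - c.(t2) <= be - al <= d.(t2) & g = s2mx al be]].
Definition Rs12 : set 'M[k]_3 :=
  [set g : 'M[k]_3 | exists2 al, 1 <= al <= Num.min d.(t1) c.(t2) & g = s12mx al].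
Definition Rs21 : set 'M[k]_3 :=
  [set g : 'M[k]_3 | exists2 al, 1 <= al <= Num.min c.(t1) d.(t2) & g = s21mx al].

(* The product of 'S_3 composes from left to right: s2 * s1 is the
   composition of functions usually written s_1 s_2. *)
Definition Rw (w : 'S_3) : set 'M[k]_3 :=
  if w == 1%g then R1
  else if w == s1 then Rs1
  else if w == s2 then Rs2
  else if w == (s2 * s1)%g then Rs12
  else if w == (s1 * s2)%g then Rs21
  else [set w0mx].

(* The three alternatives, by the sign of a_1 + a_2 - a_3, that are common to
   the cases a_1 < M (with L = M) and a_2 < N (with L = N). *)
Definition suppcond (L : int) (a : triple) (x : k) : Prop :=
  [\/ a.(t1) + a.(t2) < a.(t3) /\
      L <= mins (sub3 c a ++ sub3 d a
                 ++ [:: c.(t2) + a.(t1) - a.(t3); d.(t1) + a.(t2) - a.(t3)]),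
      a.(t1) + a.(t2) > a.(t3) /\
      L <= mins (sub3 c (op3 a) ++ sub3 d (op3 a))
    | [/\ a.(t1) + a.(t2) = a.(t3),
          L <= mins (sub3 c a ++ sub3 d a)
        & tval (x - 1) (acd' c d a) <= acd' c d a - L]].

Variables M N : nat.

Definition S1 : set 'M[k]_3 :=
  [set g : 'M[k]_3 | exists a x, [/\ Tcd c d a, X a x, g = tmx a x &
    [\/ M%:Z <= a.(t1) /\ N%:Z <= a.(t2),
        [/\ a.(t1) < M%:Z, N%:Z <= a.(t2) & suppcond M a x]
      | [/\ N%:Z <= a.(t1), a.(t2) < N%:Z & suppcond N a x]]]].
Definition Ss1 : set 'M[k]_3 :=
  [set g : 'M[k]_3 | exists al be,
    [/\ N%:Z <= al <= Num.min d.(t2) c.(t3) - M%:Z,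
        N%:Z <= be <= Num.min c.(t2) d.(t3) - M%:Z,
        M%:Z - c.(t1) <= be - al <= d.(t1) - M%:Z & g = s1mx al be]].
Definition Ss2 : set 'M[k]_3 :=
  [set g : 'M[k]_3 | exists al be,
    [/\ N%:Z <= al <= Num.min d.(t1) c.(t3) - N%:Z,
        N%:Z <= be <= Num.min c.(t1) d.(t3) - N%:Z,
        N%:Z - c.(t2) <= be - al <= d.(t2) - N%:Z & g = s2mx al be]].

Definition Sw (w : 'S_3) : set 'M[k]_3 :=
  if w == 1%g then S1
  else if w == s1 then Ss1
  else if w == s2 then Ss2
  else set0.

Definition Scd : set 'M[k]_3 := \bigcup_(w in Wcd c d) Sw w.

End DoubleCosets.

Section Hecke.
Variables (R : realType) (k : padicField).
Variables (chi2 chi3 : k -> R[i]) (M : nat).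

(* M is the conductor of chi2; when M = 0 the entry g_22 need not be a unit. *)
Definition chi (g : 'M[k]_3) : R[i] :=
  (if M == 0%N then 1 else chi2 (g 1 1)) * chi3 (g 2 2).

(* A function on GL3R is given as a function on all matrices, whose values
   outside GL3R are ignored. *)
Definition Hecke (c d : triple) : set ('M[k]_3 -> R[i]) :=
  [set f | forall g x g', Cgrp c g -> GL3R x -> Cgrp d g' ->
     f (g *m x *m g') = chi g * f x * chi g'].

Definition supports (c d : triple) (D : set 'M[k]_3) : Prop :=
  exists f, [/\ Hecke c d f, exists2 x, GL3R x & f x != 0
    & forall x, GL3R x -> f x != 0 -> D x].

Definition reps_of_support (c d : triple) (S : set 'M[k]_3) : Prop :=
  (forall g, S g -> GL3R g /\ supports c d (dcoset c d g)) /\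
  (forall g, GL3R g -> supports c d (dcoset c d g) ->
     exists! s, S s /\ dcoset c d g s).

End Hecke.

(* Main.v *)
(* A double coset C_c g C_d supports a Hecke function iff chi_c(h) = chi_d(h')
   whenever h g = g h' with h in C_c and h' in C_d.  Gaussian elimination brings
   every g in K, by upper triangular matrices, to one of six shapes, one for each
   element of the Weyl group.  The three shapes with a permutation of order 3 or
   w_0 never satisfy the condition, as a torus element moves chi_3 alone.

   The main case is the lower unipotent t with entries A = t_21, B = t_32,
   Z = t_31.  Put D = A B - Z, the lower left entry of t^-1.  The equation
   h t = t h' yields
     Z D (h_22 - h'_22) = - B D h'_21 + A D h_32 - Z B h_21 + Z A h'_32
                          + A B (h_31 - h'_31),
   and all the terms on the right can be varied independently by explicit pairs
   (h, h').  The conditions (a), (b), (c) of the theorem are what makes each term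
   small enough for the relevant character to be trivial on h_22 / h'_22; they only
   differ by the value of val D, which is a_1 + a_2, a_3 or a_3 + val(x - 1).

   Comparing valuations in the entries of h g = g' h' separates the double cosets
   of the representatives.  (Matrix entries are numbered from 1 here and in the
   statement, from 0 in the code.) *)

Require Import Defs.
From mathcomp Require Import all_boot all_order all_fingroup all_algebra.
From mathcomp Require Import all_classical reals.
From mathcomp Require Import complex.
From mathcomp Require Import zify ring.
Set Implicit Arguments.
Unset Strict Implicit.
Unset Printing Implicit Defensive.
Import Order.TTheory GRing.Theory Num.Theory.
Local Open Scope classical_set_scope.
Local Open Scope ring_scope.

(** * Valuations and 3 x 3 matrices *)

(** The pairs (h, h') behind the necessary conditions must have unit diagonal. For the terms in
    [h 2 0] and [h' 2 0] one diagonal entry is 1 + r with r known to be integral only. As 2 is a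
    unit, 1 + r or 1 - r is a unit, and v may be replaced by - v. That 2 is a unit serves again in
    the reduction to normal form, where an entry is changed by an element of its own valuation and
    must keep that valuation.

    When c_1 or d_1 vanishes, s_1 lies in C_c or C_d, so its cell merges into the lower unipotent
    one; the s_2 cell supports nothing, because M = 0 and an unconstrained entry lets chi_3 move
    alone. In this degenerate situation the first two diagonal entries of a group element need not
    be units.

    Compatibility is known along a whole double coset, so it is only tested on convenient
    representatives. For the parameter x, each term of the minima a(c,d) and a(c,d)' plays two
    roles: it bounds an error when equal double cosets are shown to have equivalent parameters, and
    it provides a move in the converse. *)

Section Valuation.
Context {k : padicField}.
Implicit Types (x y u v : k) (m n : int).

Lemma valkM x y : x != 0 -> y != 0 -> valk (x * y) = valk x + valk y.
Proof. exact: Defs.valM. Qed.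

Lemma valkD x y : x != 0 -> y != 0 -> x + y != 0 ->
  Num.min (valk x) (valk y) <= valk (x + y).
Proof. exact: Defs.valD. Qed.

Lemma valk1 : valk (1 : k) = 0.
Proof.
have := @valkM 1 1 (oner_neq0 _) (oner_neq0 _); rewrite mulr1; lia.
Qed.

Lemma valkN x : valk (- x) = valk x.
Proof.
have [->|x0] := eqVneq x 0; first by rewrite oppr0.
have n1 : (-1 : k) != 0 by rewrite oppr_eq0 oner_eq0.
have := @valkM (-1) (-1) n1 n1; rewrite mulrNN mulr1 valk1 => h.
rewrite -mulN1r valkM //; lia.
Qed.

Lemma valkV x : x != 0 -> valk x^-1 = - valk x.
Proof.
move=> x0; have := @valkM x x^-1 x0 (invr_neq0 x0).
rewrite divff // valk1; lia.
Qed.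

Lemma valk_div x y : x != 0 -> y != 0 -> valk (x / y) = valk x - valk y.
Proof. by move=> x0 y0; rewrite valkM ?invr_neq0 // valkV. Qed.

Lemma idl0 n : idl n (0 : k).
Proof. by left. Qed.

Lemma idl_val x : idl (valk x) x.
Proof. by right. Qed.

Lemma idl_neq0 n x : x != 0 -> idl n x <-> n <= valk x.
Proof. by move=> x0; split=> [[/eqP|//]|h]; [rewrite (negPf x0)|right]. Qed.

Lemma idl_le m n x : idl m x -> n <= m -> idl n x.
Proof. by case=> [->|h] nm; [left|right; lia]. Qed.

Lemma idlD m n x y : idl m x -> idl n y -> idl (Num.min m n) (x + y).
Proof.
have [->|x0] := eqVneq x 0.
  by move=> _ h; rewrite add0r; apply: idl_le h _; lia.
have [->|y0] := eqVneq y 0.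
  by move=> h _; rewrite addr0; apply: idl_le h _; lia.
have [->|xy0] := eqVneq (x + y) 0; first by left.
move=> /(idl_neq0 _ x0) hx /(idl_neq0 _ y0) hy; right.
have := @valkD x y x0 y0 xy0; lia.
Qed.

Lemma idlN n x : idl n x -> idl n (- x).
Proof. by case=> [->|h]; [left; rewrite oppr0|right; rewrite valkN]. Qed.

Lemma idlM m n x y : idl m x -> idl n y -> idl (m + n) (x * y).
Proof.
have [->|x0] := eqVneq x 0; first by rewrite mul0r => _ _; left.
have [->|y0] := eqVneq y 0; first by rewrite mulr0 => _ _; left.
move=> /(idl_neq0 _ x0) hx /(idl_neq0 _ y0) hy.
by right; rewrite valkM //; lia.
Qed.

Lemma idlV x : x != 0 -> idl (- valk x) x^-1.
Proof. by move=> x0; right; rewrite valkV. Qed.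

Lemma idl1 : idl 0 (1 : k).
Proof. by right; rewrite valk1. Qed.

Lemma runit_neq0 u : runit u -> u != 0.
Proof. by case. Qed.

Lemma runit_idl u : runit u -> idl 0 u.
Proof. by case=> _ h; right; rewrite h. Qed.

Lemma runitV_idl u : runit u -> idl 0 u^-1.
Proof. by case=> u0 h; right; rewrite valkV // h. Qed.

Lemma runit1 : runit (1 : k).
Proof. by split; [exact: oner_neq0|exact: valk1]. Qed.

Lemma runitM u v : runit u -> runit v -> runit (u * v).
Proof.
by move=> [u0 hu] [v0 hv]; split; [rewrite mulf_neq0|rewrite valkM // hu hv].
Qed.

Lemma runitV u : runit u -> runit u^-1.
Proof. by move=> [u0 hu]; split; [rewrite invr_neq0|rewrite valkV // hu]. Qed.

Lemma runitN u : runit u -> runit (- u).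
Proof. by move=> [u0 hu]; split; [rewrite oppr_eq0|rewrite valkN]. Qed.

Lemma runit_or x : idl 0 x -> runit x \/ idl 1 x.
Proof.
case=> [->|h]; first by right; left.
have [->|x0] := eqVneq x 0; first by right; left.
have [e|ne] := eqVneq (valk x) 0; first by left.
by right; right; lia.
Qed.

Lemma runit_idl1 u : runit u -> idl 1 u -> False.
Proof. by move=> [u0 hu] /(idl_neq0 _ u0); rewrite hu. Qed.

(** The bound on [y] is membership in an ideal, which also covers [y = 0], where [valk] says
    nothing. *)
Lemma valkD_lt x y n : x != 0 -> idl n y -> valk x < n ->
  x + y != 0 /\ valk (x + y) = valk x.
Proof.
move=> x0 hy lt.
have xy0 : x + y != 0.
  apply/eqP => /eqP; rewrite addr_eq0 => /eqP xy.
  by have := idlN hy; rewrite -xy => /(idl_neq0 _ x0); lia.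
split=> //.
have h1 : idl (valk x + 1) (- y) by apply: idl_le (idlN hy) _; lia.
have := idlD (idl_val (x + y)) h1.
rewrite addrK => /(idl_neq0 _ x0).
have := idlD (idl_val x) hy => /(idl_neq0 _ xy0); lia.
Qed.

Lemma runitD u v : runit u -> idl 1 v -> runit (u + v).
Proof.
move=> [u0 hu] hv; have [|h1 h2] := @valkD_lt u v 1 u0 hv; first by lia.
by split=> //; rewrite h2.
Qed.

Lemma idl_unitl u n x : runit u -> idl n (u * x) -> idl n x.
Proof.
move=> uu /(idlM (runitV_idl uu)).
by rewrite mulKf ?runit_neq0 // add0r.
Qed.

Lemma idl_unitD n x y : idl n (x - y) -> 0 < n -> runit y -> runit x.
Proof.
move=> h n0 uy; rewrite -(subrK y x) addrC; apply: runitD => //.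
by apply: idl_le h _; lia.
Qed.

Lemma val_mul_unit u x : runit u -> x != 0 -> valk (u * x) = valk x.
Proof. by move=> [u0 hu] x0; rewrite valkM // hu add0r. Qed.

End Valuation.

(** [idl_tac] adds up the bounds of the atoms of an expression and leaves the comparison of
    exponents to [lia]. An atom may have several bounds (a hypothesis, being a unit, its own
    valuation) and a compound term may be bounded as a whole; these choices are open to backtracking
    when [lia] fails. *)
Ltac idl_atom :=
  lazymatch goal with
  | |- idl _ ?x =>
     multimatch goal with
     | H : idl _ x |- _ => exact H
     | H : runit x |- _ => exact: (runit_idl H)
     | H : is_true (x != 0) |- _ => exact: idl_val
     end
  end.
Ltac idl_struct :=
  lazymatch goal with
  | |- idl _ 0 => exact: idl0
  | |- idl _ (1) => exact: idl1
  | |- idl _ (_ + _) => idl_atom + (eapply idlD; [idl_struct|idl_struct])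
  | |- idl _ (- _) => eapply idlN; idl_struct
  | |- idl _ (_ * _) => idl_atom + (eapply idlM; [idl_struct|idl_struct])
  | |- idl _ (?x^-1) =>
     first [ multimatch goal with H : runit x |- _ => exact: (runitV_idl H) end
           | apply: idlV; first [assumption | apply: runit_neq0; assumption]]
  | |- idl _ ?x => idl_atom
  end.
Ltac idl_tac := first [exact: idl0 | eapply idl_le; [idl_struct | lia]].

Section Matrices.
Context {k : padicField}.
Implicit Types (g h : 'M[k]_3) (c d : triple).

Definition M3 (a b c d e f g h i : k) : 'M[k]_3 :=
  mx3 [:: [:: a; b; c]; [:: d; e; f]; [:: g; h; i]].

Lemma forall3 (P : 'I_3 -> Prop) : P 0 -> P 1 -> P 2 -> forall i, P i.
Proof.
move=> h0 h1 h2 [[|[|[|//]]] i].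
- by have -> : Ordinal i = 0 by apply: val_inj.
- by have -> : Ordinal i = 1 by apply: val_inj.
- by have -> : Ordinal i = 2 by apply: val_inj.
Qed.

Lemma matrix3P g h :
  g 0 0 = h 0 0 -> g 0 1 = h 0 1 -> g 0 2 = h 0 2 ->
  g 1 0 = h 1 0 -> g 1 1 = h 1 1 -> g 1 2 = h 1 2 ->
  g 2 0 = h 2 0 -> g 2 1 = h 2 1 -> g 2 2 = h 2 2 -> g = h.
Proof.
by move=> *; apply/matrixP; apply: forall3; apply: forall3.
Qed.

Lemma sum3 (F : 'I_3 -> k) : \sum_i F i = F 0 + F 1 + F 2.
Proof.
rewrite !big_ord_recl big_ord0 addr0 addrA; congr (F _ + F _ + F _); exact: val_inj.
Qed.

Lemma mulmx3 g h i j :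
  (g *m h) i j = g i 0 * h 0 j + g i 1 * h 1 j + g i 2 * h 2 j.
Proof. by rewrite mxE sum3. Qed.

Lemma M3_eta g : g = M3 (g 0 0) (g 0 1) (g 0 2) (g 1 0) (g 1 1) (g 1 2)
  (g 2 0) (g 2 1) (g 2 2).
Proof. by apply: matrix3P; rewrite mxE. Qed.

Definition det3 (a b c d e f g h i : k) : k :=
  a * (e * i - f * h) - b * (d * i - f * g) + c * (d * h - e * g).

Lemma det_mx22 (A : 'M[k]_2) : \det A = A 0 0 * A 1 1 - A 0 1 * A 1 0.
Proof.
rewrite (expand_det_row _ 0) big_ord_recl big_ord1 /cofactor !det_mx11 !mxE.
rewrite /= expr0 expr1 mul1r mulN1r mulrN.
by congr (_ * A _ _ - A _ _ * A _ _); apply: val_inj.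
Qed.

Lemma det_M3 g : \det g = det3 (g 0 0) (g 0 1) (g 0 2) (g 1 0) (g 1 1) (g 1 2)
  (g 2 0) (g 2 1) (g 2 2).
Proof.
rewrite (expand_det_row _ 0) sum3 /cofactor !det_mx22 /det3 !mxE.
have -> : lift 0 0 = 1 :> 'I_3 by apply: val_inj.
have -> : lift 0 1 = 2 :> 'I_3 by apply: val_inj.
have -> : lift 1 0 = 0 :> 'I_3 by apply: val_inj.
have -> : lift 1 1 = 2 :> 'I_3 by apply: val_inj.
have -> : lift 2 0 = 0 :> 'I_3 by apply: val_inj.
have -> : lift 2 1 = 1 :> 'I_3 by apply: val_inj.
rewrite /= expr0 expr1 [_ ^+ _]expr2.
ring.
Qed.

Lemma M3_mul (a b c d e f g h i a' b' c' d' e' f' g' h' i' : k) :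
  M3 a b c d e f g h i *m M3 a' b' c' d' e' f' g' h' i' =
  M3 (a * a' + b * d' + c * g') (a * b' + b * e' + c * h') (a * c' + b * f' + c * i')
     (d * a' + e * d' + f * g') (d * b' + e * e' + f * h') (d * c' + e * f' + f * i')
     (g * a' + h * d' + i * g') (g * b' + h * e' + i * h') (g * c' + h * f' + i * i').
Proof. by apply: matrix3P; rewrite mulmx3 !mxE. Qed.

Definition adj3 g : 'M[k]_3 := M3
  (g 1 1 * g 2 2 - g 1 2 * g 2 1) (g 0 2 * g 2 1 - g 0 1 * g 2 2) (g 0 1 * g 1 2 - g 0 2 * g 1 1)
  (g 1 2 * g 2 0 - g 1 0 * g 2 2) (g 0 0 * g 2 2 - g 0 2 * g 2 0) (g 0 2 * g 1 0 - g 0 0 * g 1 2)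
  (g 1 0 * g 2 1 - g 1 1 * g 2 0) (g 0 1 * g 2 0 - g 0 0 * g 2 1) (g 0 0 * g 1 1 - g 0 1 * g 1 0).

Lemma mulmx_adj3 g : g *m adj3 g = (\det g)%:M.
Proof.
rewrite det_M3 /det3; apply: matrix3P; rewrite mulmx3 !mxE /=; ring.
Qed.

Lemma invmx3 g : \det g != 0 -> invmx g = (\det g)^-1 *: adj3 g.
Proof.
move=> d0; have ug : g \in unitmx by rewrite unitmxE unitfE.
rewrite -[RHS]mul1mx -(mulVmx ug) -mulmxA -scalemxAr mulmx_adj3.
by rewrite scale_scalar_mx mulVf // mulmx1.
Qed.

End Matrices.

(** * The groups C_c and their double cosets *)

Section Groups.
Context {k : padicField}.
Implicit Types (g h : 'M[k]_3) (c d : triple).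

Lemma int_mx3 g :
  idl 0 (g 0 0) -> idl 0 (g 0 1) -> idl 0 (g 0 2) ->
  idl 0 (g 1 0) -> idl 0 (g 1 1) -> idl 0 (g 1 2) ->
  idl 0 (g 2 0) -> idl 0 (g 2 1) -> idl 0 (g 2 2) -> forall i j, idl 0 (g i j).
Proof.
move=> *; apply: (@forall3 (fun i => forall j, idl 0 (g i j))).
all: by apply: (@forall3 (fun j => idl 0 (g _ j))).
Qed.

Lemma GL3R_int g : GL3R g -> forall i j, idl 0 (g i j).
Proof. by case. Qed.

Lemma GL3R_unitmx g : GL3R g -> g \in unitmx.
Proof. by case=> _ [d0 _]; rewrite unitmxE unitfE. Qed.

Lemma GL3RM g h : GL3R g -> GL3R h -> GL3R (g *m h).
Proof.
move=> [hg ug] [hh uh]; split; last by rewrite det_mulmx; apply: runitM.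
move=> i j; rewrite mulmx3.
have := hg i 0; have := hg i 1; have := hg i 2.
have := hh 0 j; have := hh 1 j; have := hh 2 j => *; idl_tac.
Qed.

Lemma GL3RV g : GL3R g -> GL3R (invmx g).
Proof.
move=> [hg ug]; split; last first.
  by rewrite det_inv; apply: runitV.
rewrite invmx3 ?runit_neq0 //.
have := hg 0 0; have := hg 0 1; have := hg 0 2.
have := hg 1 0; have := hg 1 1; have := hg 1 2.
have := hg 2 0; have := hg 2 1; have := hg 2 2 => *.
by apply: int_mx3; rewrite !mxE /=; idl_tac.
Qed.

Lemma Cgrp_GL c g : Cgrp c g -> GL3R g.
Proof. by case. Qed.

Lemma Cgrp1 c : Cgrp c (1%:M : 'M[k]_3).
Proof.
split; first split.
- by move=> i j; rewrite mxE; case: eqP => _; [exact: idl1|exact: idl0].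
- by rewrite det1; apply: runit1.
all: by rewrite mxE; apply: idl0.
Qed.

(** The inequalities of [TT] are what closes C_c under products: c_3 <= c_1 + c_2 absorbs
    [g 2 1 * h 1 0] in the corner, and c_1, c_2 <= c_3 absorb the corner entries in the two entries
    next to the diagonal. *)
Lemma CgrpM c g h : TT c -> Cgrp c g -> Cgrp c h -> Cgrp c (g *m h).
Proof.
move=> [c1 c2 c3 c4 c5] [Gg g10 g21 g20] [Gh h10 h21 h20].
split; [exact: GL3RM|..]; rewrite mulmx3.
all: have := GL3R_int Gg 0 0; have := GL3R_int Gg 0 1; have := GL3R_int Gg 0 2.
all: have := GL3R_int Gg 1 1; have := GL3R_int Gg 1 2; have := GL3R_int Gg 2 2.
all: have := GL3R_int Gh 0 0; have := GL3R_int Gh 0 1; have := GL3R_int Gh 0 2.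
all: have := GL3R_int Gh 1 1; have := GL3R_int Gh 1 2; have := GL3R_int Gh 2 2.
all: move=> *; idl_tac.
Qed.

Lemma CgrpV c g : TT c -> Cgrp c g -> Cgrp c (invmx g).
Proof.
move=> [c1 c2 c3 c4 c5] [Gg g10 g21 g20].
split; [exact: GL3RV|..]; case: (Gg) => _ ud; rewrite invmx3 ?runit_neq0 // !mxE /=.
all: have := GL3R_int Gg 0 0; have := GL3R_int Gg 0 1; have := GL3R_int Gg 0 2.
all: have := GL3R_int Gg 1 1; have := GL3R_int Gg 1 2; have := GL3R_int Gg 2 2.
all: move=> *; idl_tac.
Qed.

(** Membership in a double coset without inverses: an explicit pair is then checked by nine
    identities between entries. *)
Definition dceq c d g g' : Prop :=
  exists h h', [/\ Cgrp c h, Cgrp d h' & h *m g = g' *m h'].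

Lemma dceq_refl c d g : dceq c d g g.
Proof. by exists 1%:M, 1%:M; rewrite mul1mx mulmx1; split=> //; exact: Cgrp1. Qed.

Lemma dceq_sym c d g g' : TT c -> TT d -> dceq c d g g' -> dceq c d g' g.
Proof.
move=> Tc Td [h [h' [Ch Ch' e]]].
exists (invmx h), (invmx h'); split; [exact: CgrpV|exact: CgrpV|].
have uh := GL3R_unitmx (Cgrp_GL Ch); have uh' := GL3R_unitmx (Cgrp_GL Ch').
by rewrite -[g](mulKmx uh) e -!mulmxA mulmxV // mulmx1.
Qed.

Lemma dceq_trans c d g1 g2 g3 : TT c -> TT d ->
  dceq c d g1 g2 -> dceq c d g2 g3 -> dceq c d g1 g3.
Proof.
move=> Tc Td [h [h' [Ch Ch' e]]] [i [i' [Ci Ci' e']]].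
exists (i *m h), (i' *m h'); split; [exact: CgrpM|exact: CgrpM|].
by rewrite -mulmxA e mulmxA e' mulmxA.
Qed.

Lemma dcosetP c d g g' : TT c -> TT d -> dcoset c d g g' <-> dceq c d g g'.
Proof.
move=> Tc Td; split=> [[h [h' [Ch Ch' ->]]]|[h [h' [Ch Ch' e]]]].
  exists h, (invmx h'); split=> //; first exact: CgrpV.
  by rewrite -mulmxA mulmxV ?mulmx1 // (GL3R_unitmx (Cgrp_GL Ch')).
exists h, (invmx h'); split=> //; first exact: CgrpV.
by rewrite e -mulmxA mulmxV ?mulmx1 // (GL3R_unitmx (Cgrp_GL Ch')).
Qed.

End Groups.

(** * Hecke functions and compatibility on stabilizers *)

Section MulChar.
Context {R : realType} {k : padicField}.
Implicit Types psi : k -> R[i].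

Lemma mul_char_neq0 psi u : mul_char psi -> u != 0 -> psi u != 0.
Proof.
move=> [h1 hM] u0; apply/eqP => e.
have := hM u u^-1; rewrite !inE u0 invr_eq0 u0 divff // h1 e mul0r => /(_ isT isT).
by move/eqP; rewrite oner_eq0.
Qed.

Lemma mul_charM psi u v : mul_char psi -> u != 0 -> v != 0 ->
  psi (u * v) = psi u * psi v.
Proof. by move=> [_ hM] u0 v0; apply: hM; rewrite inE. Qed.

Lemma mul_char_div psi1 psi2 : mul_char psi1 -> mul_char psi2 ->
  mul_char (fun x => psi1 x / psi2 x).
Proof.
move=> h1 h2; split; first by rewrite h1.1 h2.1 divr1.
move=> u v; rewrite !inE => u0 v0.
by rewrite !mul_charM // invfM mulrACA.
Qed.

Lemma trivial_on_level_eq psi m u v : mul_char psi -> trivial_on_level psi m ->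
  runit u -> runit v -> idl m (u - v) -> psi u = psi v.
Proof.
move=> hpsi hm uu uv huv.
have -> : u = (u / v) * v by rewrite mulfVK ?runit_neq0.
rewrite mul_charM ?runit_neq0 //; last by apply: runitM => //; apply: runitV.
rewrite hm ?mul1r //; first by apply: runitM => //; apply: runitV.
have -> : u / v - 1 = (u - v) / v by rewrite mulrBl divff ?runit_neq0.
by have := idlM huv (runitV_idl uv); rewrite addr0.
Qed.

(** Source of all lower bounds by M or N: a bound holds as soon as suitable pairs show the character
    to be trivial on 1 + p^n. *)
Lemma conductor_le psi m (n : int) : conductor psi m -> 0 <= n ->
  (forall v, idl n v -> runit (1 + v) -> psi (1 + v) = 1) -> m%:Z <= n.
Proof.
case: n => // n [_ hm] _ h; rewrite lez_nat; apply: hm => x ux hx.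
by have := h (x - 1) hx; rewrite addrC subrK; apply.
Qed.

End MulChar.

Section CgrpUnits.
Context {k : padicField} {c : triple}.
Implicit Type h : 'M[k]_3.
Hypotheses (c2 : 1 <= c.(t2)) (c3 : 1 <= c.(t3)).

(** As c_1 may be 0, the reduction of [h] modulo p is only block triangular, with diagonal blocks of
    size 2 and 1. *)
Lemma Cgrp_unit h : Cgrp c h ->
  runit (h 2 2) /\ runit (h 0 0 * h 1 1 - h 0 1 * h 1 0).
Proof.
move=> [[hi]]; rewrite det_M3 /det3 => ud h10 h21 h20.
have := hi 0 0; have := hi 0 1; have := hi 0 2.
have := hi 1 0; have := hi 1 1; have := hi 1 2; have := hi 2 2 => *.
have : runit (h 2 2 * (h 0 0 * h 1 1 - h 0 1 * h 1 0)).
  apply: (@idl_unitD _ 1) ud => //.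
  set X := (X in idl 1 X).
  have -> : X = h 0 0 * h 1 2 * h 2 1 - h 0 1 * h 1 2 * h 2 0
    - h 0 2 * h 1 0 * h 2 1 + h 0 2 * h 1 1 * h 2 0 by rewrite /X; ring.
  idl_tac.
move=> um.
have [?|h22] := @runit_or _ (h 2 2) ltac:(assumption).
  split=> //; have -> : h 0 0 * h 1 1 - h 0 1 * h 1 0 =
    (h 2 2)^-1 * (h 2 2 * (h 0 0 * h 1 1 - h 0 1 * h 1 0)).
    by rewrite mulKf ?runit_neq0.
  by apply: runitM => //; apply: runitV.
by case: (runit_idl1 um); idl_tac.
Qed.

Lemma Cgrp_diag_unit h : 1 <= c.(t1) -> Cgrp c h ->
  [/\ runit (h 0 0), runit (h 1 1) & runit (h 2 2)].
Proof.
move=> c1 Ch; have [u22 um] := Cgrp_unit Ch.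
case: Ch => [[hi _] h10 h21 h20].
have := hi 0 0; have := hi 0 1; have := hi 1 1 => *.
have u : runit (h 0 0 * h 1 1).
  rewrite -(subrK (h 0 1 * h 1 0) (h 0 0 * h 1 1)).
  by apply: runitD => //; idl_tac.
have [?|?] := @runit_or _ (h 0 0) ltac:(assumption); last first.
  by case: (runit_idl1 u); idl_tac.
have [?|?] := @runit_or _ (h 1 1) ltac:(assumption) => //.
by case: (runit_idl1 u); idl_tac.
Qed.

(** The last premise stands in for c_1 >= 1: it makes the determinant congruent to the product of
    the diagonal entries modulo p even when c_1 = 0. *)
Lemma Cgrp_M3 (x00 x01 x02 x10 x11 x12 x20 x21 x22 : k) :
  0 <= c.(t1) ->
  idl 0 x01 -> idl 0 x02 -> idl 0 x12 ->
  runit x00 -> runit x11 -> runit x22 ->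
  idl c.(t1) x10 -> idl c.(t2) x21 -> idl c.(t3) x20 -> idl 1 (x01 * x10) ->
  Cgrp c (M3 x00 x01 x02 x10 x11 x12 x20 x21 x22).
Proof.
move=> c1 i01 i02 i12 u0 u1 u2 i10 i21 i20 i0110.
split; rewrite ?mxE //=; split.
  by apply: int_mx3; rewrite mxE /=; idl_tac.
rewrite det_M3 !mxE /= /det3.
have -> : x00 * (x11 * x22 - x12 * x21) - x01 * (x10 * x22 - x12 * x20) +
  x02 * (x10 * x21 - x11 * x20) = x00 * x11 * x22 + (- x00 * (x12 * x21)
  - x01 * x10 * x22 + x01 * x12 * x20 + x02 * x10 * x21 - x02 * x11 * x20).
  by ring.
by apply: runitD; [by apply: runitM => //; apply: runitM|idl_tac].
Qed.

End CgrpUnits.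

Section Compat.
Context {R : realType} {k : padicField} {chi2 chi3 : k -> R[i]} {M N : nat}.
Hypotheses (hchi2 : mul_char chi2) (hchi3 : mul_char chi3).
Hypotheses (hM : conductor chi2 M) (hN : conductor chi3 N).
Hypotheses (hMN : (M <= N)%N) (hN0 : (0 < N)%N).
Implicit Types (c d : triple) (g h : 'M[k]_3).
Local Notation chi := (chi chi2 chi3 M).
Local Notation m := (Triple M N N).

Lemma chi1 : chi 1%:M = 1.
Proof. by rewrite /Defs.chi !mxE /= hchi2.1 hchi3.1 mulr1; case: ifP. Qed.

(** Since c dominates (M, N, N), the off-diagonal contributions to the last two diagonal entries of
    [g *m h] lie in p^M and p^N. For M = 0 the middle entry may be a non-unit, but then it is not
    evaluated. *)
Lemma chiM c g h : TTm m c -> Cgrp c g -> Cgrp c h ->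
  chi (g *m h) = chi g * chi h.
Proof.
move=> [Tc [/= m1 m2 m3]] Cg Ch; have [q1 q2 q3 q4 q5] := Tc.
have [c2 c3] : 1 <= c.(t2) /\ 1 <= c.(t3) by lia.
have Cgh := CgrpM Tc Cg Ch.
have [ug22 _] := Cgrp_unit c2 c3 Cg; have [uh22 _] := Cgrp_unit c2 c3 Ch.
have [ugh22 _] := Cgrp_unit c2 c3 Cgh.
rewrite /Defs.chi [RHS]mulrACA; congr (_ * _).
  case: eqP => [_|M0]; first by rewrite mulr1.
  have c1 : 1 <= c.(t1) by lia.
  have [_ ug _] := Cgrp_diag_unit c2 c3 c1 Cg.
  have [_ uh _] := Cgrp_diag_unit c2 c3 c1 Ch.
  have [_ ugh _] := Cgrp_diag_unit c2 c3 c1 Cgh.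
  rewrite -mul_charM ?runit_neq0 //.
  apply: (trivial_on_level_eq hchi2 hM.1) => //; first exact: runitM.
  have -> : (g *m h) 1 1 - g 1 1 * h 1 1 = g 1 0 * h 0 1 + g 1 2 * h 2 1.
    by rewrite mulmx3; ring.
  case: (Cg) (Ch) => -[gi _] ? ? ? [[hi _] ? ? ?].
  have := gi 1 2; have := hi 0 1 => *; idl_tac.
rewrite -mul_charM ?runit_neq0 //.
apply: (trivial_on_level_eq hchi3 hN.1) => //; first exact: runitM.
have -> : (g *m h) 2 2 - g 2 2 * h 2 2 = g 2 0 * h 0 2 + g 2 1 * h 1 2.
  by rewrite mulmx3; ring.
case: (Cg) (Ch) => -[gi _] ? ? ? [[hi _] ? ? ?].
have := hi 1 2; have := hi 0 2 => *; idl_tac.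
Qed.

Lemma chi_neq0 c g : TTm m c -> Cgrp c g -> chi g != 0.
Proof.
move=> Tc Cg; have Cg' := CgrpV Tc.1 Cg.
have := chiM Tc Cg Cg'; rewrite mulmxV ?(GL3R_unitmx (Cgrp_GL Cg)) // chi1.
by move=> /esym e; apply/eqP => e0; move/eqP: e; rewrite e0 mul0r eq_sym oner_eq0.
Qed.

Definition compat c d g : Prop := forall h h',
  Cgrp c h -> Cgrp d h' -> h *m g = g *m h' -> chi h = chi h'.

(** A supported function vanishes nowhere on its double coset, so evaluating it at h y = y h' works
    at every point y; hence the conclusion for any [g'] of the coset. *)
Lemma supports_compat c d g g' : TTm m c -> TTm m d -> GL3R g ->
  supports chi2 chi3 M c d (dcoset c d g) -> dceq c d g g' -> compat c d g'.
Proof.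
move=> Tc Td Gg [f [Hf [x Gx fx] sf]] /(dcosetP _ _ Tc.1 Td.1) [a [a' [Ca Ca' ->]]].
have [b [b' [Cb Cb' xE]]] := sf x Gx fx.
have fg : f g != 0.
  apply: contraNneq fx => fg0; rewrite xE Hf // fg0 mulr0 mul0r //.
set y := a *m g *m a'.
have Gy : GL3R y by apply: GL3RM (Cgrp_GL Ca'); apply: GL3RM Gg; apply: Cgrp_GL Ca.
have fy : f y != 0.
  by rewrite /y Hf // mulf_neq0 ?(chi_neq0 Td Ca') // mulf_neq0 ?(chi_neq0 Tc Ca).
move=> h h' Ch Ch' e.
have e1 : f (h *m y *m 1%:M) = chi h * f y by rewrite Hf ?chi1 ?mulr1 //; exact: Cgrp1.
have e2 : f (1%:M *m y *m h') = f y * chi h' by rewrite Hf ?chi1 ?mul1r //; exact: Cgrp1.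
apply: (mulIf fy); rewrite -e1 [RHS]mulrC -e2; congr f.
by rewrite mul1mx mulmx1.
Qed.

Lemma compat_supports c d g : TTm m c -> TTm m d -> GL3R g ->
  compat c d g -> supports chi2 chi3 M c d (dcoset c d g).
Proof.
move=> Tc Td Gg cg.
pose P y z := exists h h', [/\ Cgrp c h, Cgrp d h', y = h *m g *m h' & z = chi h * chi h'].
pose f y : R[i] := xget 0 (P y).
(* [f] is to be chi h * chi h' at h g h', and 0 off the double coset. Two factorizations h g h' = i
   g i' yield the pair (i^-1 h, i' h'^-1), to which [compat] applies; this makes [f] well
   defined. *)
have Puniq y z z' : P y z -> P y z' -> z = z'.
  move=> [h [h' [Ch Ch' -> ->]]] [i [i' [Ci Ci' e ->]]].
  have ui := GL3R_unitmx (Cgrp_GL Ci); have uh' := GL3R_unitmx (Cgrp_GL Ch').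
  have := cg _ _ (CgrpM Tc.1 (CgrpV Tc.1 Ci) Ch) (CgrpM Td.1 Ci' (CgrpV Td.1 Ch')).
  rewrite (chiM Tc (CgrpV Tc.1 Ci) Ch) (chiM Td Ci' (CgrpV Td.1 Ch')).
  have -> : invmx i *m h *m g = g *m (i' *m invmx h').
    rewrite [RHS]mulmxA -[LHS](mulmxK uh'); congr (_ *m _).
    by rewrite -!mulmxA (mulmxA h) e !mulmxA mulVmx // mul1mx.
  move/(_ erefl) => eq1.
  have v1 : chi (invmx i) * chi i = 1.
    by rewrite -(chiM Tc (CgrpV Tc.1 Ci) Ci) mulVmx // chi1.
  have v2 : chi (invmx h') * chi h' = 1.
    by rewrite -(chiM Td (CgrpV Td.1 Ch') Ch') mulVmx // chi1.
  transitivity (chi i * (chi (invmx i) * chi h) * chi h').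
    by rewrite mulrA [chi i * _]mulrC v1 mul1r.
  by rewrite eq1 [_ * (_ * _)]mulrA -mulrA v2 mulr1.
have fP y z : P y z -> f y = z.
  by move=> Pyz; rewrite /f; case: xgetP => [w _ Pw|/(_ z) //]; apply: Puniq Pw Pyz.
have f0 y : ~ (exists z, P y z) -> f y = 0.
  by move=> nP; rewrite /f; case: xgetP => // z _ Pz; case: nP; exists z.
exists f; split.
- move=> a y a' Ca Gy Ca'; have [[z Pz]|nP] := pselect (exists z, P y z).
    rewrite (fP _ _ Pz); apply: fP; case: Pz => h [h' [Ch Ch' -> ->]].
    exists (a *m h), (h' *m a'); split; [exact: CgrpM Tc.1 _ _|exact: CgrpM Td.1 _ _| |].
      by rewrite !mulmxA.
    by rewrite (chiM Tc) // (chiM Td) // !mulrA.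
  rewrite (f0 _ nP) mulr0 mul0r f0 // => -[z [h [h' [Ch Ch' e _]]]].
  apply: nP; exists (chi (invmx a *m h) * chi (h' *m invmx a')).
  exists (invmx a *m h), (h' *m invmx a'); split=> //.
  + by apply: CgrpM Tc.1 _ Ch; apply: CgrpV Tc.1 Ca.
  + by apply: CgrpM Td.1 Ch' _; apply: CgrpV Td.1 Ca'.
  have ua := GL3R_unitmx (Cgrp_GL Ca); have ua' := GL3R_unitmx (Cgrp_GL Ca').
  have {1}-> : y = invmx a *m (a *m y *m a') *m invmx a'.
    by rewrite -!mulmxA mulmxV // mulmx1 mulKmx.
  by rewrite e !mulmxA.
- exists g => //; rewrite (fP _ 1) ?oner_neq0 //.
  by exists 1%:M, 1%:M; rewrite mul1mx mulmx1 !chi1 mulr1; split=> //; exact: Cgrp1.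
- move=> y Gy fy; have [[z [h [h' [Ch Ch' -> _]]]]|nP] := pselect (exists z, P y z).
    by exists h, h'.
  by rewrite f0 ?eqxx in fy.
Qed.

End Compat.

(** * The cells of K *)

Ltac runit_tac :=
  first
    [ assumption
    | exact: runit1
    | lazymatch goal with
      | |- runit (- _) => apply: runitN; runit_tac
      | |- runit (_^-1) => apply: runitV; runit_tac
      | |- runit (_ * _) => apply: runitM; runit_tac
      | |- runit (_ + _) => apply: runitD; [runit_tac | idl_tac]
      end ].

Ltac nz_tac :=
  repeat (apply/andP; split);
  first [ exact: isT | assumption | apply: oner_neq0 | apply: runit_neq0; runit_tac ].

Ltac cgrp_tac :=
  apply: Cgrp_M3; rewrite ?(mul0r, mulr0);
  lazymatch goal with
  | |- runit _ => runit_tac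
  | |- idl _ _ => idl_tac
  | |- _ => lia
  end.

Ltac dceq_tac :=
  split; [cgrp_tac | cgrp_tac | rewrite !M3_mul; congr (M3 _ _ _ _ _ _ _ _ _);
    try (by []); field; nz_tac].

Section Bruhat.
Context {k : padicField} {c d : triple}.
Hypotheses (Tc : TT c) (Td : TT d).
Hypotheses (c2 : 1 <= c.(t2)) (c3 : 1 <= c.(t3)) (d2 : 1 <= d.(t2)) (d3 : 1 <= d.(t3)).
Implicit Types g : 'M[k]_3.

Definition tform (A B Z : k) := M3 1 0 0 A 1 0 Z B 1.
Definition s1form (A B : k) := M3 0 1 0 1 0 0 B A 1.
Definition s2form (A B : k) := M3 1 0 0 B 0 1 A 1 0.
Definition s12form (A : k) := M3 0 0 1 1 0 0 A 1 0.
Definition s21form (A : k) := M3 0 1 0 0 A 1 1 0 0.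
Definition w0form : 'M[k]_3 := M3 0 0 1 0 1 0 1 0 0.

Variant bruhat_spec g : Prop :=
| BruhatT A B Z of idl 1 A & idl 1 B & idl 1 Z & dceq c d g (tform A B Z)
| BruhatS1 A B of idl 1 A & idl 1 B & dceq c d g (s1form A B)
| BruhatS2 A B of idl 1 A & idl 1 B & dceq c d g (s2form A B)
| BruhatS12 A of idl 1 A & dceq c d g (s12form A)
| BruhatS21 A of idl 1 A & dceq c d g (s21form A)
| BruhatW0 of dceq c d g w0form.

Lemma bruhat_spec_dceq g g' : dceq c d g g' -> bruhat_spec g' -> bruhat_spec g.
Proof.
move=> e; case=> [A B Z *|A B *|A B *|A *|A *|*].
- by apply: (@BruhatT _ A B Z) => //; apply: dceq_trans e _.
- by apply: (@BruhatS1 _ A B) => //; apply: dceq_trans e _.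
- by apply: (@BruhatS2 _ A B) => //; apply: dceq_trans e _.
- by apply: (@BruhatS12 _ A) => //; apply: dceq_trans e _.
- by apply: (@BruhatS21 _ A) => //; apply: dceq_trans e _.
- by apply: BruhatW0; apply: dceq_trans e _.
Qed.

Lemma unit_minor (x y z t : k) : idl 0 x -> idl 0 y -> idl 0 z -> idl 1 t ->
  runit (x * y - z * t) -> runit x /\ runit y.
Proof.
move=> ix iy iz it u.
have uxy : runit (x * y).
  by rewrite -(subrK (z * t) (x * y)); apply: runitD => //; idl_tac.
have [?|?] := runit_or ix; last by case: (runit_idl1 uxy); idl_tac.
have [?|?] := runit_or iy; last by case: (runit_idl1 uxy); idl_tac.
by [].
Qed.

(** The pivot of the last row is its first unit entry [z], [y] or [w]. Clearing the column above it
    leaves a 2 x 2 block with unit determinant: either its entry [F] is a unit and serves as pivot,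
    or [F] is in p and both entries of the opposite diagonal are units by [unit_minor]. *)
Lemma bruhat g : GL3R g -> bruhat_spec g.
Proof.
have [tc1 tc2 tc3 tc4 tc5] := Tc; have [td1 td2 td3 td4 td5] := Td.
rewrite (M3_eta g) => -[+ +]; move: (g 0 0) (g 0 1) (g 0 2) (g 1 0) (g 1 1) (g 1 2).
move: (g 2 0) (g 2 1) (g 2 2) => z y w a b e f m n gi; rewrite det_M3 !mxE /= => ug.
have := gi 0 0; have := gi 0 1; have := gi 0 2.
have := gi 1 0; have := gi 1 1; have := gi 1 2.
have := gi 2 0; have := gi 2 1; have := gi 2 2; rewrite !mxE /= => {gi}.
move=> iw iy iz i_n im i_f ie ib ia.
have [uz|{}iz] := runit_or iz.
  have st : dceq c d (M3 a b e f m n z y w)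
     (M3 0 (b - a / z * y) (e - a / z * w) 0 (m - f / z * y) (n - f / z * w) 1 0 0).
    exists (M3 1 0 (- (a / z)) 0 1 (- (f / z)) 0 0 z^-1), (M3 1 (y / z) (w / z) 0 1 0 0 0 1).
    by dceq_tac.
  apply: bruhat_spec_dceq st _.
  have {ug} : runit ((b - a / z * y) * (n - f / z * w) - (e - a / z * w) * (m - f / z * y)).
    suff -> : (b - a / z * y) * (n - f / z * w) - (e - a / z * w) * (m - f / z * y) =
      det3 a b e f m n z y w / z by runit_tac.
    by rewrite /det3; field; nz_tac.
  have : idl 0 (b - a / z * y) by idl_tac.
  have : idl 0 (e - a / z * w) by idl_tac.
  have : idl 0 (m - f / z * y) by idl_tac.
  have : idl 0 (n - f / z * w) by idl_tac.
  move: (b - a / z * y) (e - a / z * w) (m - f / z * y) (n - f / z * w) => B E F Nn iN iF iE iB.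
  move=> uD; have [uF|{}iF] := runit_or iF.
    apply: BruhatW0.
    exists (M3 (- F / (B * Nn - E * F)) (B / (B * Nn - E * F)) 0 0 F^-1 0 0 0 1), (M3 1 0 0 0 1 (Nn / F) 0 0 1).
    by dceq_tac.
  have [uB uN] := unit_minor iB iN iE iF uD.
  apply: (@BruhatS21 _ (F / Nn)); first by idl_tac.
  exists (M3 (Nn / (B * Nn - E * F)) (- E / (B * Nn - E * F)) 0 0 Nn^-1 0 0 0 1), (M3 1 0 0 0 1 0 0 0 1).
  by dceq_tac.
have [uy|{}iy] := runit_or iy.
  have st : dceq c d (M3 a b e f m n z y w)
     (M3 (a - b / y * z) 0 (e - b / y * w) (f - m / y * z) 0 (n - m / y * w) (z / y) 1 0).
    exists (M3 1 0 (- (b / y)) 0 1 (- (m / y)) 0 0 y^-1), (M3 1 0 0 0 1 (w / y) 0 0 1).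
    by dceq_tac.
  apply: bruhat_spec_dceq st _.
  have {ug} : runit ((a - b / y * z) * (n - m / y * w) - (e - b / y * w) * (f - m / y * z)).
    suff -> : (a - b / y * z) * (n - m / y * w) - (e - b / y * w) * (f - m / y * z) =
      - det3 a b e f m n z y w / y by runit_tac.
    by rewrite /det3; field; nz_tac.
  have : idl 0 (a - b / y * z) by idl_tac.
  have : idl 0 (e - b / y * w) by idl_tac.
  have : idl 0 (f - m / y * z) by idl_tac.
  have : idl 0 (n - m / y * w) by idl_tac.
  have : idl 1 (z / y) by idl_tac.
  move: (a - b / y * z) (e - b / y * w) (f - m / y * z) (n - m / y * w) (z / y).
  move=> A E F Nn Z iZ iN iF iE iA uD; have [uF|{}iF] := runit_or iF.
    apply: (@BruhatS12 _ Z) => //.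
    exists (M3 (- F / (A * Nn - E * F)) (A / (A * Nn - E * F)) 0 0 F^-1 0 0 0 1),
      (M3 1 0 (Nn / F) 0 1 (- Z * Nn / F) 0 0 1).
    by dceq_tac.
  have [uA uN] := unit_minor iA iN iE iF uD.
  apply: (@BruhatS2 _ Z (F / Nn)) => //; first by idl_tac.
  exists (M3 (Nn / (A * Nn - E * F)) (- E / (A * Nn - E * F)) 0 0 Nn^-1 0 0 0 1), (M3 1 0 0 0 1 0 0 0 1).
  by dceq_tac.
have uw : runit w.
  have [//|{}iw] := runit_or iw; case: (runit_idl1 ug); rewrite /det3; idl_tac.
have st : dceq c d (M3 a b e f m n z y w)
   (M3 (a - e / w * z) (b - e / w * y) 0 (f - n / w * z) (m - n / w * y) 0 (z / w) (y / w) 1).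
  exists (M3 1 0 (- (e / w)) 0 1 (- (n / w)) 0 0 w^-1), (M3 1 0 0 0 1 0 0 0 1).
  by dceq_tac.
apply: bruhat_spec_dceq st _.
have {ug} : runit ((a - e / w * z) * (m - n / w * y) - (b - e / w * y) * (f - n / w * z)).
  suff -> : (a - e / w * z) * (m - n / w * y) - (b - e / w * y) * (f - n / w * z) =
      det3 a b e f m n z y w / w by runit_tac.
  by rewrite /det3; field; nz_tac.
have : idl 0 (a - e / w * z) by idl_tac.
have : idl 0 (b - e / w * y) by idl_tac.
have : idl 0 (f - n / w * z) by idl_tac.
have : idl 0 (m - n / w * y) by idl_tac.
have : idl 1 (z / w) by idl_tac.
have : idl 1 (y / w) by idl_tac.
move: (a - e / w * z) (b - e / w * y) (f - n / w * z) (m - n / w * y) (z / w) (y / w).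
move=> A B F Mm Z Y iY iZ iM iF iB iA uD; have [uF|{}iF] := runit_or iF.
  apply: (@BruhatS1 _ (Y - Z * Mm / F) Z) => //; first by idl_tac.
  exists (M3 (- F / (A * Mm - B * F)) (A / (A * Mm - B * F)) 0 0 F^-1 0 0 0 1),
    (M3 1 (Mm / F) 0 0 1 0 0 0 1).
  by dceq_tac.
have [uA uM] := unit_minor iA iM iB iF uD.
apply: (@BruhatT _ (F / Mm) Y Z) => //; first by idl_tac.
exists (M3 (Mm / (A * Mm - B * F)) (- B / (A * Mm - B * F)) 0 0 Mm^-1 0 0 0 1), (M3 1 0 0 0 1 0 0 0 1).
by dceq_tac.
Qed.

End Bruhat.

(** * Necessary conditions *)

Lemma runit2 (k : padicField) p : p \in [pchar (residue k)] -> (2 < p)%N ->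
  runit (1 + 1 : k).
Proof.
move=> hp p2; have i1 := @idl1 k.
have [//|i2] := @runit_or k (1 + 1) ltac:(idl_tac).
have : red (1 + 1 : k) = 0 by apply/red_ker => //; idl_tac.
rewrite redD // red1 => e.
have : 2%N \in [pchar (residue k)] by rewrite inE /= mulr2n e eqxx.
by rewrite (pcharf_eq hp) inE => /eqP e2; rewrite -e2 in p2.
Qed.

Section Necessity.
Context {R : realType} {k : padicField} {chi2 chi3 : k -> R[i]} {M N : nat}.
Hypotheses (hchi2 : mul_char chi2) (hchi3 : mul_char chi3).
Hypotheses (hM : conductor chi2 M) (hN : conductor chi3 N).
Hypotheses (hMN : (M <= N)%N) (hN0 : (0 < N)%N).
Hypothesis (h23 : conductor (fun x => chi2 x / chi3 x) N).
Hypothesis u2 : runit (1 + 1 : k).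
Context {c d : triple}.
Local Notation m := (Triple M N N).
Hypotheses (Tc : TTm m c) (Td : TTm m d).
Local Notation chi := (chi chi2 chi3 M).
Local Notation compat := (@compat R k chi2 chi3 M c d).

(** The factor of [chi] at the middle entry. It agrees with [chi2] on units and is multiplicative
    for every M, so the convention for M = 0 needs no separate treatment below. *)
Definition psi2 (u : k) : R[i] := if M == 0%N then 1 else chi2 u.

Lemma psi2_unit u : runit u -> psi2 u = chi2 u.
Proof.
move=> uu; rewrite /psi2; case: eqP => // M0.
by case: hM => h _; rewrite h // M0; exact: idl_le (idlD (runit_idl uu) (idlN idl1)) _.
Qed.

Lemma mul_char_psi2 : mul_char psi2.
Proof.
rewrite /psi2; case: (M == 0%N); last exact: hchi2.
by split=> // u v _ _; rewrite mulr1.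
Qed.

Lemma conductor_ext (f g : k -> R[i]) n : (forall u, runit u -> f u = g u) ->
  conductor f n -> conductor g n.
Proof.
move=> fg [h1 h2]; split=> [x ux hx|n' hn']; first by rewrite -fg // h1.
by apply: h2 => x ux hx; rewrite fg // hn'.
Qed.

Lemma conductor_psi2 : conductor psi2 M.
Proof. by apply: conductor_ext hM => u uu; rewrite psi2_unit. Qed.

Lemma conductor_psi2_chi3 : conductor (fun x => psi2 x / chi3 x) N.
Proof. by apply: conductor_ext h23 => u uu; rewrite psi2_unit. Qed.

Lemma chiE (h : 'M[k]_3) : chi h = psi2 (h 1 1) * chi3 (h 2 2).
Proof. by []. Qed.

Lemma chi_M3 (x00 x01 x02 x10 x11 x12 x20 x21 x22 : k) :
  chi (M3 x00 x01 x02 x10 x11 x12 x20 x21 x22) = psi2 x11 * chi3 x22.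
Proof. by rewrite chiE !mxE. Qed.

Lemma level_facts : [/\ 1 <= c.(t2), 1 <= c.(t3), 1 <= d.(t2) & 1 <= d.(t3)]
  /\ ([/\ 0 <= c.(t1), c.(t1) <= c.(t3), c.(t2) <= c.(t3) & c.(t3) <= c.(t1) + c.(t2)]
  /\ [/\ 0 <= d.(t1), d.(t1) <= d.(t3), d.(t2) <= d.(t3) & d.(t3) <= d.(t1) + d.(t2)]).
Proof.
case: Tc Td => -[? ? ? ? ?] [/= ? ? ?] [[? ? ? ? ?] [/= ? ? ?]].
by do !split; lia.
Qed.

(** Applies compatibility to an explicit pair: membership in C_c and C_d and the matrix identity are
    discharged, and the resulting equation between values of [psi2] and [chi3] is left, cleared of
    values at 1. *)
Local Ltac pair Hc h h' :=
  have : chi h = chi h';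
  [ apply: Hc;
    [ cgrp_tac | cgrp_tac
    | rewrite !M3_mul; congr (M3 _ _ _ _ _ _ _ _ _); try (by []); field; nz_tac ]
  | rewrite !chi_M3 ?(mul_char_psi2).1 ?(hchi3).1 ?mulr1 ?mul1r ].

Lemma chi3_nontriv : ~ (forall v, runit (1 + v) -> chi3 (1 + v) = 1).
Proof.
move=> h; have := @conductor_le _ _ chi3 N 0 hN (lexx _) (fun v _ => h v); lia.
Qed.

Lemma unit_1D_int v : runit (1 + v : k) -> idl 0 v.
Proof. by move=> u; rewrite (_ : v = (1 + v) - 1); [idl_tac|ring]. Qed.

Lemma not_compat_s12 A : idl 1 A -> ~ compat (s12form A).
Proof.
have [[c2 c3 d2 d3] [[? ? ? ?] [? ? ? ?]]] := level_facts.
move=> iA Hc; apply: chi3_nontriv => v uv; symmetry.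
by pair Hc (M3 (1 + v) 0 0 0 1 0 0 0 1) (M3 1 0 0 0 1 0 0 0 (1 + v)).
Qed.

Lemma not_compat_s21 A : idl 1 A -> ~ compat (s21form A).
Proof.
have [[c2 c3 d2 d3] [[? ? ? ?] [? ? ? ?]]] := level_facts.
move=> iA Hc; apply: chi3_nontriv => v uv.
by pair Hc (M3 1 0 0 0 1 0 0 0 (1 + v)) (M3 (1 + v) 0 0 0 1 0 0 0 1).
Qed.

Lemma not_compat_w0 : ~ compat (w0form).
Proof.
have [[c2 c3 d2 d3] [[? ? ? ?] [? ? ? ?]]] := level_facts.
move=> Hc; apply: chi3_nontriv => v uv; symmetry.
by pair Hc (M3 (1 + v) 0 0 0 1 0 0 0 1) (M3 1 0 0 0 1 0 0 0 (1 + v)).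
Qed.

(** The torus pair exchanging the last two diagonal entries needs a correction in [h 1 0] or
    [h' 1 0], which is unconstrained when c_1 = 0 or d_1 = 0. Moreover M = 0 then, so only chi_3 is
    felt. *)
Lemma not_compat_s2 A B : idl 1 A -> idl 1 B -> c.(t1) = 0 \/ d.(t1) = 0 ->
  ~ compat (s2form A B).
Proof.
have [[c2 c3 d2 d3] [[? ? ? ?] [? ? ? ?]]] := level_facts.
move=> iA iB cd1 Hc; apply: chi3_nontriv => v uv.
have iv := unit_1D_int uv.
have M0 : M = 0%N by case: Tc Td => [_ [/= ? _ _]] [_ [/= ? _ _]]; lia.
have p1 u : psi2 u = 1 by rewrite /psi2 M0.
case: cd1 => ?.
  by pair Hc (M3 1 0 0 (- B * v) (1 + v) 0 0 0 1) (M3 1 0 0 0 1 0 0 0 (1 + v));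
    rewrite p1.
by pair Hc (M3 1 0 0 0 1 0 0 0 (1 + v)) (M3 1 0 0 (A * v) (1 + v) 0 0 0 1);
  rewrite p1.
Qed.

(** The two bounds from below by N come from pairs with an upper entry v / A or v / B, which move
    chi_3. Each of the six bounds with M comes from a torus pair moving chi_2 alone, whose
    correction is placed in one of the six constrained entries of h and h'. *)
Lemma compat_s1 A B : A != 0 -> B != 0 ->
  1 <= valk A -> valk A <= d.(t2) -> valk A <= c.(t3) ->
  1 <= valk B -> valk B <= c.(t2) -> valk B <= d.(t3) ->
  - c.(t1) <= valk B - valk A -> valk B - valk A <= d.(t1) ->
  compat (s1form A B) ->
  [/\ N%:Z <= valk A <= Num.min d.(t2) c.(t3) - M%:Z,
      N%:Z <= valk B <= Num.min c.(t2) d.(t3) - M%:Z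
    & M%:Z - c.(t1) <= valk B - valk A <= d.(t1) - M%:Z].
Proof.
have [[c2 c3 d2 d3] [[? ? ? ?] [? ? ? ?]]] := level_facts.
move=> A0 B0 A1 Ad2 Ac3 B1 Bc2 Bd3 BAc BAd Hc.
have pM n := @conductor_le _ _ psi2 M n conductor_psi2.
have bB : N%:Z <= valk B.
  apply: (conductor_le hN) => [|v iv uv]; first by lia.
  by pair Hc (M3 1 0 0 0 1 (v / B) 0 0 (1 + v)) (M3 (1 + v) (A * (v / B)) (v / B) 0 1 0 0 0 1).
have bA : N%:Z <= valk A.
  apply: (conductor_le hN) => [|v iv uv]; first by lia.
  pair Hc (M3 1 (- B * (v / A)) (v / A) 0 (1 + v) 0 0 0 (1 + v))
          (M3 (1 + v) 0 0 0 (1 + v) (v / A) 0 0 1).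
  move=> e; apply: (mulfI (mul_char_neq0 mul_char_psi2 (runit_neq0 uv))).
  by rewrite e mulr1.
have h1 : M%:Z <= d.(t2) - valk A.
  apply: pM => [|v iv uv]; first by lia.
  by pair Hc (M3 (1 + v) 0 0 0 1 0 0 0 1) (M3 1 0 0 0 (1 + v) 0 0 (- A * v) 1).
have h2 : M%:Z <= c.(t3) - valk A.
  apply: pM => [|v iv uv]; first by lia.
  by pair Hc (M3 (1 + v) 0 0 0 1 0 (A * v) 0 1) (M3 1 0 0 0 (1 + v) 0 0 0 1).
have h3 : M%:Z <= c.(t2) - valk B.
  apply: pM => [|v iv uv]; first by lia.
  by pair Hc (M3 1 0 0 0 (1 + v) 0 0 (B * v) 1) (M3 (1 + v) 0 0 0 1 0 0 0 1).
have h4 : M%:Z <= d.(t3) - valk B.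
  apply: pM => [|v iv uv]; first by lia.
  by pair Hc (M3 1 0 0 0 (1 + v) 0 0 0 1) (M3 (1 + v) 0 0 0 1 0 (- B * v) 0 1).
have h5 : M%:Z <= c.(t1) + valk B - valk A.
  apply: pM => [|v iv uv]; first by lia.
  by pair Hc (M3 (1 + v) 0 0 (- A * v / B) 1 0 0 0 1) (M3 1 (- A * v / B) 0 0 (1 + v) 0 0 0 1).
have h6 : M%:Z <= d.(t1) + valk A - valk B.
  apply: pM => [|v iv uv]; first by lia.
  by pair Hc (M3 1 (- B * v / A) 0 0 (1 + v) 0 0 0 1) (M3 (1 + v) 0 0 (- B * v / A) 1 0 0 0 1).
by split; lia.
Qed.

(** As for s_1, except that the permutation exchanges the last two diagonal entries: torus pairs
    compare chi_2 with chi_3, so the six bounds involve the conductor N of chi_2 / chi_3 instead of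
    M. *)
Lemma compat_s2 A B : A != 0 -> B != 0 ->
  1 <= valk A -> valk A <= d.(t1) -> valk A <= c.(t3) ->
  1 <= valk B -> valk B <= c.(t1) -> valk B <= d.(t3) ->
  - c.(t2) <= valk B - valk A -> valk B - valk A <= d.(t2) ->
  compat (s2form A B) ->
  [/\ N%:Z <= valk A <= Num.min d.(t1) c.(t3) - N%:Z,
      N%:Z <= valk B <= Num.min c.(t1) d.(t3) - N%:Z
    & N%:Z - c.(t2) <= valk B - valk A <= d.(t2) - N%:Z].
Proof.
have [[c2 c3 d2 d3] [[? ? ? ?] [? ? ? ?]]] := level_facts.
move=> A0 B0 A1 Ad2 Ac3 B1 Bc2 Bd3 BAc BAd Hc.
have nz u : runit u -> chi3 u != 0 by move=> uu; apply: mul_char_neq0 => //; exact: runit_neq0.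
have pM n : 0 <= n ->
  (forall v, idl n v -> runit (1 + v) -> psi2 (1 + v) = chi3 (1 + v)) -> N%:Z <= n.
  move=> n0 h; apply: (conductor_le conductor_psi2_chi3 n0) => v iv uv.
  by rewrite h // divff // nz.
have bB : N%:Z <= valk B.
  apply: (conductor_le hN) => [|v iv uv]; first by lia.
  pair Hc (M3 1 (v / B) 0 0 (1 + v) 0 0 0 (1 + v)) (M3 (1 + v) 0 (v / B) 0 (1 + v) (- A * (v / B)) 0 0 1).
  move=> e; apply: (mulfI (mul_char_neq0 mul_char_psi2 (runit_neq0 uv))).
  by rewrite e mulr1.
have bA : N%:Z <= valk A.
  apply: (conductor_le hN) => [|v iv uv]; first by lia.
  by pair Hc (M3 1 0 (v / A) 0 1 (B * (v / A)) 0 0 (1 + v))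
          (M3 (1 + v) (v / A) 0 0 1 0 0 0 1).
have h1 : N%:Z <= c.(t1) - valk B.
  apply: pM => [|v iv uv]; first by lia.
  by pair Hc (M3 1 0 0 (- B * v) (1 + v) 0 0 0 1) (M3 1 0 0 0 1 0 0 0 (1 + v)).
have h2 : N%:Z <= d.(t3) - valk B.
  apply: pM => [|v iv uv]; first by lia.
  by pair Hc (M3 1 0 0 0 (1 + v) 0 0 0 1) (M3 1 0 0 0 1 0 (B * v) 0 (1 + v)).
have h3 : N%:Z <= d.(t2) + valk A - valk B.
  apply: pM => [|v iv uv]; first by lia.
  by pair Hc (M3 1 0 0 0 (1 + v) (- B * v / A) 0 0 1) (M3 1 0 0 0 1 0 0 (- B * v / A) (1 + v)).
have h4 : N%:Z <= d.(t1) - valk A.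
  apply: pM => [|v iv uv]; first by lia.
  by pair Hc (M3 1 0 0 0 1 0 0 0 (1 + v)) (M3 1 0 0 (A * v) (1 + v) 0 0 0 1).
have h5 : N%:Z <= c.(t3) - valk A.
  apply: pM => [|v iv uv]; first by lia.
  by pair Hc (M3 1 0 0 0 1 0 (- A * v) 0 (1 + v)) (M3 1 0 0 0 (1 + v) 0 0 0 1).
have h6 : N%:Z <= c.(t2) + valk B - valk A.
  apply: pM => [|v iv uv]; first by lia.
  by pair Hc (M3 1 0 0 0 1 0 0 (- A * v / B) (1 + v)) (M3 1 0 0 0 (1 + v) (- A * v / B) 0 0 1).
by split; lia.
Qed.

(** * Necessary conditions in the lower unipotent cell *)

Section LowerForm.
Variables A B Z : k.
Hypotheses (A0 : A != 0) (B0 : B != 0) (Z0 : Z != 0).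
Hypotheses (a1 : 1 <= valk A) (a2 : 1 <= valk B).
Hypotheses (a13 : valk A <= valk Z) (a23 : valk B <= valk Z).
Hypotheses (ac2 : valk B <= c.(t2)) (ad2 : valk B <= d.(t2)).
Hypotheses (ac3 : valk Z <= c.(t3)) (ad3 : valk Z <= d.(t3)).
Hypothesis Hc : compat (tform A B Z).

Lemma compat_t_val_Z : N%:Z <= valk Z.
Proof.
have [[c2 c3 d2 d3] [[? ? ? ?] [? ? ? ?]]] := level_facts.
apply: (conductor_le hN) => [|v iv uv]; first by lia.
pair Hc (M3 (1 + v) 0 (- v / Z) 0 (1 + v) (- v / Z * A) 0 0 1)
  (M3 1 (- v / Z * B) (- v / Z) 0 (1 + v) 0 0 0 (1 + v)).
move=> e; apply: (mulfI (mul_char_neq0 mul_char_psi2 (runit_neq0 uv))).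
by rewrite -e mulr1.
Qed.

Lemma compat_t_max : N%:Z <= valk A \/ N%:Z <= valk B.
Proof.
have [[c2 c3 d2 d3] [[? ? ? ?] [? ? ? ?]]] := level_facts.
have hZ := compat_t_val_Z.
have [?|ltA] := lerP N%:Z (valk A); first by left.
have [?|ltB] := lerP N%:Z (valk B); first by right.
suff : N%:Z <= Num.max (valk A) (valk B) by lia.
apply: (conductor_le hN) => [|v iv uv]; first by lia.
(* v lies in p^max(val A, val B), and the smaller of the two valuations is below N <= val Z; hence Z
   v / (A B) is in p. *)
have uw : runit (1 + Z * v / A / B) by runit_tac.
pair Hc (M3 (1 + v) (- v / A) 0 0 (1 + Z * v / A / B) (- v / B) 0 0 1)
  (M3 1 (- v / A) 0 0 (1 + Z * v / A / B) (- v / B) 0 0 (1 + v)).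
move=> e; apply: (mulfI (mul_char_neq0 mul_char_psi2 (runit_neq0 uw))).
by rewrite -e mulr1.
Qed.

(* The bounds on [L] are those which put each term of the identity for
   [h 1 1 - h' 1 1] in [p^L], when [h *m t = t *m h'] with [t = tform A B Z]. *)
Definition deep (L : int) : Prop :=
  [/\ A * B - Z != 0,
      L <= d.(t1) + valk B - valk Z,
      L <= c.(t2) + valk A - valk Z
    & [/\ L <= c.(t1) + valk B - valk (A * B - Z),
          L <= d.(t2) + valk A - valk (A * B - Z),
          L <= valk A + valk B + c.(t3) - valk Z - valk (A * B - Z)
        & L <= valk A + valk B + d.(t3) - valk Z - valk (A * B - Z)]].

(** If one of the bounds fails at L it holds with L - 1 reversed, so for v in p^(L-1) the correction
    attached to it fits into its constrained entry. For A B = Z the correction v (A B - Z) / B is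
    simply 0. *)
Lemma deep_or (L : int) : deep L \/ (forall v : k, idl (L - 1) v ->
  [\/ idl d.(t1) (Z * v / B), idl c.(t2) (Z * v / A)
    | [\/ idl c.(t1) (v * (A * B - Z) / B), idl d.(t2) (v * (A * B - Z) / A)
     | idl c.(t3) (Z * v * (A * B - Z) / A / B) \/
       idl d.(t3) (Z * v * (A * B - Z) / A / B)]]).
Proof.
have [D0|D0] := eqVneq (A * B - Z) 0.
  by right=> v iv; apply: Or33; apply: Or31; rewrite D0 mulr0 mul0r; exact: idl0.
have [?|?] := lerP L (d.(t1) + valk B - valk Z); last first.
  by right=> v iv; apply: Or31; idl_tac.
have [?|?] := lerP L (c.(t2) + valk A - valk Z); last first.
  by right=> v iv; apply: Or32; idl_tac.
have [?|?] := lerP L (c.(t1) + valk B - valk (A * B - Z)); last first.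
  by right=> v iv; apply: Or33; apply: Or31; idl_tac.
have [?|?] := lerP L (d.(t2) + valk A - valk (A * B - Z)); last first.
  by right=> v iv; apply: Or33; apply: Or32; idl_tac.
have [?|?] := lerP L (valk A + valk B + c.(t3) - valk Z - valk (A * B - Z)); last first.
  by right=> v iv; apply: Or33; apply: Or33; left; idl_tac.
have [?|?] := lerP L (valk A + valk B + d.(t3) - valk Z - valk (A * B - Z)); last first.
  by right=> v iv; apply: Or33; apply: Or33; right; idl_tac.
by left.
Qed.

(* If [1 + r] is not a unit then [1 - r] is one, as 2 is a unit; and
   [(1 + v) (1 - v)] is close enough to 1 for the characters to be trivial on it. *)
Lemma sign_trick (psi : k -> R[i]) (n : nat) (v r : k) : mul_char psi ->
  trivial_on_level psi n -> (1 < n)%N ->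
  idl (n%:Z - 1) v -> idl 0 r -> (forall w s, idl (n%:Z - 1) w -> (w = v /\ s = r) \/ (w = - v /\ s = - r) ->
    runit (1 + s) -> psi (1 + w) = 1) -> psi (1 + v) = 1.
Proof.
move=> hpsi tr n1 iv ir h; have i1 := @idl1 k.
have [ur|nur] := @runit_or k (1 + r) ltac:(idl_tac).
  by apply: (h v r) => //; left.
have u1 := @runit1 k.
have urN : runit (1 - r).
  by rewrite (_ : 1 - r = 1 + 1 - (1 + r)); [apply: runitD => //; idl_tac|ring].
have uv : runit (1 + v) by runit_tac.
have uvN : runit (1 - v) by apply: runitD => //; idl_tac.
have eN : psi (1 - v) = 1.
  by apply: (h (- v) (- r)) => //; [idl_tac|right].
have := tr ((1 + v) * (1 - v)) ltac:(runit_tac).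
rewrite mul_charM ?runit_neq0 // eN mulr1; apply.
by rewrite (_ : _ - 1 = - (v * v)); [idl_tac|ring].
Qed.

Lemma compat_t_deep2 : valk A < M%:Z -> N%:Z <= valk B -> deep M.
Proof.
have [[c2 c3 d2 d3] [[? ? ? ?] [? ? ? ?]]] := level_facts.
move=> aM aN; have [//|h] := deep_or M; exfalso.
have [Mc Md] : M%:Z <= c.(t1) /\ M%:Z <= d.(t1).
  by case: Tc Td => _ [/= ? _ _] [_ [/= ? _ _]].
(* If [deep M] fails, each v in p^(M-1) is the parameter of a pair with upper entry v / A, integral
   as val A < M, and this pair forces psi2 (1 + v) = 1; so the conductor would be at most M - 1.
   Since 1 <= val A < M, here M - 1 >= 1. *)
suff : M%:Z <= M%:Z - 1 by lia.
apply: (conductor_le conductor_psi2) => [|v iv uv]; first by lia.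
have cancel x : runit x -> psi2 (1 + v) * chi3 x = chi3 x -> psi2 (1 + v) = 1.
  move=> ux e; apply: (mulIf (mul_char_neq0 hchi3 (runit_neq0 ux))).
  by rewrite e mul1r.
have [iw|iw|[iw|iw|iw]] := h v iv.
- have uw : runit (1 + Z * v / A / B).
    by rewrite (_ : _ / B = (Z * v / B) / A); [runit_tac|field; nz_tac].
  pair Hc (M3 (1 + Z * v / A / B) (v / A) 0 0 (1 + v) 0 0 0 (1 + Z * v / A / B))
    (M3 (1 + Z * v / A / B + v) (v / A) 0 (- (Z * v / B)) 1 0 0 0 (1 + Z * v / A / B)).
  exact: cancel.
- by pair Hc (M3 1 (v / A) 0 0 (1 + v) 0 0 (Z * v / A) 1) (M3 (1 + v) (v / A) 0 0 1 0 0 0 1).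
- have uw : runit (1 + Z * v / A / B).
    rewrite (_ : _ / B = v - v * (A * B - Z) / B / A); last by field; nz_tac.
    by rewrite addrA; apply: runitD => //; idl_tac.
  have uw' : runit (1 + Z * v / A / B - v) by runit_tac.
  pair Hc (M3 (1 + Z * v / A / B - v) (v / A) 0 (- (v * (A * B - Z) / B)) (1 + v) 0 0 0 (1 + Z * v / A / B))
    (M3 (1 + Z * v / A / B) (v / A) 0 0 1 0 0 0 (1 + Z * v / A / B)).
  exact: cancel.
- pair Hc (M3 1 (v / A) 0 0 (1 + v) 0 0 0 (1 + v))
    (M3 (1 + v) (v / A) 0 0 1 0 0 (v * (A * B - Z) / A) (1 + v)).
  exact: cancel.
(* In the corner case val Z <= c_3, d_3 only makes Z v / (A B) integral, so 1 + Z v / (A B), a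
   diagonal entry of the pair, may fail to be a unit. *)
have ir : idl 0 (Z * v / A / B).
  have -> : Z * v / A / B = v - Z * v * (A * B - Z) / A / B / Z by field; nz_tac.
  by case: iw => iw; idl_tac.
apply: (sign_trick mul_char_psi2 conductor_psi2.1 _ iv ir); first by lia.
move=> w s {}iv hws us.
have iv1 : idl 1 w by idl_tac.
have uw := runitD (@runit1 k) iv1.
have es : s = Z * w / A / B by case: hws => -[-> ->] //; ring.
have cancel' x : runit x -> psi2 (1 + w) * chi3 x = chi3 x -> psi2 (1 + w) = 1.
  move=> ux e; apply: (mulIf (mul_char_neq0 hchi3 (runit_neq0 ux))).
  by rewrite e mul1r.
rewrite es in us.
have {}iw : idl c.(t3) (Z * w * (A * B - Z) / A / B) \/ idl d.(t3) (Z * w * (A * B - Z) / A / B).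
  by case: hws iw => -[-> _] //; rewrite mulrN !mulNr => -[/idlN ?|/idlN ?]; [left|right].
case: iw => iw.
  pair Hc (M3 1 (w / A) 0 0 (1 + w) 0 (Z * w * (A * B - Z) / A / B) 0 (1 + Z * w / A / B))
    (M3 (1 + w) (w / A) 0 0 1 0 0 0 (1 + Z * w / A / B)).
  exact: cancel'.
pair Hc (M3 1 (w / A) 0 0 (1 + w) 0 0 0 (1 + Z * w / A / B))
    (M3 (1 + w) (w / A) 0 0 1 0 (- (Z * w * (A * B - Z) / A / B)) 0 (1 + Z * w / A / B)).
exact: cancel'.
Qed.

Lemma compat_t_deep3 : valk A <= c.(t1) -> valk A <= d.(t1) ->
  N%:Z <= valk A -> valk B < N%:Z -> deep N.
Proof.
have [[c2 c3 d2 d3] [[? ? ? ?] [? ? ? ?]]] := level_facts.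
move=> ac1 ad1 aN aB; have [//|h] := deep_or N; exfalso.
have [Nc Nd] : N%:Z <= c.(t2) /\ N%:Z <= d.(t2).
  by case: Tc Td => _ [/= _ ? _] [_ [/= _ ? _]].
suff : N%:Z <= N%:Z - 1 by lia.
have cphi := conductor_psi2_chi3.
have phiE w : runit (1 + w) -> psi2 (1 + w) = chi3 (1 + w) -> psi2 (1 + w) / chi3 (1 + w) = 1.
  by move=> uw ->; rewrite divff // mul_char_neq0 // runit_neq0.
(* Some pairs produce chi3 (x + w) where chi3 (x (1 + w)) is wanted. The arguments differ by w (x -
   1), which is in p^N because w is in p^(N-1) and x - 1 in p. *)
have cancel x w : runit x -> idl (N%:Z - 1) w -> idl 1 (x - 1) -> runit (1 + w) ->
    psi2 (1 + w) * chi3 x = chi3 (x + w) -> psi2 (1 + w) = chi3 (1 + w).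
  move=> ux iw ix uw e; apply: (mulIf (mul_char_neq0 hchi3 (runit_neq0 ux))).
  rewrite e -mul_charM ?runit_neq0 //.
  apply: (trivial_on_level_eq hchi3 hN.1); [runit_tac|runit_tac|].
  by rewrite (_ : _ - _ = - w * (x - 1)); [idl_tac|ring].
apply: (conductor_le cphi) => [|v iv uv]; first by lia.
have [iw|iw|[iw|iw|iw]] := h v iv.
- apply: phiE => //.
  by pair Hc (M3 (1 + v) 0 0 0 (1 + v) (- v / B) 0 0 1) (M3 (1 + v) 0 0 (- (Z * v / B)) 1 (- v / B) 0 0 (1 + v)).
- apply: phiE => //.
  have ir : idl 1 (Z * v / A / B) by idl_tac.
  have u1 := @runit1 k.
  have uw : runit (1 - Z * v / A / B) by apply: runitD => //; idl_tac.
  have uw' : runit (1 - Z * v / A / B + v) by apply: runitD => //; idl_tac.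
  pair Hc (M3 (1 - Z * v / A / B + v) 0 0 0 (1 + v) (- v / B) 0 (Z * v / A) (1 - Z * v / A / B))
    (M3 (1 - Z * v / A / B + v) 0 0 0 1 (- v / B) 0 0 (1 - Z * v / A / B + v)).
  by apply: cancel => //; rewrite (_ : _ - 1 = - (Z * v / A / B)); [idl_tac|ring].
- apply: phiE => //.
  by pair Hc (M3 1 0 0 (- (v * (A * B - Z) / B)) (1 + v) (- v / B) 0 0 1) (M3 1 0 0 0 1 (- v / B) 0 0 (1 + v)).
- apply: phiE => //.
  have ir : idl 1 (v * (A * B - Z) / A / B) by idl_tac.
  have uw : runit (1 + v * (A * B - Z) / A / B) by apply: runitD => //; exact: runit1.
  pair Hc (M3 (1 + v * (A * B - Z) / A / B) 0 0 0 (1 + v) (- v / B) 0 0 (1 + v * (A * B - Z) / A / B))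
    (M3 (1 + v * (A * B - Z) / A / B) 0 0 0 1 (- v / B) 0 (v * (A * B - Z) / A) (1 + v * (A * B - Z) / A / B + v)).
  by apply: cancel => //; rewrite (_ : _ - 1 = v * (A * B - Z) / A / B); [idl_tac|ring].
(* Again only integral: 1 + (v - Z v / (A B)) is the upper left entry of the pairs for the two
   corner cases. *)
have ir : idl 0 (v - Z * v / A / B).
  have -> : v - Z * v / A / B = Z * v * (A * B - Z) / A / B / Z by field; nz_tac.
  by case: iw => iw; idl_tac.
apply: (sign_trick (psi := fun x => psi2 x / chi3 x) (mul_char_div mul_char_psi2 hchi3) cphi.1 _ iv ir); first by lia.
move=> w s {}iv hws us.
have iv1 : idl 1 w by idl_tac.
have uw := runitD (@runit1 k) iv1.
have es : s = w - Z * w / A / B by case: hws => -[-> ->] //; ring.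
rewrite es in us.
apply: phiE => //.
have {}iw : idl c.(t3) (Z * w * (A * B - Z) / A / B) \/ idl d.(t3) (Z * w * (A * B - Z) / A / B).
  by case: hws iw => -[-> _] //; rewrite mulrN !mulNr => -[/idlN ?|/idlN ?]; [left|right].
case: iw => iw.
  by pair Hc (M3 (1 + (w - Z * w / A / B)) 0 0 0 (1 + w) (- w / B) (Z * w * (A * B - Z) / A / B) 0 1)
    (M3 (1 + (w - Z * w / A / B)) 0 0 0 1 (- w / B) 0 0 (1 + w)).
by pair Hc (M3 (1 + (w - Z * w / A / B)) 0 0 0 (1 + w) (- w / B) 0 0 1)
    (M3 (1 + (w - Z * w / A / B)) 0 0 0 1 (- w / B) (- (Z * w * (A * B - Z) / A / B)) 0 (1 + w)).
Qed.

End LowerForm.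

End Necessity.

(** * Sufficient conditions *)

Section Equations.
Context {k : padicField}.
Implicit Types h g : 'M[k]_3.

Lemma mulmx3_eq h h' g g' : h *m g = g' *m h' -> forall i j,
  h i 0 * g 0 j + h i 1 * g 1 j + h i 2 * g 2 j =
  g' i 0 * h' 0 j + g' i 1 * h' 1 j + g' i 2 * h' 2 j.
Proof. by move=> e i j; rewrite -!mulmx3 e. Qed.

(** The parameters on the two sides are kept distinct so that the same equations serve for
    stabilizers and for comparing double cosets. *)
Lemma tform_eqs (A B Z A' B' Z' : k) h h' :
  h *m tform A B Z = tform A' B' Z' *m h' ->
  [/\ h 0 0 + h 0 1 * A + h 0 2 * Z = h' 0 0,
      h 0 1 + h 0 2 * B = h' 0 1
    & h 0 2 = h' 0 2] /\
  [/\ h 1 0 + h 1 1 * A + h 1 2 * Z = A' * h' 0 0 + h' 1 0,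
      h 1 1 + h 1 2 * B = A' * h' 0 1 + h' 1 1
    & h 1 2 = A' * h' 0 2 + h' 1 2] /\
  [/\ h 2 0 + h 2 1 * A + h 2 2 * Z = Z' * h' 0 0 + B' * h' 1 0 + h' 2 0,
      h 2 1 + h 2 2 * B = Z' * h' 0 1 + B' * h' 1 1 + h' 2 1
    & h 2 2 = Z' * h' 0 2 + B' * h' 1 2 + h' 2 2].
Proof.
move=> /mulmx3_eq E; have := E 2 2; have := E 2 1; have := E 2 0.
have := E 1 2; have := E 1 1; have := E 1 0.
have := E 0 2; have := E 0 1; have := E 0 0.
by rewrite !mxE /= ?(mulr1, mul1r, mulr0, mul0r, addr0, add0r); do !split.
Qed.

Lemma s1form_eqs (A B A' B' : k) h h' :
  h *m s1form A B = s1form A' B' *m h' ->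
  [/\ h 0 1 + h 0 2 * B = h' 1 0,
      h 0 0 + h 0 2 * A = h' 1 1
    & h 0 2 = h' 1 2] /\
  [/\ h 1 1 + h 1 2 * B = h' 0 0,
      h 1 0 + h 1 2 * A = h' 0 1
    & h 1 2 = h' 0 2] /\
  [/\ h 2 1 + h 2 2 * B = B' * h' 0 0 + A' * h' 1 0 + h' 2 0,
      h 2 0 + h 2 2 * A = B' * h' 0 1 + A' * h' 1 1 + h' 2 1
    & h 2 2 = B' * h' 0 2 + A' * h' 1 2 + h' 2 2].
Proof.
move=> /mulmx3_eq E; have := E 2 2; have := E 2 1; have := E 2 0.
have := E 1 2; have := E 1 1; have := E 1 0.
have := E 0 2; have := E 0 1; have := E 0 0.
by rewrite !mxE /= ?(mulr1, mul1r, mulr0, mul0r, addr0, add0r); do !split.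
Qed.

Lemma s2form_eqs (A B A' B' : k) h h' :
  h *m s2form A B = s2form A' B' *m h' ->
  [/\ h 0 0 + h 0 1 * B + h 0 2 * A = h' 0 0,
      h 0 2 = h' 0 1
    & h 0 1 = h' 0 2] /\
  [/\ h 1 0 + h 1 1 * B + h 1 2 * A = B' * h' 0 0 + h' 2 0,
      h 1 2 = B' * h' 0 1 + h' 2 1
    & h 1 1 = B' * h' 0 2 + h' 2 2] /\
  [/\ h 2 0 + h 2 1 * B + h 2 2 * A = A' * h' 0 0 + h' 1 0,
      h 2 2 = A' * h' 0 1 + h' 1 1
    & h 2 1 = A' * h' 0 2 + h' 1 2].
Proof.
move=> /mulmx3_eq E; have := E 2 2; have := E 2 1; have := E 2 0.
have := E 1 2; have := E 1 1; have := E 1 0.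
have := E 0 2; have := E 0 1; have := E 0 0.
by rewrite !mxE /= ?(mulr1, mul1r, mulr0, mul0r, addr0, add0r); do !split.
Qed.

Lemma Cgrp_idl e (h : 'M[k]_3) : Cgrp e h ->
  [/\ idl 0 (h 0 0), idl 0 (h 0 1) & idl 0 (h 0 2)] /\
  [/\ idl e.(t1) (h 1 0), idl 0 (h 1 1) & idl 0 (h 1 2)] /\
  [/\ idl e.(t3) (h 2 0), idl e.(t2) (h 2 1) & idl 0 (h 2 2)].
Proof. by case=> [[hi _] ? ? ?]; do !split. Qed.

End Equations.

Section Sufficiency.
Context {R : realType} {k : padicField} {chi2 chi3 : k -> R[i]} {M N : nat}.
Hypotheses (hchi2 : mul_char chi2) (hchi3 : mul_char chi3).
Hypotheses (hM : conductor chi2 M) (hN : conductor chi3 N).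
Hypotheses (hMN : (M <= N)%N) (hN0 : (0 < N)%N).
Context {c d : triple}.
Local Notation m := (Triple M N N).
Hypotheses (Tc : TTm m c) (Td : TTm m d).
Local Notation compat := (@compat R k chi2 chi3 M c d).

Lemma compatI g :
  (forall h h', Cgrp c h -> Cgrp d h' -> h *m g = g *m h' ->
    ((0 < M)%N -> idl M (h 1 1 - h' 1 1)) /\ idl N (h 2 2 - h' 2 2)) ->
  compat g.
Proof.
have [[c2 c3 d2 d3] [[? ? ? ?] [? ? ? ?]]] := level_facts hMN hN0 Tc Td.
move=> H h h' Ch Ch' /(H _ _ Ch Ch') [H1 H2].
have [u22 _] := Cgrp_unit c2 c3 Ch; have [u22' _] := Cgrp_unit d2 d3 Ch'.
rewrite /chi (trivial_on_level_eq hchi3 hN.1 _ _ H2) //; congr (_ * _).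
case: eqP => // M0.
have [c1 d1] : 1 <= c.(t1) /\ 1 <= d.(t1).
  by case: Tc Td => _ [/= ? _ _] [_ [/= ? _ _]]; lia.
have [_ ? _] := Cgrp_diag_unit c2 c3 c1 Ch; have [_ ? _] := Cgrp_diag_unit d2 d3 d1 Ch'.
by apply: (trivial_on_level_eq hchi2 hM.1) => //; apply: H1; lia.
Qed.

Lemma deep_diag (A B Z : k) (L : int) h h' : A != 0 -> B != 0 -> Z != 0 ->
  deep (c := c) (d := d) A B Z L -> Cgrp c h -> Cgrp d h' ->
  h *m tform A B Z = tform A B Z *m h' -> idl L (h 1 1 - h' 1 1).
Proof.
move=> A0 B0 Z0 [D0 L1 L2 [L3 L4 L5 L6]] /Cgrp_idl Ch /Cgrp_idl Ch' /tform_eqs.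
move=> [_ [[e10 e11 _] [e20 e21 _]]].
move: Ch Ch' => [_ [[h10 _ _] [h20 h21 _]]] [_ [[h10' _ _] [h20' h21' _]]].
have -> : h 1 1 - h' 1 1 = - (B / Z * h' 1 0) + A / Z * h 2 1
  + (A * h' 2 1 - B * h 1 0) / (A * B - Z)
  + A * B * (h 2 0 - h' 2 0) / Z / (A * B - Z).
  apply: (mulfI (mulf_neq0 Z0 D0)); apply/eqP; rewrite -subr_eq0; apply/eqP.
  (* This combination of the four lower left equations eliminates [h 1 2], [h 2 2], [h' 0 0] and
     [h' 0 1], leaving the two middle entries and the constrained ones. *)
  transitivity (Z * B * (h 1 0 + h 1 1 * A + h 1 2 * Z - (A * h' 0 0 + h' 1 0))
    - A * B * (h 2 0 + h 2 1 * A + h 2 2 * Z - (Z * h' 0 0 + B * h' 1 0 + h' 2 0))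
    + Z * A * (h 2 1 + h 2 2 * B - (Z * h' 0 1 + B * h' 1 1 + h' 2 1))
    - Z ^+ 2 * (h 1 1 + h 1 2 * B - (A * h' 0 1 + h' 1 1))).
    by field; nz_tac.
  by rewrite e10 e11 e20 e21 !subrr; ring.
idl_tac.
Qed.

Lemma compat_tform (A B Z : k) : A != 0 -> B != 0 -> Z != 0 ->
  0 <= valk B -> valk A <= valk Z -> valk B <= valk Z ->
  [\/ M%:Z <= valk A /\ N%:Z <= valk B,
      N%:Z <= valk B /\ deep (c := c) (d := d) A B Z M
    | N%:Z <= valk A /\ deep (c := c) (d := d) A B Z N] ->
  compat (tform A B Z).
Proof.
move=> A0 B0 Z0 b0 a13 a23 H; apply: compatI => h h' Ch Ch' E.
have [[_ _ e02] [[_ e11 e12] [_ _ e22]]] := tform_eqs E.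
have [[h00 h01 h02] [[h10 h11 h12] [h20 h21 h22]]] := Cgrp_idl Ch.
have [[h00' h01' h02'] [[h10' h11' h12'] [h20' h21' h22']]] := Cgrp_idl Ch'.
have d22 : h 2 2 - h' 2 2 = Z * h' 0 2 + B * h' 1 2 by rewrite e22; ring.
have d11 : h 1 1 - h' 1 1 = A * h' 0 1 - h 1 2 * B.
  by apply/eqP; rewrite subr_eq addrAC -e11 addrK.
case: H => [[a1 a2]|[a2 D]|[a1 D]].
- by split=> [_|]; rewrite ?d11 ?d22; idl_tac.
- split=> [_|]; first exact: deep_diag E.
  by rewrite d22; idl_tac.
have iN := deep_diag A0 B0 Z0 D Ch Ch' E.
split=> [_|]; first by idl_tac.
(* [B] may be too shallow here, so the term [B * h' 1 2] is replaced through the middle difference,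
   already known to be in p^N; what remains is divisible by A or Z. *)
have -> : h 2 2 - h' 2 2 = (Z - A * B) * h' 0 2 + A * h' 0 1 - (h 1 1 - h' 1 1).
  by rewrite d22 d11 e12; ring.
idl_tac.
Qed.

Lemma compat_s1form (A B : k) : A != 0 -> B != 0 ->
  N%:Z <= valk A <= Num.min d.(t2) c.(t3) - M%:Z ->
  N%:Z <= valk B <= Num.min c.(t2) d.(t3) - M%:Z ->
  M%:Z - c.(t1) <= valk B - valk A <= d.(t1) - M%:Z ->
  compat (s1form A B).
Proof.
move=> A0 B0 a1 a2 a3; apply: compatI => h h' Ch Ch' /s1form_eqs.
move=> [[e00 e01 e02] [[e10 e11 e12] [e20 e21 e22]]].
have [[h00 h01 h02] [[h10 h11 h12] [h20 h21 h22]]] := Cgrp_idl Ch.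
have [[h00' h01' h02'] [[h10' h11' h12'] [h20' h21' h22']]] := Cgrp_idl Ch'.
split=> [_|]; last first.
  rewrite (_ : _ - _ = B * h' 0 2 + A * h' 1 2); first by idl_tac.
  by rewrite e22; ring.
(* The equations at (2,1) and (2,0), divided by A and B, both express [h 2 2]; in their difference
   the terms with [h 1 2] cancel. *)
have -> : h 1 1 - h' 1 1 = (B * h 1 0 + h' 2 1 - h 2 0) / A
  - (A * h' 1 0 + h' 2 0 - h 2 1) / B.
  have -> : h' 2 1 = h 2 0 + h 2 2 * A - (B * h' 0 1 + A * h' 1 1).
    by rewrite e21; ring.
  have -> : h' 2 0 = h 2 1 + h 2 2 * B - (B * h' 0 0 + A * h' 1 0).
    by rewrite e20; ring.
  by rewrite -e11 -e10; field; nz_tac.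
idl_tac.
Qed.

Lemma compat_s2form (A B : k) : A != 0 -> B != 0 ->
  N%:Z <= valk A <= Num.min d.(t1) c.(t3) - N%:Z ->
  N%:Z <= valk B <= Num.min c.(t1) d.(t3) - N%:Z ->
  N%:Z - c.(t2) <= valk B - valk A <= d.(t2) - N%:Z ->
  compat (s2form A B).
Proof.
move=> A0 B0 a1 a2 a3; apply: compatI => h h' Ch Ch' /s2form_eqs.
move=> [[e00 e01 e02] [[e10 e11 e12] [e20 e21 e22]]].
have [[h00 h01 h02] [[h10 h11 h12] [h20 h21 h22]]] := Cgrp_idl Ch.
have [[h00' h01' h02'] [[h10' h11' h12'] [h20' h21' h22']]] := Cgrp_idl Ch'.
(* Modulo p^N the last two diagonal entries are exchanged: [h 1 1] is congruent to [h' 2 2] and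
   [h 2 2] to [h' 1 1]. So it suffices that [h 1 1] and [h 2 2] agree. *)
have i12 : idl N (h 1 1 - h 2 2).
  have -> : h 1 1 - h 2 2 = (h' 2 0 - h 1 0 - A * h' 2 1) / B
    - (h' 1 0 - h 2 0 - B * h 2 1) / A - A * h' 0 1.
    have -> : h' 2 0 = h 1 0 + h 1 1 * B + h 1 2 * A - B * h' 0 0.
      by rewrite e10; ring.
    have -> : h' 1 0 = h 2 0 + h 2 1 * B + h 2 2 * A - A * h' 0 0.
      by rewrite e20; ring.
    by rewrite e11; field; nz_tac.
  idl_tac.
split=> [_|].
  have -> : h 1 1 - h' 1 1 = (h 1 1 - h 2 2) + A * h' 0 1 by rewrite e21; ring.
  idl_tac.
have -> : h 2 2 - h' 2 2 = - (h 1 1 - h 2 2) + B * h' 0 2 by rewrite e12; ring.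
idl_tac.
Qed.

End Sufficiency.

(** * Normal forms in the cells *)

Section Uniformizer.
Context {k : padicField} { pi : k}.
Hypothesis hpi : uniformizer pi.

Lemma pi_neq0 (n : int) : pi ^ n != 0.
Proof. by apply: expfz_neq0; case: hpi. Qed.

Lemma valk_pi (n : int) : valk (pi ^ n) = n.
Proof.
case: hpi => p0 p1; have natE (m : nat) : valk (pi ^ m%:Z) = m%:Z.
  elim: m => [|m IH]; first by rewrite expr0z valk1.
  by rewrite exprSz valkM ?pi_neq0 // p1 IH; lia.
case: n => n; first exact: natE.
by rewrite NegzE -invr_expz valkV ?pi_neq0 // natE.
Qed.

End Uniformizer.

Section Reduction.
Context {k : padicField} { pi : k} {c d : triple}.
Hypothesis hpi : uniformizer pi.
Hypothesis u2 : runit (1 + 1 : k).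
Hypotheses (Tc : TT c) (Td : TT d).
Hypotheses (c2 : 1 <= c.(t2)) (c3 : 1 <= c.(t3)) (d2 : 1 <= d.(t2)) (d3 : 1 <= d.(t3)).
Implicit Types A B Z s u x : k.

Lemma TT_facts : [/\ 0 <= c.(t1), 0 <= d.(t1), c.(t1) <= c.(t3) & d.(t1) <= d.(t3)]
  /\ (c.(t2) <= c.(t3) /\ d.(t2) <= d.(t3)).
Proof. by case: Tc Td => [? ? ? ? ?] [? ? ? ? ?]; do !split. Qed.

Lemma rtrans (g1 g2 g3 : 'M[k]_3) : dceq c d g1 g2 -> dceq c d g2 g3 -> dceq c d g1 g3.
Proof. exact: dceq_trans. Qed.

Local Ltac op h h' := have [[? ? ? ?] [? ?]] := TT_facts; exists h, h'; dceq_tac.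

(** In these names [L] means a left factor in C_c and [R] a right factor in C_d; the digits give the
    position of its entry, numbered from 1. *)
Lemma tform_L21 A B Z s : idl c.(t1) s ->
  dceq c d (tform A B Z) (tform (A + s) B Z).
Proof. by move=> is_; op (M3 1 0 0 s 1 0 0 0 1) (M3 1 0 0 0 1 0 0 0 1 : 'M[k]_3). Qed.

Lemma tform_R21 A B Z s : idl d.(t1) s ->
  dceq c d (tform A B Z) (tform (A + s) B (Z + B * s)).
Proof. by move=> is_; op (M3 1 0 0 0 1 0 0 0 1 : 'M[k]_3) (M3 1 0 0 (- s) 1 0 0 0 1). Qed.

Lemma tform_L32 A B Z s : idl c.(t2) s ->
  dceq c d (tform A B Z) (tform A (B + s) (Z + s * A)).
Proof. by move=> is_; op (M3 1 0 0 0 1 0 0 s 1) (M3 1 0 0 0 1 0 0 0 1 : 'M[k]_3). Qed.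

Lemma tform_R32 A B Z s : idl d.(t2) s ->
  dceq c d (tform A B Z) (tform A (B + s) Z).
Proof. by move=> is_; op (M3 1 0 0 0 1 0 0 0 1 : 'M[k]_3) (M3 1 0 0 0 1 0 0 (- s) 1). Qed.

Lemma tform_L31 A B Z s : idl c.(t3) s ->
  dceq c d (tform A B Z) (tform A B (Z + s)).
Proof. by move=> is_; op (M3 1 0 0 0 1 0 s 0 1) (M3 1 0 0 0 1 0 0 0 1 : 'M[k]_3). Qed.

Lemma tform_R31 A B Z s : idl d.(t3) s ->
  dceq c d (tform A B Z) (tform A B (Z + s)).
Proof. by move=> is_; op (M3 1 0 0 0 1 0 0 0 1 : 'M[k]_3) (M3 1 0 0 0 1 0 (- s) 0 1). Qed.

(** An upper unipotent factor destroys the lower unipotent shape; torus and upper triangular factors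
    restore it, whence the denominators. *)
Lemma tform_E23 A B Z u : idl 0 u -> runit (1 + u * B) ->
  dceq c d (tform A B Z)
    (tform ((A + u * Z) / (1 + u * B)) (B * (1 + u * B)) (Z * (1 + u * B))).
Proof.
move=> iu uB.
by op (M3 1 0 0 0 (1 + u * B)^-1 (u / (1 + u * B)) 0 0 (1 + u * B))
  (M3 1 0 0 0 1 (u / (1 + u * B)) 0 0 1).
Qed.

Lemma tform_E12 A B Z u : idl 0 u -> runit (1 + u * A) ->
  dceq c d (tform A B Z)
    (tform (A * (1 + u * A)) ((B + u * Z) / (1 + u * A)) (Z * (1 + u * A))).
Proof.
move=> iu uA.
by op (M3 1 (- u / (1 + u * A)) 0 0 1 0 0 0 1)
  (M3 (1 + u * A)^-1 (- u / (1 + u * A)) 0 0 (1 + u * A) 0 0 0 1).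
Qed.

(** The torus rescales A and B by arbitrary units and preserves Z / (A B), so one unit parameter x
    remains. *)
Lemma tform_torus A B Z A' B' : A != 0 -> B != 0 -> A' != 0 -> B' != 0 ->
  valk A = valk A' -> valk B = valk B' ->
  dceq c d (tform A B Z) (tform A' B' (Z * A' * B' / A / B)).
Proof.
move=> A0 B0 A0' B0' eA eB.
have uA : runit (A' / A) by split; rewrite ?mulf_neq0 ?invr_neq0 // valk_div //; lia.
have uB : runit (B' / B) by split; rewrite ?mulf_neq0 ?invr_neq0 // valk_div //; lia.
by op (M3 1 0 0 0 (A' / A) 0 0 0 (A' / A * (B' / B)))
  (M3 1 0 0 0 (A' / A) 0 0 0 (A' / A * (B' / B))).
Qed.

(** An entry deeper than p^n, possibly zero, is replaced by pi^n; afterwards all entries have a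
    valuation. *)
Lemma clip x (n : int) : idl 1 x -> 1 <= n ->
  exists s, [/\ idl n s, x + s != 0 & 1 <= valk (x + s) <= n].
Proof.
move=> ix n1; have [x0|x0] := eqVneq x 0.
  exists (pi ^ n); rewrite x0 add0r (pi_neq0 hpi) (valk_pi hpi); split=> //; try lia.
  by right; rewrite (valk_pi hpi).
have /(idl_neq0 _ x0) vx := ix.
have [le|lt] := lerP (valk x) n.
  by exists 0; rewrite addr0; split=> //; [exact: idl0|lia].
have p0 := pi_neq0 hpi n; have vp := valk_pi hpi n.
exists (pi ^ n - x); rewrite (addrC x) subrK (valk_pi hpi) (pi_neq0 hpi); split=> //; last by lia.
idl_tac.
Qed.

(** Meant for lowering val Z by adding s A or B s: s needs valuation exactly n, yet must not alter
    the valuation of the entry it is added to. When val x = n, s = x works because 2 is a unit. *)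
Lemma shift_val x (n : int) : x != 0 -> valk x <= n ->
  exists s, [/\ s != 0, valk s = n, x + s != 0 & valk (x + s) = valk x].
Proof.
move=> x0; rewrite le_eqVlt => /orP[/eqP xn|lt].
  have e : x + x = (1 + 1) * x by rewrite mulrDl mul1r.
  by exists x; rewrite e val_mul_unit // mulf_neq0 ?(runit_neq0 u2).
exists (pi ^ n); rewrite (pi_neq0 hpi) (valk_pi hpi).
by have [] := @valkD_lt k x (pi ^ n) n x0 _ lt; first by right; rewrite (valk_pi hpi).
Qed.

Lemma tform_clipA A B Z : idl 1 A -> idl 1 B -> idl 1 Z ->
  exists A' Z', [/\ A' != 0, idl 1 Z',
    [/\ 1 <= valk A', valk A' <= under c.(t1) & valk A' <= under d.(t1)] & dceq c d (tform A B Z) (tform A' B Z')].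
Proof.
have [[? ? ? ?] [? ?]] := TT_facts; rewrite /under => iA iB iZ.
have [le|lt] := lerP (Num.max c.(t1) 1) (Num.max d.(t1) 1).
  have [s [is_ s0 sv]] := clip iA (n := Num.max c.(t1) 1) ltac:(lia).
  exists (A + s), Z; split=> //; first by split; lia.
  by apply: tform_L21; idl_tac.
have [s [is_ s0 sv]] := clip iA (n := Num.max d.(t1) 1) ltac:(lia).
exists (A + s), (Z + B * s); split=> //; [by idl_tac|by split; lia|].
by apply: tform_R21; idl_tac.
Qed.

Lemma tform_clipB A B Z : idl 1 A -> idl 1 B -> idl 1 Z ->
  exists B' Z', [/\ B' != 0, idl 1 Z',
    [/\ 1 <= valk B', valk B' <= c.(t2) & valk B' <= d.(t2)] & dceq c d (tform A B Z) (tform A B' Z')].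
Proof.
have [[? ? ? ?] [? ?]] := TT_facts => iA iB iZ.
have [le|lt] := lerP c.(t2) d.(t2).
  have [s [is_ s0 sv]] := clip iB c2.
  exists (B + s), (Z + s * A); split=> //; [by idl_tac|by split; lia|].
  exact: tform_L32.
have [s [is_ s0 sv]] := clip iB d2.
by exists (B + s), Z; split=> //; [by split; lia|exact: tform_R32].
Qed.

Lemma tform_clipZ A B Z : idl 1 Z ->
  exists Z', [/\ Z' != 0,
    [/\ 1 <= valk Z', valk Z' <= c.(t3) & valk Z' <= d.(t3)] & dceq c d (tform A B Z) (tform A B Z')].
Proof.
move=> iZ; have [le|lt] := lerP c.(t3) d.(t3).
  have [s [is_ s0 sv]] := clip iZ c3.
  by exists (Z + s); split=> //; [by split; lia|exact: tform_L31].
have [s [is_ s0 sv]] := clip iZ d3.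
by exists (Z + s); split=> //; [by split; lia|exact: tform_R31].
Qed.

Lemma tform_leA A B Z : A != 0 -> B != 0 -> Z != 0 ->
  1 <= valk A -> 1 <= valk B -> 1 <= valk Z ->
  exists A' B' Z', [/\ A' != 0, B' != 0 & Z' != 0] /\
    [/\ [/\ 1 <= valk A', valk A' <= valk A & valk A' <= valk Z'],
      valk B' = valk B, valk Z' = valk Z & dceq c d (tform A B Z) (tform A' B' Z')].
Proof.
move=> A0 B0 Z0 a1 a2 a3; have i1 := @idl1 k; have iB : idl 1 B by idl_tac.
have [le|lt] := lerP (valk A) (valk Z).
  by exists A, B, Z; do !split=> //; exact: dceq_refl.
have uB : runit (1 + 1 * B) by rewrite mul1r; apply: runitD => //; exact: runit1.
have uB0 := runit_neq0 uB.
have [ZA0 ZA] : A + 1 * Z != 0 /\ valk (A + 1 * Z) = valk Z.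
  by rewrite mul1r addrC; apply: (valkD_lt Z0 (idl_val A)); lia.
exists ((A + 1 * Z) / (1 + 1 * B)), (B * (1 + 1 * B)), (Z * (1 + 1 * B)).
split; first by rewrite !mulf_neq0 ?invr_neq0.
split; last exact: tform_E23.
- by rewrite valk_div // valkM // uB.2; split; lia.
- by rewrite valkM // uB.2; lia.
- by rewrite valkM // uB.2; lia.
Qed.

Lemma tform_leB A B Z : A != 0 -> B != 0 -> Z != 0 ->
  1 <= valk A -> 1 <= valk B -> 1 <= valk Z ->
  exists A' B' Z', [/\ A' != 0, B' != 0 & Z' != 0] /\
    [/\ [/\ 1 <= valk B', valk B' <= valk B & valk B' <= valk Z'],
      valk A' = valk A, valk Z' = valk Z & dceq c d (tform A B Z) (tform A' B' Z')].
Proof.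
move=> A0 B0 Z0 a1 a2 a3; have i1 := @idl1 k; have iA : idl 1 A by idl_tac.
have [le|lt] := lerP (valk B) (valk Z).
  by exists A, B, Z; do !split=> //; exact: dceq_refl.
have uA : runit (1 + 1 * A) by rewrite mul1r; apply: runitD => //; exact: runit1.
have uA0 := runit_neq0 uA.
have [ZB0 ZB] : B + 1 * Z != 0 /\ valk (B + 1 * Z) = valk Z.
  by rewrite mul1r addrC; apply: (valkD_lt Z0 (idl_val B)); lia.
exists (A * (1 + 1 * A)), ((B + 1 * Z) / (1 + 1 * A)), (Z * (1 + 1 * A)).
split; first by rewrite !mulf_neq0 ?invr_neq0.
split; last exact: tform_E12.
- by rewrite valk_div // valkM // uA.2; split; lia.
- by rewrite valkM // uA.2; lia.
- by rewrite valkM // uA.2; lia.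
Qed.

(** If Z is too deep, adding s A with val s = c_2 brings its valuation down to val A + c_2, while B
    + s keeps the valuation of B. *)
Lemma tform_leAc A B Z : A != 0 -> B != 0 -> Z != 0 -> valk B <= c.(t2) ->
  0 <= valk A <= valk Z -> valk B <= valk Z ->
  exists B' Z', [/\ B' != 0, Z' != 0, valk B' = valk B,
    [/\ valk Z' <= valk Z, valk Z' <= valk A + c.(t2), valk A <= valk Z' & valk B <= valk Z']
    & dceq c d (tform A B Z) (tform A B' Z')].
Proof.
move=> A0 B0 Z0 leB leAZ leBZ; have [le|lt] := lerP (valk Z) (valk A + c.(t2)).
  by exists B, Z; do !split=> //; try lia; exact: dceq_refl.
have [s [s0 sv Bs0 Bsv]] := shift_val B0 leB.
have sA0 : s * A != 0 by rewrite mulf_neq0.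
have [ZA0 ZA] : Z + s * A != 0 /\ valk (Z + s * A) = valk (s * A).
  by rewrite addrC; apply: (valkD_lt sA0 (idl_val Z)); rewrite valkM //; lia.
exists (B + s), (Z + s * A); split=> //; last by apply: tform_L32; idl_tac.
by rewrite ZA valkM //; split; lia.
Qed.

Lemma tform_leBd A B Z : A != 0 -> B != 0 -> Z != 0 -> valk A <= under d.(t1) ->
  0 <= valk B <= valk Z -> valk A <= valk Z ->
  exists A' Z', [/\ A' != 0, Z' != 0, valk A' = valk A,
    [/\ valk Z' <= valk Z, valk Z' <= under d.(t1) + valk B, valk A <= valk Z' & valk B <= valk Z']
    & dceq c d (tform A B Z) (tform A' B Z')].
Proof.
have ud1 : 1 <= under d.(t1) by rewrite /under; lia.
move=> A0 B0 Z0 leA leBZ leAZ; have [le|lt] := lerP (valk Z) (under d.(t1) + valk B).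
  by exists A, Z; do !split=> //; try lia; exact: dceq_refl.
have [s [s0 sv As0 Asv]] := shift_val A0 leA.
have sB0 : B * s != 0 by rewrite mulf_neq0.
have [ZB0 ZB] : Z + B * s != 0 /\ valk (Z + B * s) = valk (B * s).
  by rewrite addrC; apply: (valkD_lt sB0 (idl_val Z)); rewrite valkM //; lia.
exists (A + s), (Z + B * s); split=> //; last by apply: tform_R21; rewrite /under in sv; idl_tac.
by rewrite ZB valkM //; split; lia.
Qed.

Lemma tform_pi A B Z : A != 0 -> B != 0 -> Z != 0 ->
  exists2 x, runit x & dceq c d (tform A B Z) (tmx pi (Triple (valk A) (valk B) (valk Z)) x).
Proof.
move=> A0 B0 Z0; have pA := pi_neq0 hpi (valk A); have pB := pi_neq0 hpi (valk B).
have pZ := pi_neq0 hpi (valk Z).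
exists (Z * pi ^ valk A * pi ^ valk B / A / B / pi ^ valk Z).
  split; first by rewrite !mulf_neq0 ?invr_neq0.
  by rewrite !valk_div ?mulf_neq0 ?invr_neq0 // !valkM ?mulf_neq0 // !(valk_pi hpi); lia.
have -> : tmx pi (Triple (valk A) (valk B) (valk Z))
    (Z * pi ^ valk A * pi ^ valk B / A / B / pi ^ valk Z) =
  tform (pi ^ valk A) (pi ^ valk B) (Z * pi ^ valk A * pi ^ valk B / A / B).
  by rewrite /tmx /= divfK.
by apply: tform_torus => //; rewrite (valk_pi hpi).
Qed.

(** The bounds from above that survive the later moves, as those never raise a valuation. *)
Definition bounded A B Z : Prop :=
  [/\ [/\ A != 0, B != 0 & Z != 0],
      [/\ 1 <= valk A, valk A <= under c.(t1) & valk A <= under d.(t1)],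
      [/\ 1 <= valk B, valk B <= c.(t2) & valk B <= d.(t2)]
    & [/\ 1 <= valk Z, valk Z <= c.(t3) & valk Z <= d.(t3)]].

Lemma tform_bounded A B Z : idl 1 A -> idl 1 B -> idl 1 Z ->
  exists A' B' Z', bounded A' B' Z' /\ dceq c d (tform A B Z) (tform A' B' Z').
Proof.
move=> iA iB iZ.
have [A1 [Z1 [A10 iZ1 b1 e1]]] := tform_clipA iA iB iZ.
have iA1 : idl 1 A1 by apply/(idl_neq0 _ A10); case: b1.
have [B1 [Z2 [B10 iZ2 b2 e2]]] := tform_clipB iA1 iB iZ1.
have [Z3 [Z30 b3 e3]] := tform_clipZ A1 B1 iZ2.
by exists A1, B1, Z3; split=> //; apply: rtrans e1 (rtrans e2 e3).
Qed.

Lemma tform_ordered A B Z : bounded A B Z ->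
  exists A' B' Z', [/\ bounded A' B' Z', valk A' <= valk Z', valk B' <= valk Z'
    & dceq c d (tform A B Z) (tform A' B' Z')].
Proof.
move=> [[A0 B0 Z0] [A1 A2 A3] [B1 B2 B3] [Z1 Z2 Z3]].
have [A' [B' [Z' [[A0' B0' Z0'] [[? ? ?] eB eZ e1]]]]] := tform_leA A0 B0 Z0 A1 B1 Z1.
rewrite -eB in B1 B2 B3; rewrite -eZ in Z1 Z2 Z3.
have A2' : valk A' <= under c.(t1) by lia.
have A3' : valk A' <= under d.(t1) by lia.
clear A1 A2 A3 eB eZ.
have [||| A'' [B'' [Z'' [[A0'' B0'' Z0''] [[hB1 hB hBZ] eA eZ e2]]]]] :=
  tform_leB A0' B0' Z0'; try by [].
exists A'', B'', Z''; rewrite /bounded eA; split=> //; [|by rewrite eZ|exact: rtrans e1 e2].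
rewrite eZ; do !split=> //; [exact: le_trans hB B2|exact: le_trans hB B3].
Qed.

Lemma tform_sharp A B Z : bounded A B Z -> valk A <= valk Z -> valk B <= valk Z ->
  exists A' B' Z', bounded A' B' Z' /\
    [/\ valk A' <= valk Z', valk B' <= valk Z', valk Z' <= valk A' + c.(t2),
      valk Z' <= under d.(t1) + valk B'
    & dceq c d (tform A B Z) (tform A' B' Z')].
Proof.
move=> [[A0 B0 Z0] [A1 A2 A3] [B1 B2 B3] [Z1 Z2 Z3]] AZ BZ.
have A0v : 0 <= valk A <= valk Z by lia.
have [B' [Z' [B0' Z0' eB [hZ ZA AZ' BZ'] e1]]] := tform_leAc A0 B0 Z0 B2 A0v BZ.
rewrite -eB in B1 B2 B3.
have B0v : 0 <= valk B' <= valk Z' by rewrite eB BZ' andbT; lia.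
have [A' [Z'' [A0' Z0'' eA [hZ' ZB AZ'' BZ''] e2]]] := tform_leBd A0 B0' Z0' A3 B0v AZ'.
rewrite -eA in A1 A2 A3 AZ''.
have hZZ := le_trans hZ' hZ.
exists A', B', Z''; split; last first.
  split=> //; [by rewrite eA; exact: le_trans hZ' ZA|exact: rtrans e1 e2].
split=> //; split; [exact: le_trans A1 AZ''|exact: le_trans hZZ Z2|exact: le_trans hZZ Z3].
Qed.

Lemma tform_reduce A B Z : idl 1 A -> idl 1 B -> idl 1 Z ->
  exists a x, [/\ Tcd c d a, runit x & dceq c d (tform A B Z) (tmx pi a x)].
Proof.
move=> iA iB iZ.
have [A1 [B1 [Z1 [b1 e1]]]] := tform_bounded iA iB iZ.
have [A2 [B2 [Z2 [b2 AZ2 BZ2 e2]]]] := tform_ordered b1.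
have [A7 [B6 [Z7 [b3 [AZ7 BZ7 ZA7 ZB7 e3]]]]] := tform_sharp b2 AZ2 BZ2.
have [[A70 B60 Z70] [A71 A7c A7d] [B71 B7c B7d] [Z71 Z7c Z7d]] := b3.
have e := rtrans e1 (rtrans e2 e3); clear e1 e2 e3 b1 b2 b3 AZ2 BZ2.
have [[? ? ? ?] [? ?]] := TT_facts.
have [x ux ex] := tform_pi A70 B60 Z70.
have [/andP[/eqP c10 /eqP d10]|cd] := boolP ((c.(t1) == 0) && (d.(t1) == 0)); last first.
  exists (Triple (valk A7) (valk B6) (valk Z7)), x; split=> //; last exact: rtrans ex.
  rewrite /Tcd (negPf cd); rewrite /under in A7c A7d ZB7 *.
  by split; do ?split; rewrite /= /under; lia.
have TE n : 1 <= n -> n <= c.(t2) -> n <= d.(t2) -> Tcd c d (Triple 1 n n).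
  by move=> *; rewrite /Tcd c10 d10 eqxx /=; exists n => //; split; lia.
rewrite /under c10 d10 in A7c A7d ZB7.
have v1 : valk A7 = 1 by lia.
have [eZ|nZ] := eqVneq (valk Z7) (valk B6).
  exists (Triple (valk A7) (valk B6) (valk Z7)), x; split=> //; last exact: rtrans ex.
  by rewrite eZ v1; apply: TE; lia.
have [ZB0 ZBv] : B6 + Z7 != 0 /\ valk (B6 + Z7) = valk B6.
  by apply: (valkD_lt B60 (idl_val Z7)); lia.
(* With c_1 = d_1 = 0 the entry -1 at (1,0) is allowed on both sides; its two effects on A cancel,
   and B is added to Z. *)
have e8 : dceq c d (tform A7 B6 Z7) (tform A7 B6 (B6 + Z7)).
  have i1 := @idl1 k; have u1 := @runit1 k.
  exists (M3 1 0 0 (- 1) 1 0 0 0 1), (M3 1 0 0 (- 1) 1 0 0 0 1).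
  by dceq_tac.
have [x' ux' ex'] := tform_pi A70 B60 ZB0.
exists (Triple (valk A7) (valk B6) (valk (B6 + Z7))), x'; split=> //.
  by rewrite ZBv v1; apply: TE; lia.
by apply: rtrans e _; apply: rtrans e8 ex'.
Qed.

(** Once both entries are clipped, at most one inequality on be - al fails; the deeper entry is then
    replaced by the power of pi at the boundary, using the (1,0) entry of C_d or of C_c. *)
Lemma s1form_reduce A B : idl 1 A -> idl 1 B -> 1 <= c.(t1) -> 1 <= d.(t1) ->
  exists al be, [/\ 1 <= al <= Num.min d.(t2) c.(t3), 1 <= be <= Num.min c.(t2) d.(t3),
    - c.(t1) <= be - al <= d.(t1) & dceq c d (s1form A B) (s1form (pi ^ al) (pi ^ be))].
Proof.
have [[? ? ? ?] [? ?]] := TT_facts => iA iB c1 d1.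
have torus X Y : X != 0 -> Y != 0 ->
    dceq c d (s1form X Y) (s1form (pi ^ valk X) (pi ^ valk Y)).
  move=> X0 Y0; have pX := pi_neq0 hpi (valk X); have pY := pi_neq0 hpi (valk Y).
  have uX : runit (X / pi ^ valk X).
    by split; rewrite ?mulf_neq0 ?invr_neq0 // valk_div // (valk_pi hpi); lia.
  have uY : runit (Y / pi ^ valk Y).
    by split; rewrite ?mulf_neq0 ?invr_neq0 // valk_div // (valk_pi hpi); lia.
  exists (M3 (X / pi ^ valk X) 0 0 0 (Y / pi ^ valk Y) 0 0 0 1),
    (M3 (Y / pi ^ valk Y) 0 0 0 (X / pi ^ valk X) 0 0 0 1).
  by dceq_tac.
have [A1 [A10 A1v e1]] : exists A1, [/\ A1 != 0, 1 <= valk A1 <= Num.min d.(t2) c.(t3)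
    & dceq c d (s1form A B) (s1form A1 B)].
  have [le|lt] := lerP d.(t2) c.(t3).
    have [s [is_ s0 sv]] := clip iA d2.
    exists (A + s); split=> //; try lia.
    by exists (M3 1 0 0 0 1 0 0 0 1 : 'M[k]_3), (M3 1 0 0 0 1 0 0 (- s) 1); dceq_tac.
  have [s [is_ s0 sv]] := clip iA c3.
  exists (A + s); split=> //; try lia.
  by exists (M3 1 0 0 0 1 0 s 0 1), (M3 1 0 0 0 1 0 0 0 1 : 'M[k]_3); dceq_tac.
have [B1 [B10 B1v e2]] : exists B1, [/\ B1 != 0, 1 <= valk B1 <= Num.min c.(t2) d.(t3)
    & dceq c d (s1form A1 B) (s1form A1 B1)].
  have [le|lt] := lerP d.(t3) c.(t2).
    have [s [is_ s0 sv]] := clip iB d3.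
    exists (B + s); split=> //; try lia.
    by exists (M3 1 0 0 0 1 0 0 0 1 : 'M[k]_3), (M3 1 0 0 0 1 0 (- s) 0 1); dceq_tac.
  have [s [is_ s0 sv]] := clip iB c2.
  exists (B + s); split=> //; try lia.
  by exists (M3 1 0 0 0 1 0 0 s 1), (M3 1 0 0 0 1 0 0 0 1 : 'M[k]_3); dceq_tac.
have e := rtrans e1 e2.
have [leB|ltB] := lerP (valk B1) (valk A1 + d.(t1)); last first.
  have [n nE] : exists n, n = valk A1 + d.(t1) by exists (valk A1 + d.(t1)).
  have p0 := pi_neq0 hpi n; have vp := valk_pi hpi n.
  have is_ : idl d.(t1) ((B1 - pi ^ n) / A1) by idl_tac.
  exists (valk A1), n; split; [lia|lia|lia|].
  apply: rtrans e _; apply: (@rtrans _ (s1form A1 (pi ^ n))); last by have := torus A1 (pi ^ n) A10 p0; rewrite vp.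
  exists (M3 1 ((B1 - pi ^ n) / A1) 0 0 1 0 0 0 1), (M3 1 0 0 ((B1 - pi ^ n) / A1) 1 0 0 0 1).
  by dceq_tac.
have [leA|ltA] := lerP (valk A1) (valk B1 + c.(t1)); last first.
  have [n nE] : exists n, n = valk B1 + c.(t1) by exists (valk B1 + c.(t1)).
  have p0 := pi_neq0 hpi n; have vp := valk_pi hpi n.
  have is_ : idl c.(t1) ((A1 - pi ^ n) / B1) by idl_tac.
  exists n, (valk B1); split; [lia|lia|lia|].
  apply: rtrans e _; apply: (@rtrans _ (s1form (pi ^ n) B1)); last by have := torus (pi ^ n) B1 p0 B10; rewrite vp.
  exists (M3 1 0 0 ((A1 - pi ^ n) / B1) 1 0 0 0 1), (M3 1 ((A1 - pi ^ n) / B1) 0 0 1 0 0 0 1).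
  by dceq_tac.
exists (valk A1), (valk B1); split; [lia|lia|lia|].
by apply: rtrans e _; exact: torus.
Qed.

Lemma s2form_reduce A B : idl 1 A -> idl 1 B -> 1 <= c.(t1) -> 1 <= d.(t1) ->
  exists al be, [/\ 1 <= al <= Num.min d.(t1) c.(t3), 1 <= be <= Num.min c.(t1) d.(t3),
    - c.(t2) <= be - al <= d.(t2) & dceq c d (s2form A B) (s2form (pi ^ al) (pi ^ be))].
Proof.
have [[? ? ? ?] [? ?]] := TT_facts => iA iB c1 d1.
have torus X Y : X != 0 -> Y != 0 ->
    dceq c d (s2form X Y) (s2form (pi ^ valk X) (pi ^ valk Y)).
  move=> X0 Y0; have pX := pi_neq0 hpi (valk X); have pY := pi_neq0 hpi (valk Y).
  have uX : runit (pi ^ valk X / X).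
    by split; rewrite ?mulf_neq0 ?invr_neq0 // valk_div // (valk_pi hpi); lia.
  have uY : runit (pi ^ valk Y / Y).
    by split; rewrite ?mulf_neq0 ?invr_neq0 // valk_div // (valk_pi hpi); lia.
  exists (M3 1 0 0 0 (pi ^ valk Y / Y) 0 0 0 (pi ^ valk X / X)),
    (M3 1 0 0 0 (pi ^ valk X / X) 0 0 0 (pi ^ valk Y / Y)).
  by dceq_tac.
have [A1 [A10 A1v e1]] : exists A1, [/\ A1 != 0, 1 <= valk A1 <= Num.min d.(t1) c.(t3)
    & dceq c d (s2form A B) (s2form A1 B)].
  have [le|lt] := lerP d.(t1) c.(t3).
    have [s [is_ s0 sv]] := clip iA d1.
    exists (A + s); split=> //; try lia.
    by exists (M3 1 0 0 0 1 0 0 0 1 : 'M[k]_3), (M3 1 0 0 (- s) 1 0 0 0 1); dceq_tac.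
  have [s [is_ s0 sv]] := clip iA c3.
  exists (A + s); split=> //; try lia.
  by exists (M3 1 0 0 0 1 0 s 0 1), (M3 1 0 0 0 1 0 0 0 1 : 'M[k]_3); dceq_tac.
have [B1 [B10 B1v e2]] : exists B1, [/\ B1 != 0, 1 <= valk B1 <= Num.min c.(t1) d.(t3)
    & dceq c d (s2form A1 B) (s2form A1 B1)].
  have [le|lt] := lerP d.(t3) c.(t1).
    have [s [is_ s0 sv]] := clip iB d3.
    exists (B + s); split=> //; try lia.
    by exists (M3 1 0 0 0 1 0 0 0 1 : 'M[k]_3), (M3 1 0 0 0 1 0 (- s) 0 1); dceq_tac.
  have [s [is_ s0 sv]] := clip iB c1.
  exists (B + s); split=> //; try lia.
  by exists (M3 1 0 0 s 1 0 0 0 1), (M3 1 0 0 0 1 0 0 0 1 : 'M[k]_3); dceq_tac.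
have e := rtrans e1 e2.
have [leB|ltB] := lerP (valk B1) (valk A1 + d.(t2)); last first.
  have [n nE] : exists n, n = valk A1 + d.(t2) by exists (valk A1 + d.(t2)).
  have p0 := pi_neq0 hpi n; have vp := valk_pi hpi n.
  have is_ : idl d.(t2) ((pi ^ n - B1) / A1) by idl_tac.
  exists (valk A1), n; split; [lia|lia|lia|].
  apply: rtrans e _; apply: (@rtrans _ (s2form A1 (pi ^ n))); last by have := torus A1 (pi ^ n) A10 p0; rewrite vp.
  exists (M3 1 0 0 0 1 ((pi ^ n - B1) / A1) 0 0 1), (M3 1 0 0 0 1 0 0 ((pi ^ n - B1) / A1) 1).
  by dceq_tac.
have [leA|ltA] := lerP (valk A1) (valk B1 + c.(t2)); last first.
  have [n nE] : exists n, n = valk B1 + c.(t2) by exists (valk B1 + c.(t2)).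
  have p0 := pi_neq0 hpi n; have vp := valk_pi hpi n.
  have is_ : idl c.(t2) ((pi ^ n - A1) / B1) by idl_tac.
  exists n, (valk B1); split; [lia|lia|lia|].
  apply: rtrans e _; apply: (@rtrans _ (s2form (pi ^ n) B1)); last by have := torus (pi ^ n) B1 p0 B10; rewrite vp.
  exists (M3 1 0 0 0 1 0 0 ((pi ^ n - A1) / B1) 1), (M3 1 0 0 0 1 ((pi ^ n - A1) / B1) 0 0 1).
  by dceq_tac.
exists (valk A1), (valk B1); split; [lia|lia|lia|].
by apply: rtrans e _; exact: torus.
Qed.

End Reduction.

(** * Separation of the double cosets *)

Lemma le_mins (n : int) s : s != [::] -> (n <= mins s) = all (fun y => n <= y) s.
Proof.
case: s => // y s _; rewrite /mins /=.
elim: s => [|z s IH] /=; first by rewrite andbT.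
by rewrite le_min IH andbCA.
Qed.

Section Bounds.
Context {c d : triple}.

Lemma acd_gt0 a n : 0 < n -> n <= acd c d a ->
  n <= mins ([:: a.(t1); a.(t2); a.(t3) - a.(t1); a.(t3) - a.(t2)]
     ++ sub3 c a ++ sub3 d a
     ++ [:: a.(t1) + c.(t2) - a.(t3); d.(t1) + a.(t2) - a.(t3)]).
Proof. by move=> n0; rewrite /acd; set m := mins _; lia. Qed.

Lemma acd'_gt0 a n : 0 < n -> n <= acd' c d a ->
  [/\ n <= d.(t3) - a.(t3), n <= c.(t3) - a.(t3), n <= c.(t1) - a.(t1)
    & n <= d.(t2) - a.(t2)].
Proof.
move=> n0; rewrite /acd' => h.
have : n <= mins [:: d.(t3) - a.(t3); c.(t3) - a.(t3); c.(t1) - a.(t1); d.(t2) - a.(t2)].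
  by move: h; set m := mins _; lia.
by rewrite le_mins // /= => /and5P[].
Qed.

Lemma acd_ge0 a : 0 <= acd c d a.
Proof. by rewrite /acd le_max lexx. Qed.

Lemma acd'_ge0 a : 0 <= acd' c d a.
Proof. by rewrite /acd' le_max lexx. Qed.

End Bounds.

Section TruncatedValuation.
Context {k : padicField}.
Implicit Type x : k.

Lemma tval_le x (n i : int) : i <= n -> (i <= Defs.tval x n) <-> idl i x.
Proof.
move=> le; rewrite /Defs.tval; have [->|x0] := eqVneq x 0; first by split=> _ //; exact: idl0.
by rewrite (idl_neq0 _ x0); split; lia.
Qed.

Lemma idl_tval x (n : int) : idl (Defs.tval x n) x.
Proof.
apply/(tval_le x (n := n)); rewrite ?lexx //.
by rewrite /Defs.tval; case: ifP => _; [exact: lexx|lia].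
Qed.

Lemma tval_leq x (n : int) : Defs.tval x n <= n.
Proof. by rewrite /Defs.tval; case: ifP => _; [exact: lexx|lia]. Qed.

Lemma tval0 x : idl 0 x -> Defs.tval x 0 = 0.
Proof.
by move=> /(@tval_le _ 0 0 (lexx _)) h; apply/eqP; rewrite eq_le tval_leq.
Qed.

End TruncatedValuation.

(** * Equal double cosets have equal a and equivalent x *)

Section Classes.
Context {k : padicField} { pi : k} {c d : triple}.
Hypothesis hpi : uniformizer pi.
Hypotheses (Tc : TT c) (Td : TT d).
Hypotheses (c2 : 1 <= c.(t2)) (c3 : 1 <= c.(t3)) (d2 : 1 <= d.(t2)) (d3 : 1 <= d.(t3)).
Implicit Types A B Z s u x y : k.

(** One list of bounds for both clauses of [Tcd]; the last conjunct keeps what is special to c_1 =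
    d_1 = 0. *)
Lemma Tcd_facts a : Tcd c d a ->
  [/\ [/\ 1 <= a.(t1), a.(t1) <= a.(t3), a.(t1) <= under c.(t1) & a.(t1) <= under d.(t1)],
      [/\ 1 <= a.(t2), a.(t2) <= a.(t3), a.(t2) <= c.(t2) & a.(t2) <= d.(t2)],
      [/\ a.(t3) <= c.(t3), a.(t3) <= d.(t3), a.(t3) <= a.(t1) + c.(t2)
        & a.(t3) <= under d.(t1) + a.(t2)]
    & c.(t1) = 0 -> d.(t1) = 0 -> a.(t3) = a.(t2)].
Proof.
have [[? ? ? ?] [? ?]] := TT_facts Tc Td; rewrite /Tcd; case: ifP => [|cd].
  move=> /andP[/eqP c10 /eqP d10] [n [n1 n2] <-] /=; rewrite c10 d10 /under.
  by split=> //; split; lia.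
move=> [[? ? ? ?] [/= r1 r2 r3] [/= r4 r5 r6] r7].
rewrite /under in r1 r2 r3 r4 r5 r6 r7 *.
split; [split; lia|split; lia|split; lia|].
by move=> c10 d10; rewrite c10 d10 !eqxx in cd.
Qed.

Lemma dceq_tform_B A B Z A' B' Z' : B != 0 -> B' != 0 -> Z' != 0 ->
  valk B' <= valk Z' -> valk B' <= c.(t2) -> valk B' <= d.(t2) ->
  dceq c d (tform A B Z) (tform A' B' Z') -> valk B' <= valk B.
Proof.
move=> B0 B0' Z0' b1 b2 b3 [h [h' [Ch Ch' /tform_eqs [_ [_ [_ e _]]]]]].
have [u22 _] := Cgrp_unit c2 c3 Ch.
have [[h00 h01 h02] [[h10 h11 h12] [h20 h21 h22]]] := Cgrp_idl Ch.
have [[h00' h01' h02'] [[h10' h11' h12'] [h20' h21' h22']]] := Cgrp_idl Ch'.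
apply/(idl_neq0 _ B0); apply: (idl_unitl u22).
have -> : h 2 2 * B = Z' * h' 0 1 + B' * h' 1 1 + h' 2 1 - h 2 1 by rewrite -e; ring.
idl_tac.
Qed.

Lemma dceq_tform_A A B Z A' B' Z' : A != 0 -> A' != 0 -> Z != 0 ->
  1 <= d.(t1) -> valk A <= valk Z -> valk A <= c.(t1) -> valk A <= d.(t1) ->
  dceq c d (tform A B Z) (tform A' B' Z') -> valk A <= valk A'.
Proof.
move=> A0 A0' Z0 d1 b1 b2 b3 [h [h' [Ch Ch' /tform_eqs [_ [[e _ _] _]]]]].
have [u00 _ _] := Cgrp_diag_unit d2 d3 d1 Ch'.
have [[h00 h01 h02] [[h10 h11 h12] [h20 h21 h22]]] := Cgrp_idl Ch.
have [[h00' h01' h02'] [[h10' h11' h12'] [h20' h21' h22']]] := Cgrp_idl Ch'.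
apply/(idl_neq0 _ A0'); apply: (idl_unitl u00).
have -> : h' 0 0 * A' = h 1 0 + h 1 1 * A + h 1 2 * Z - h' 1 0 by rewrite e; ring.
idl_tac.
Qed.

Lemma dceq_tform_Z A B Z A' B' Z' : A != 0 -> B' != 0 -> Z != 0 -> Z' != 0 ->
  valk Z' <= c.(t3) -> valk Z' <= d.(t3) -> valk Z' <= valk A + c.(t2) ->
  valk Z' <= d.(t1) + valk B' ->
  dceq c d (tform A B Z) (tform A' B' Z') -> valk Z' <= valk Z.
Proof.
move=> A0 B0' Z0 Z0' b1 b2 b3 b4 [h [h' [Ch Ch' /tform_eqs [_ [_ [e _ _]]]]]].
have [u22 _] := Cgrp_unit c2 c3 Ch.
have [[h00 h01 h02] [[h10 h11 h12] [h20 h21 h22]]] := Cgrp_idl Ch.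
have [[h00' h01' h02'] [[h10' h11' h12'] [h20' h21' h22']]] := Cgrp_idl Ch'.
apply/(idl_neq0 _ Z0); apply: (idl_unitl u22).
have -> : h 2 2 * Z = Z' * h' 0 0 + B' * h' 1 0 + h' 2 0 - h 2 0 - h 2 1 * A by rewrite -e; ring.
idl_tac.
Qed.

(* The lower left entry of the inverse of [tform A B Z] is [A * B - Z]. *)
Lemma tform_inv_eq A B Z Z' h h' : h *m tform A B Z = tform A B Z' *m h' ->
  h 2 0 - B * h 1 0 - h' 2 0 + A * h' 2 1 =
  (Z' - A * B) * (h' 0 0 - A * h' 0 1) - (Z - A * B) * (h 2 2 - B * h 1 2).
Proof.
move=> /tform_eqs [_ [[e10 e11 _] [e20 e21 _]]].
apply/eqP; rewrite -subr_eq0; apply/eqP.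
transitivity (h 2 0 + h 2 1 * A + h 2 2 * Z - (Z' * h' 0 0 + B * h' 1 0 + h' 2 0)
  - B * (h 1 0 + h 1 1 * A + h 1 2 * Z - (A * h' 0 0 + h' 1 0))
  - A * (h 2 1 + h 2 2 * B - (Z' * h' 0 1 + B * h' 1 1 + h' 2 1))
  + A * B * (h 1 1 + h 1 2 * B - (A * h' 0 1 + h' 1 1))); first by ring.
by rewrite e10 e11 e20 e21 !subrr; ring.
Qed.

(** For d_1 = 0 the bound on a_3 in [Tcd] is 1 + a_2, one more than [dceq_tform_Z] can use. The
    values a_2 and a_2 + 1 are told apart by the corner of the inverse instead. *)
Lemma dceq_tform_inv A B Z Z' : A != 0 -> B != 0 -> 1 <= valk A -> 1 <= valk B ->
  valk Z = valk B -> Z != 0 -> Z' != 0 ->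
  valk Z' <= c.(t3) -> valk Z' <= d.(t3) -> valk Z' <= valk A + valk B ->
  valk B + 1 <= valk Z' -> 1 <= c.(t1) -> valk Z' <= d.(t2) + 1 ->
  ~ dceq c d (tform A B Z) (tform A B Z').
Proof.
move=> A0 B0 a1 b1 ZB Z0 Z0' q1 q2 q3 q4 q5 q6 [h [h' [Ch Ch' /tform_inv_eq e]]].
have [u22 _] := Cgrp_unit c2 c3 Ch.
have [[h00 h01 h02] [[h10 h11 h12] [h20 h21 h22]]] := Cgrp_idl Ch.
have [[h00' h01' h02'] [[h10' h11' h12'] [h20' h21' h22']]] := Cgrp_idl Ch'.
have u : runit (h 2 2 - B * h 1 2) by apply: runitD => //; idl_tac.
have : idl (valk B + 1) Z.
  apply: (idl_unitl u).
  have -> : (h 2 2 - B * h 1 2) * Z = A * B * (h 2 2 - B * h 1 2) +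
    (Z' - A * B) * (h' 0 0 - A * h' 0 1) - (h 2 0 - B * h 1 0 - h' 2 0 + A * h' 2 1).
    by rewrite e; ring.
  idl_tac.
by move=> /(idl_neq0 _ Z0); lia.
Qed.

Lemma tmx_triple a a' x x' : Tcd c d a -> Tcd c d a' -> runit x -> runit x' ->
  dceq c d (tmx pi a x) (tmx pi a' x') -> a = a'.
Proof.
move=> Ta Ta' ux ux' e; have e' := dceq_sym Tc Td e.
have [[p1 p2 p3 p4] [p5 p6 p7 p8] [p9 p10 p11 p12] p13] := Tcd_facts Ta.
have [[q1 q2 q3 q4] [q5 q6 q7 q8] [q9 q10 q11 q12] q13] := Tcd_facts Ta'.
have [[? ? ? ?] [? ?]] := TT_facts Tc Td.
have P0 n := pi_neq0 hpi n; have Pv n := valk_pi hpi n.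
have X0 n : x * pi ^ n != 0 by rewrite mulf_neq0 // runit_neq0.
have X0' n : x' * pi ^ n != 0 by rewrite mulf_neq0 // runit_neq0.
have Xv n : valk (x * pi ^ n) = n by rewrite val_mul_unit ?Pv.
have Xv' n : valk (x' * pi ^ n) = n by rewrite val_mul_unit ?Pv.
have eB : a.(t2) = a'.(t2).
  have h1 := dceq_tform_B (P0 _) (P0 _) (X0' _) _ _ _ e.
  have h2 := dceq_tform_B (P0 _) (P0 _) (X0 _) _ _ _ e'.
  rewrite !Pv !Xv' in h1; rewrite !Pv !Xv in h2.
  by move: (h1 q6 q7 q8) (h2 p6 p7 p8); lia.
have eA : a.(t1) = a'.(t1).
  have [c10|c10] := eqVneq c.(t1) 0; first by rewrite c10 /under in p3 q3; lia.
  have [d10|d10] := eqVneq d.(t1) 0; first by rewrite d10 /under in p4 q4; lia.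
  have d11 : 1 <= d.(t1) by lia.
  have h1 := dceq_tform_A (P0 _) (P0 _) (X0 _) d11 _ _ _ e.
  have h2 := dceq_tform_A (P0 _) (P0 _) (X0' _) d11 _ _ _ e'.
  rewrite !Pv !Xv in h1; rewrite !Pv !Xv' in h2; rewrite /under in p3 p4 q3 q4.
  by move: (h1 p2 ltac:(lia) ltac:(lia)) (h2 q2 ltac:(lia) ltac:(lia)); lia.
case: a Ta e e' p1 p2 p3 p4 p5 p6 p7 p8 p9 p10 p11 p12 p13 eA eB => a1 a2 a3 Ta e e' /=.
move=> p1 p2 p3 p4 p5 p6 p7 p8 p9 p10 p11 p12 p13 eA eB.
case: a' Ta' e e' q1 q2 q3 q4 q5 q6 q7 q8 q9 q10 q11 q12 q13 eA eB => b1 b2 b3 Ta' e e' /=.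
move=> q1 q2 q3 q4 q5 q6 q7 q8 q9 q10 q11 q12 q13 eA eB.
subst b1 b2; congr Triple.
have [d10|d10] := eqVneq d.(t1) 0; last first.
  have h1 := dceq_tform_Z (P0 _) (P0 _) (X0 _) (X0' _) _ _ _ _ e.
  have h2 := dceq_tform_Z (P0 _) (P0 _) (X0' _) (X0 _) _ _ _ _ e'.
  rewrite /= !Pv !Xv !Xv' in h1 h2; rewrite /under in p12 q12.
  by move: (h1 q9 q10 q11 ltac:(lia)) (h2 p9 p10 p11 ltac:(lia)); lia.
have [c10|c10] := eqVneq c.(t1) 0; first by rewrite p13 // q13.
have c11 : 1 <= c.(t1) by lia.
(* Now a_1 = 1, and a_3 and b_3 can only be a_2 or a_2 + 1. *)
rewrite /under d10 in p4 p12 q12.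
have [//|ne] := eqVneq a3 b3.
have [lt|le] := ltrP a3 b3.
  case: (dceq_tform_inv (P0 a1) (P0 a2) _ _ _ (X0 a3) (X0' b3) _ _ _ _ _ _ e);
    rewrite ?Pv ?Xv ?Xv'; lia.
case: (dceq_tform_inv (P0 a1) (P0 a2) _ _ _ (X0' b3) (X0 a3) _ _ _ _ _ _ e');
    rewrite ?Pv ?Xv ?Xv'; lia.
Qed.

(** Entries (1,0), (1,1) and (2,1) give a chain of congruences from [h' 0 0] through [h 1 1] and
    [h' 1 1] to [h 2 2]; entry (2,0) then compares x and y. Each of the twelve terms of the minimum
    [acd] controls a term that occurs. *)
Lemma tmx_acd a x y h h' : Tcd c d a -> runit x -> runit y ->
  Cgrp c h -> Cgrp d h' -> h *m tmx pi a x = tmx pi a y *m h' ->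
  0 < acd c d a ->
  idl (acd c d a) (h' 0 0 - h 2 2) /\ idl (acd c d a) (x - y).
Proof.
move=> Ta ux uy Ch Ch' E e0.
have := acd_gt0 e0 (lexx _); rewrite le_mins //= andbT.
set e := acd c d a in e0 *.
move=> /andP[p1 /andP[p2 /andP[p3 /andP[p4 /andP[p5 /andP[p6 /andP[p7]]]]]]].
move=> /andP[p8 /andP[p9 /andP[p10 /andP[p11 p12]]]].
have [[q1 q2 q3 q4] [q5 q6 q7 q8] [q9 q10 q11 q12] q13] := Tcd_facts Ta.
have [_ [[e10 e11 _] [e20 e21 _]]] := tform_eqs E.
have [u22 _] := Cgrp_unit c2 c3 Ch.
have [[h00 h01 h02] [[h10 h11 h12] [h20 h21 h22]]] := Cgrp_idl Ch.
have [[h00' h01' h02'] [[h10' h11' h12'] [h20' h21' h22']]] := Cgrp_idl Ch'.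
move: e10 e11 e20 e21.
have A0 := pi_neq0 hpi a.(t1); have Av := valk_pi hpi a.(t1).
have B0 := pi_neq0 hpi a.(t2); have Bv := valk_pi hpi a.(t2).
have C0 := pi_neq0 hpi a.(t3); have Cv := valk_pi hpi a.(t3).
move: (pi ^ a.(t1)) (pi ^ a.(t2)) (pi ^ a.(t3)) A0 Av B0 Bv C0 Cv => A B C A0 Av B0 Bv C0 Cv.
clear E Ta Ch Ch' q3 q4 q12 q13.
move=> e10 e11 e20 e21.
have d1 : idl e (h' 0 0 - h 1 1).
  have -> : h' 0 0 - h 1 1 = (h 1 0 + h 1 2 * (x * C) - h' 1 0) / A.
    have -> : h' 1 0 = h 1 0 + h 1 1 * A + h 1 2 * (x * C) - A * h' 0 0 by rewrite e10; ring.
    by field; nz_tac.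
  idl_tac.
have d2' : idl e (h' 1 1 - h 2 2).
  have -> : h' 1 1 - h 2 2 = (h 2 1 - y * C * h' 0 1 - h' 2 1) / B.
    have -> : h 2 1 = y * C * h' 0 1 + B * h' 1 1 + h' 2 1 - h 2 2 * B by rewrite -e21; ring.
    by field; nz_tac.
  idl_tac.
have d3' : idl e (h 1 1 - h' 1 1).
  have -> : h 1 1 - h' 1 1 = A * h' 0 1 - h 1 2 * B.
    by apply/eqP; rewrite subr_eq addrAC -e11 addrK.
  idl_tac.
have d4 : idl e (h' 0 0 - h 2 2).
  have -> : h' 0 0 - h 2 2 = (h' 0 0 - h 1 1) + (h 1 1 - h' 1 1) + (h' 1 1 - h 2 2) by ring.
  idl_tac.
split=> //; apply: (idl_unitl u22).
have -> : h 2 2 * (x - y) = (B * h' 1 0 + h' 2 0 - h 2 0 - h 2 1 * A) / C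
   + y * (h' 0 0 - h 2 2).
  have -> : h' 2 0 = h 2 0 + h 2 1 * A + h 2 2 * (x * C) - y * C * h' 0 0 - B * h' 1 0.
    by rewrite e20; ring.
  by field; nz_tac.
idl_tac.
Qed.

(** Here A B - x C = C (1 - x), so dividing the corner equation of the inverses by A B compares x -
    1 with y - 1 up to units. The four terms of [acd'] bound the four errors. *)
Lemma tmx_tval_le a x y h h' : Tcd c d a -> runit x -> runit y ->
  a.(t1) + a.(t2) = a.(t3) ->
  Cgrp c h -> Cgrp d h' -> h *m tmx pi a x = tmx pi a y *m h' ->
  0 < acd' c d a ->
  idl (acd' c d a) ((y - 1) * (h' 0 0 - pi ^ a.(t1) * h' 0 1)
     - (x - 1) * (h 2 2 - pi ^ a.(t2) * h 1 2)) /\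
  Defs.tval (y - 1) (acd' c d a) <= Defs.tval (x - 1) (acd' c d a).
Proof.
move=> Ta ux uy a12 Ch Ch' E e0.
have [p1 p2 p3 p4] := acd'_gt0 e0 (lexx _).
set e := acd' c d a in e0 p1 p2 p3 p4 *.
have [[q1 q2 q3 q4] [q5 q6 q7 q8] [q9 q10 q11 q12] q13] := Tcd_facts Ta.
have eq := tform_inv_eq E.
have [u22 _] := Cgrp_unit c2 c3 Ch.
have [[h00 h01 h02] [[h10 h11 h12] [h20 h21 h22]]] := Cgrp_idl Ch.
have [[h00' h01' h02'] [[h10' h11' h12'] [h20' h21' h22']]] := Cgrp_idl Ch'.
have CE : pi ^ a.(t3) = pi ^ a.(t1) * pi ^ a.(t2).
  by rewrite -a12 expfzDr //; case: hpi.
rewrite CE in eq; move: eq.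
have A0 := pi_neq0 hpi a.(t1); have Av := valk_pi hpi a.(t1).
have B0 := pi_neq0 hpi a.(t2); have Bv := valk_pi hpi a.(t2).
move: (pi ^ a.(t1)) (pi ^ a.(t2)) A0 Av B0 Bv => A B A0 Av B0 Bv.
clear E Ta Ch Ch' q3 q4 q12 q13 CE.
move=> eq.
have u : runit (h 2 2 - B * h 1 2) by apply: runitD => //; idl_tac.
have i1 : idl e ((y - 1) * (h' 0 0 - A * h' 0 1) - (x - 1) * (h 2 2 - B * h 1 2)).
  have -> : (y - 1) * (h' 0 0 - A * h' 0 1) - (x - 1) * (h 2 2 - B * h 1 2) =
    (h 2 0 - B * h 1 0 - h' 2 0 + A * h' 2 1) / A / B by rewrite eq; field; nz_tac.
  idl_tac.
split=> //; apply/tval_le; first exact: tval_leq.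
apply: (idl_unitl u).
have -> : (h 2 2 - B * h 1 2) * (x - 1) = (y - 1) * (h' 0 0 - A * h' 0 1)
   - ((y - 1) * (h' 0 0 - A * h' 0 1) - (x - 1) * (h 2 2 - B * h 1 2)) by ring.
have i2 := @idl_tval k (y - 1) e; have i3 := tval_leq (y - 1) e.
have i4 : idl 0 (h' 0 0 - A * h' 0 1) by idl_tac.
move: i1 i2 i3 i4; move: (Defs.tval _ _) => t i1 i2 i3 i4.
have := idlM i2 i4; rewrite addr0 => i5.
by apply: idl_le (idlD i5 (idlN i1)) _; lia.
Qed.

Lemma dceq_Xeq a x y : Tcd c d a -> runit x -> runit y ->
  dceq c d (tmx pi a x) (tmx pi a y) -> Xeq c d a x y.
Proof.
move=> Ta ux uy De; have [g [g' [Cg Cg' Eg]]] := dceq_sym Tc Td De.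
case: De => h [h' [Ch Ch' E]].
have [ix iy] := (runit_idl ux, runit_idl uy); have i1 := @idl1 k.
have e0 := @acd_ge0 c d a; have e0' := @acd'_ge0 c d a.
rewrite /Xeq; case: eqP => a12 /=.
  have tE : Defs.tval (x - 1) (acd' c d a) = Defs.tval (y - 1) (acd' c d a).
    have [z|nz] := eqVneq (acd' c d a) 0; first by rewrite z !tval0 //; idl_tac.
    have e1 : 0 < acd' c d a by rewrite lt_def nz.
    have [_ l1] := tmx_tval_le Ta ux uy a12 Ch Ch' E e1.
    have [_ l2] := tmx_tval_le Ta uy ux a12 Cg Cg' Eg e1.
    by apply/eqP; rewrite eq_le l1 l2.
  split=> //.
  have [z|nz] := eqVneq (acd' c d a) 0.
    have := tval_leq (x - 1) (acd' c d a); rewrite z => *.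
    by apply: (@idl_le _ 0); [idl_tac|lia].
  have e1 : 0 < acd' c d a by rewrite lt_def nz.
  have [j1 _] := tmx_tval_le Ta ux uy a12 Ch Ch' E e1.
  have := @idl_tval k (y - 1) (acd' c d a); rewrite -tE.
  move: (Defs.tval _ _) => t j2.
  have [u22 _] := Cgrp_unit c2 c3 Ch.
  have [[q1 q2 q3 q4] [q5 q6 q7 q8] [q9 q10 q11 q12] q13] := Tcd_facts Ta.
  have [[h00 h01 h02] [[h10 h11 h12] [h20 h21 h22]]] := Cgrp_idl Ch.
  have [[h00' h01' h02'] [[h10' h11' h12'] [h20' h21' h22']]] := Cgrp_idl Ch'.
  have A0 := pi_neq0 hpi a.(t1); have Av := valk_pi hpi a.(t1).
  have B0 := pi_neq0 hpi a.(t2); have Bv := valk_pi hpi a.(t2).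
  have u : runit (h 2 2 - pi ^ a.(t2) * h 1 2) by apply: runitD => //; idl_tac.
  have j3 : idl (acd c d a) ((h' 0 0 - pi ^ a.(t1) * h' 0 1) - (h 2 2 - pi ^ a.(t2) * h 1 2)).
    have [ez|enz] := eqVneq (acd c d a) 0; first by rewrite ez; idl_tac.
    have e2 : 0 < acd c d a by rewrite lt_def enz.
    have [j _] := tmx_acd Ta ux uy Ch Ch' E e2.
    have := acd_gt0 e2 (lexx _); rewrite le_mins //= => /andP[p1 /andP[p2 _]].
    have -> : (h' 0 0 - pi ^ a.(t1) * h' 0 1) - (h 2 2 - pi ^ a.(t2) * h 1 2) =
      (h' 0 0 - h 2 2) - pi ^ a.(t1) * h' 0 1 + pi ^ a.(t2) * h 1 2 by ring.
    idl_tac.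
  apply: (idl_unitl u).
  (* The two unit factors agree modulo p^acd and multiply y - 1, of truncated valuation t; the rest
     is an error in p^acd'. Hence the modulus min(t + acd, acd') in [Xeq]. *)
  have -> : (h 2 2 - pi ^ a.(t2) * h 1 2) * (x - y) =
     (y - 1) * ((h' 0 0 - pi ^ a.(t1) * h' 0 1) - (h 2 2 - pi ^ a.(t2) * h 1 2)) -
     ((y - 1) * (h' 0 0 - pi ^ a.(t1) * h' 0 1)
       - (x - 1) * (h 2 2 - pi ^ a.(t2) * h 1 2)) by ring.
  by apply: idl_le (idlD (idlM j2 j3) (idlN j1)) _; lia.
have [ez|enz] := eqVneq (acd c d a) 0; first by rewrite ez; idl_tac.
have e2 : 0 < acd c d a by rewrite lt_def enz.
by have [_ ?] := tmx_acd Ta ux uy Ch Ch' E e2.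
Qed.

End Classes.

(** * Equivalent parameters x give equal double cosets *)

Section ChangeParam.
Context {k : padicField} { pi : k} {c d : triple}.
Hypothesis hpi : uniformizer pi.
Hypotheses (Tc : TT c) (Td : TT d).
Hypotheses (c2 : 1 <= c.(t2)) (c3 : 1 <= c.(t3)) (d2 : 1 <= d.(t2)) (d3 : 1 <= d.(t3)).
Implicit Types A B C s u x y : k.

(** The torus returns to A and B and multiplies Z' by A B / (A' B'), so that moves of all kinds are
    compared at fixed A and B. *)
Lemma tform_via A B C A' B' Z' x y : A != 0 -> B != 0 -> A' != 0 -> B' != 0 ->
  valk A' = valk A -> valk B' = valk B -> Z' * A * B / A' / B' = y * C ->
  dceq c d (tform A B (x * C)) (tform A' B' Z') ->
  dceq c d (tform A B (x * C)) (tform A B (y * C)).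
Proof.
move=> A0 B0 A0' B0' vA vB <- e.
apply: (rtrans Tc Td e).
exact: (tform_torus Tc Td c2 c3 d2 d3 _ A0' B0' A0 B0 vA vB).
Qed.

Lemma tform_same_lower A B C x y : runit x -> runit y ->
  A != 0 -> B != 0 -> C != 0 ->
  [\/ c.(t3) <= valk (x - y) + valk C, d.(t3) <= valk (x - y) + valk C,
      c.(t1) <= valk (x - y) + valk A | d.(t2) <= valk (x - y) + valk B] ->
  dceq c d (tform A B (x * C)) (tform A B (y * C)).
Proof.
move=> ux uy A0 B0 C0 H; have ix := idl_val (x - y).
have [x0 y0] := (runit_neq0 ux, runit_neq0 uy).
case: H => h.
- have -> : y * C = x * C + (- (x - y)) * C by ring.
  by apply: tform_L31 => //; idl_tac.
- have -> : y * C = x * C + (- (x - y)) * C by ring.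
  by apply: tform_R31 => //; idl_tac.
- have e : A + A * (x - y) / y = A * (x / y) by field; nz_tac.
  apply: (@tform_via _ _ _ (A * (x / y)) B (x * C)) => //.
  + by rewrite !mulf_neq0 ?invr_neq0.
  + by rewrite mulrC val_mul_unit //; runit_tac.
  + by field; nz_tac.
  by rewrite -e; apply: tform_L21 => //; idl_tac.
- have e : B + B * (x - y) / y = B * (x / y) by field; nz_tac.
  apply: (@tform_via _ _ _ A (B * (x / y)) (x * C)) => //.
  + by rewrite !mulf_neq0 ?invr_neq0.
  + by rewrite mulrC val_mul_unit //; runit_tac.
  + by field; nz_tac.
  by rewrite -e; apply: tform_R32 => //; idl_tac.
Qed.

(* Each of the four moves sends [z] to a fractional linear transform of [z]; the
   parameter is the one for which [x * C] is sent to [y * C]. *)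
Lemma tform_same_mixed A B C x y : runit x -> runit y ->
  A != 0 -> B != 0 -> C != 0 -> A * B - x * C != 0 -> A * B - y * C != 0 ->
  valk (A * B - x * C) = valk (A * B - y * C) ->
  [\/ c.(t2) <= valk (x - y) + valk B + valk C - valk (A * B - y * C),
      d.(t1) <= valk (x - y) + valk A + valk C - valk (A * B - y * C),
      0 <= valk (x - y) + valk A - valk (A * B - y * C)
    | 0 <= valk (x - y) + valk B - valk (A * B - y * C)] ->
  dceq c d (tform A B (x * C)) (tform A B (y * C)).
Proof.
move=> ux uy A0 B0 C0 Dx0 Dy0 eD H; have ix := idl_val (x - y).
have [x0 y0] := (runit_neq0 ux, runit_neq0 uy).
have uD : runit ((A * B - x * C) / (A * B - y * C)).
  by split; rewrite ?mulf_neq0 ?invr_neq0 // valk_div // eD subrr.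
case: H => h.
- set s := - (x - y) * B * C / (A * B - y * C).
  have e : B + s = B * ((A * B - x * C) / (A * B - y * C)).
    by rewrite /s; field; nz_tac.
  apply: (@tform_via _ _ _ A (B * ((A * B - x * C) / (A * B - y * C))) (x * C + s * A)) => //.
  + by rewrite !mulf_neq0 ?invr_neq0.
  + by rewrite mulrC val_mul_unit.
  + by rewrite /s; field; nz_tac.
  by rewrite -e; apply: tform_L32 => //; rewrite /s; idl_tac.
- set s := - (x - y) * A * C / (A * B - y * C).
  have e : A + s = A * ((A * B - x * C) / (A * B - y * C)).
    by rewrite /s; field; nz_tac.
  apply: (@tform_via _ _ _ (A * ((A * B - x * C) / (A * B - y * C))) B (x * C + B * s)) => //.
  + by rewrite !mulf_neq0 ?invr_neq0.
  + by rewrite mulrC val_mul_unit.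
  + by rewrite /s; field; nz_tac.
  by rewrite -e; apply: tform_R21 => //; rewrite /s; idl_tac.
- set u := - (x - y) * A / x / (A * B - y * C).
  have uE : 1 + u * B = y / x * ((A * B - x * C) / (A * B - y * C)).
    by rewrite /u; field; nz_tac.
  have uu : runit (1 + u * B) by rewrite uE; runit_tac.
  have e : (A + u * (x * C)) / (1 + u * B) = A * (x / y).
    by rewrite uE /u; field; nz_tac.
  apply: (@tform_via _ _ _ (A * (x / y)) (B * (1 + u * B)) (x * C * (1 + u * B))) => //.
  + by rewrite !mulf_neq0 ?invr_neq0.
  + by rewrite !mulf_neq0 // runit_neq0.
  + by rewrite mulrC val_mul_unit //; runit_tac.
  + by rewrite mulrC val_mul_unit.
  + by have uu0 := runit_neq0 uu; field; nz_tac.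
  by rewrite -e; apply: tform_E23 => //; rewrite /u; idl_tac.
- set u := - (x - y) * B / x / (A * B - y * C).
  have uE : 1 + u * A = y / x * ((A * B - x * C) / (A * B - y * C)).
    by rewrite /u; field; nz_tac.
  have uu : runit (1 + u * A) by rewrite uE; runit_tac.
  have e : (B + u * (x * C)) / (1 + u * A) = B * (x / y).
    by rewrite uE /u; field; nz_tac.
  apply: (@tform_via _ _ _ (A * (1 + u * A)) (B * (x / y)) (x * C * (1 + u * A))) => //.
  + by rewrite !mulf_neq0 // runit_neq0.
  + by rewrite !mulf_neq0 ?invr_neq0.
  + by rewrite mulrC val_mul_unit.
  + by rewrite mulrC val_mul_unit //; runit_tac.
  + by have uu0 := runit_neq0 uu; field; nz_tac.
  by rewrite -e; apply: tform_E12 => //; rewrite /u; idl_tac.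
Qed.

(** If val (x - y) reaches one of the terms of [acd'], a lower move suffices. Otherwise those four
    terms are too large to realize the minimum [acd], and each of the eight others provides one of
    the moves of [tform_same_mixed]. *)
Lemma Xeq_dceq a x y : Tcd c d a -> runit x -> runit y ->
  Xeq c d a x y -> dceq c d (tmx pi a x) (tmx pi a y).
Proof.
move=> Ta ux uy X; have [->|nxy] := eqVneq x y; first exact: dceq_refl.
have xy0 : x - y != 0 by rewrite subr_eq0.
have [[p1 p2 p3 p4] [p5 p6 p7 p8] [p9 p10 p11 p12] p13] := Tcd_facts Tc Td c2 c3 d2 d3 Ta.
have iv : 0 <= valk (x - y).
  by apply/(idl_neq0 _ xy0); have := runit_idl ux; have := runit_idl uy => *; idl_tac.
have A0 := pi_neq0 hpi a.(t1); have Av := valk_pi hpi a.(t1).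
have B0 := pi_neq0 hpi a.(t2); have Bv := valk_pi hpi a.(t2).
have C0 := pi_neq0 hpi a.(t3); have Cv := valk_pi hpi a.(t3).
have AB0 := mulf_neq0 A0 B0.
have ABv : valk (pi ^ a.(t1) * pi ^ a.(t2)) = a.(t1) + a.(t2) by rewrite valkM // Av Bv.
have C0' z : runit z -> z * pi ^ a.(t3) != 0 by move=> uz; rewrite mulf_neq0 // runit_neq0.
have Cv' z : runit z -> valk (z * pi ^ a.(t3)) = a.(t3) by move=> uz; rewrite val_mul_unit.
have lower := @tform_same_lower (pi ^ a.(t1)) (pi ^ a.(t2)) (pi ^ a.(t3)) _ _ ux uy A0 B0 C0.
have mixed := @tform_same_mixed (pi ^ a.(t1)) (pi ^ a.(t2)) (pi ^ a.(t3)) _ _ ux uy A0 B0 C0.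
rewrite Av Bv Cv in lower mixed.
have [?|l1] := lerP c.(t3) (valk (x - y) + a.(t3)); first by apply: lower; constructor 1.
have [?|l2] := lerP d.(t3) (valk (x - y) + a.(t3)); first by apply: lower; constructor 2.
have [?|l3] := lerP c.(t1) (valk (x - y) + a.(t1)); first by apply: lower; constructor 3.
have [?|l4] := lerP d.(t2) (valk (x - y) + a.(t2)); first by apply: lower; constructor 4.
have e'v : valk (x - y) + 1 <= acd' c d a.
  rewrite /acd' le_max le_mins //= andbT; apply/orP; right.
  by clear -l1 l2 l3 l4; apply/and4P; split; lia.
clear lower.
have last_step n : 0 <= n -> n <= valk (x - y) -> acd c d a <= n ->
  a.(t1) <= n \/ a.(t2) <= n \/ a.(t3) - a.(t1) <= n \/ a.(t3) - a.(t2) <= n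
  \/ c.(t2) - a.(t2) <= n \/ d.(t1) - a.(t1) <= n
  \/ a.(t1) + c.(t2) - a.(t3) <= n \/ d.(t1) + a.(t2) - a.(t3) <= n.
  move=> n0 nv le; apply: contrapT => H; move: le; apply/negP; rewrite -ltNge.
  apply: (@lt_le_trans _ _ (n + 1)); first by rewrite ltrDl.
  rewrite /acd le_max le_mins //=; apply/orP; right.
  have HH : [/\ n < a.(t1), n < a.(t2), n < a.(t3) - a.(t1) & n < a.(t3) - a.(t2)] /\
   [/\ n < c.(t2) - a.(t2), n < d.(t1) - a.(t1), n < a.(t1) + c.(t2) - a.(t3)
     & n < d.(t1) + a.(t2) - a.(t3)].
    by do !split; rewrite ltNge; apply/negP => ?; apply: H; tauto.
  case: HH => [[H0 H1 H2 H3] [H4 H5 H6 H7]].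
  move: (valk (x - y)) l1 l2 l3 l4 nv => v l1 l2 l3 l4 nv; clear -v l1 l2 l3 l4 nv n0 H0 H1 H2 H3 H4 H5 H6 H7.
  by do !(apply/andP; split) => //; lia.
have i1 := @idl1 k; have [ix iy] := (runit_idl ux, runit_idl uy).
(* The defect n is val (x - y), reduced by val (x - 1) when a_1 + a_2 = a_3. In all cases [Xeq] says
   acd <= n. *)
have [n [[n0 nv le] [Dx0 Dy0 eD] Dv]] : exists n, [/\
    [/\ 0 <= n, n <= valk (x - y) & acd c d a <= n],
    [/\ pi ^ a.(t1) * pi ^ a.(t2) - x * pi ^ a.(t3) != 0,
      pi ^ a.(t1) * pi ^ a.(t2) - y * pi ^ a.(t3) != 0
      & valk (pi ^ a.(t1) * pi ^ a.(t2) - x * pi ^ a.(t3)) =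
        valk (pi ^ a.(t1) * pi ^ a.(t2) - y * pi ^ a.(t3))]
    & [\/ a.(t1) + a.(t2) < a.(t3) /\ n = valk (x - y) /\
        valk (pi ^ a.(t1) * pi ^ a.(t2) - y * pi ^ a.(t3)) = a.(t1) + a.(t2),
      a.(t3) < a.(t1) + a.(t2) /\ n = valk (x - y) /\
        valk (pi ^ a.(t1) * pi ^ a.(t2) - y * pi ^ a.(t3)) = a.(t3)
    | a.(t3) = a.(t1) + a.(t2) /\
        valk (pi ^ a.(t1) * pi ^ a.(t2) - y * pi ^ a.(t3)) = a.(t3) + (valk (x - y) - n)]].
  clear mixed last_step l1 l2 l3 l4.
  move: X; rewrite /Xeq; case: eqP => a12 /=; last first.
    move=> /(idl_neq0 _ xy0) le; exists (valk (x - y)).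
    have DE z : runit z -> a.(t1) + a.(t2) < a.(t3) ->
        pi ^ a.(t1) * pi ^ a.(t2) - z * pi ^ a.(t3) != 0 /\
        valk (pi ^ a.(t1) * pi ^ a.(t2) - z * pi ^ a.(t3)) = a.(t1) + a.(t2).
      move=> uz lt; rewrite -ABv; apply: (@valkD_lt _ _ _ a.(t3)) => //; last by rewrite ABv.
      by apply: idlN; right; rewrite Cv'.
    have DE' z : runit z -> a.(t3) < a.(t1) + a.(t2) ->
        pi ^ a.(t1) * pi ^ a.(t2) - z * pi ^ a.(t3) != 0 /\
        valk (pi ^ a.(t1) * pi ^ a.(t2) - z * pi ^ a.(t3)) = a.(t3).
      move=> uz lt; rewrite -{3}(Cv' z uz) -[in valk (z * _)]valkN addrC.
      apply: (@valkD_lt _ _ _ (a.(t1) + a.(t2))).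
      - by rewrite oppr_eq0; apply: C0'.
      - by right; rewrite ABv.
      - by rewrite valkN Cv'.
    have [lt|gt|//] := ltrgtP (a.(t1) + a.(t2)) a.(t3).
      have [? ->] := DE x ux lt; have [? ->] := DE y uy lt.
      by split=> //; constructor 1.
    have [? ->] := DE' x ux gt; have [? ->] := DE' y uy gt.
    by split=> //; constructor 2.
  move=> [tE /(idl_neq0 _ xy0) le].
  have CE : pi ^ a.(t1) * pi ^ a.(t2) = pi ^ a.(t3).
    by rewrite -a12 expfzDr //; case: hpi.
  have e0 := @acd_ge0 c d a.
  have ltx : Defs.tval (x - 1) (acd' c d a) < acd' c d a.
    by move: (Defs.tval _ _) le => i; lia.
  have tv (z : k) : Defs.tval (z - 1) (acd' c d a) < acd' c d a ->
      z - 1 != 0 /\ Defs.tval (z - 1) (acd' c d a) = valk (z - 1).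
    by rewrite /Defs.tval; case: eqP => [|/eqP z1]; lia.
  have [x1 vx] := tv x ltx; have [y1 vy] := tv y ltac:(by rewrite -tE).
  have vxy : valk (x - 1) = valk (y - 1) by rewrite -vx -vy tE.
  have DE (z : k) : z - 1 != 0 -> pi ^ a.(t3) - z * pi ^ a.(t3) != 0 /\
      valk (pi ^ a.(t3) - z * pi ^ a.(t3)) = a.(t3) + valk (z - 1).
    move=> z1; have -> : pi ^ a.(t3) - z * pi ^ a.(t3) = - ((z - 1) * pi ^ a.(t3)) by ring.
    by rewrite valkN oppr_eq0 mulf_neq0 // valkM // Cv addrC.
  rewrite CE; have [? ->] := DE x x1; have [? ->] := DE y y1.
  have ge0 : 0 <= valk (x - 1).
    by apply/(idl_neq0 _ x1); clear -ix i1; idl_tac.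
  rewrite vx in le ltx; exists (valk (x - y) - valk (x - 1)); split.
  - by clear -le ltx ge0 e0 e'v; split; lia.
  - by rewrite vxy.
  - by constructor 3; rewrite vxy; clear -a12; split; lia.
move: (last_step n n0 nv le) => H.
have {}mixed := mixed Dx0 Dy0 eD; move: mixed H Dv.
move: (valk (pi ^ a.(t1) * pi ^ a.(t2) - y * pi ^ a.(t3))) (valk (x - y)) => w v mixed H Dv.
apply: mixed; clear -H Dv.
case: H => [h|[h|[h|[h|[h|[h|[h|h]]]]]]].
- by constructor 4; case: Dv => [[? [? ?]]|[? [? ?]]|[? ?]]; lia.
- by constructor 3; case: Dv => [[? [? ?]]|[? [? ?]]|[? ?]]; lia.
- by constructor 3; case: Dv => [[? [? ?]]|[? [? ?]]|[? ?]]; lia.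
- by constructor 4; case: Dv => [[? [? ?]]|[? [? ?]]|[? ?]]; lia.
- by constructor 1; case: Dv => [[? [? ?]]|[? [? ?]]|[? ?]]; lia.
- by constructor 2; case: Dv => [[? [? ?]]|[? [? ?]]|[? ?]]; lia.
- by constructor 1; case: Dv => [[? [? ?]]|[? [? ?]]|[? ?]]; lia.
- by constructor 2; case: Dv => [[? [? ?]]|[? [? ?]]|[? ?]]; lia.
Qed.

End ChangeParam.

(** * The conditions (a), (b), (c) as depth conditions *)

Section SuppCond.
Context {k : padicField} { pi : k} {c d : triple}.
Hypothesis hpi : uniformizer pi.
Hypotheses (Tc : TT c) (Td : TT d).
Hypotheses (c2 : 1 <= c.(t2)) (c3 : 1 <= c.(t3)) (d2 : 1 <= d.(t2)) (d3 : 1 <= d.(t3)).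

(** With val D = a_3 the six bounds of [deep] become, for instance, L <= c_1 - (a_3 - a_2) and L <=
    c_3 - (a_3 - a_1) - (a_3 - a_2); this is the origin of a^op. For val D = a_3 + val (x - 1) four
    of them amount to val (x - 1) + L <= acd'. *)
Lemma suppcondP a (x : k) (L : int) : Tcd c d a -> runit x -> 0 < L ->
  suppcond c d L a x <->
  deep (c := c) (d := d) (pi ^ a.(t1)) (pi ^ a.(t2)) (x * pi ^ a.(t3)) L.
Proof.
move=> Ta ux L0.
have [[p1 p2 _ _] [p3 p4 _ _] _ _] := Tcd_facts Tc Td c2 c3 d2 d3 Ta.
have A0 := pi_neq0 hpi a.(t1); have B0 := pi_neq0 hpi a.(t2).
have C0 := pi_neq0 hpi a.(t3); have AB0 := mulf_neq0 A0 B0.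
have xC0 : x * pi ^ a.(t3) != 0 by rewrite mulf_neq0 // runit_neq0.
have ABv : valk (pi ^ a.(t1) * pi ^ a.(t2)) = a.(t1) + a.(t2) by rewrite valkM // !(valk_pi hpi).
have Zv : valk (x * pi ^ a.(t3)) = a.(t3) by rewrite val_mul_unit // (valk_pi hpi).
rewrite /suppcond /deep Zv !(valk_pi hpi) !le_mins //= !andbT.
clear c2 c3 d2 d3 Ta.
have [lt|gt|a12] := ltrgtP (a.(t1) + a.(t2)) a.(t3).
- have [D0 Dv] : pi ^ a.(t1) * pi ^ a.(t2) - x * pi ^ a.(t3) != 0 /\
      valk (pi ^ a.(t1) * pi ^ a.(t2) - x * pi ^ a.(t3)) = a.(t1) + a.(t2).
    rewrite -ABv; apply: (@valkD_lt _ _ _ a.(t3)) => //; last by rewrite ABv.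
    by apply: idlN; right; rewrite Zv.
  rewrite Dv; split=> [[[_ H]|[h _]|[h _ _]]|[_ h1 h2 [h3 h4 h5 h6]]]; [|by []|by lia|].
    move: H => /andP[q1 /andP[q2 /andP[q3 /andP[q4 /andP[q5 /andP[q6 /andP[q7 q8]]]]]]].
    by split=> //; solve [lia | split; lia].
  constructor 1; split=> //.
  by do !(apply/andP; split); lia.
- have [D0 Dv] : pi ^ a.(t1) * pi ^ a.(t2) - x * pi ^ a.(t3) != 0 /\
      valk (pi ^ a.(t1) * pi ^ a.(t2) - x * pi ^ a.(t3)) = a.(t3).
    rewrite -{3}Zv -[in valk (x * _)]valkN addrC.
    apply: (@valkD_lt _ _ _ (a.(t1) + a.(t2))); rewrite ?oppr_eq0 //.
    + by right; rewrite ABv.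
    + by rewrite valkN Zv.
  rewrite Dv; split=> [[[h _]|[_ H]|[h _ _]]|[_ h1 h2 [h3 h4 h5 h6]]]; [by []| |by lia|].
    move: H => /andP[q1 /andP[q2 /andP[q3 /andP[q4 /andP[q5 q6]]]]].
    by split=> //; solve [lia | split; lia].
  constructor 2; split=> //.
  by do !(apply/andP; split); lia.
have CE : pi ^ a.(t1) * pi ^ a.(t2) = pi ^ a.(t3).
  by rewrite -a12 expfzDr //; case: hpi.
have DE : pi ^ a.(t3) - x * pi ^ a.(t3) = - ((x - 1) * pi ^ a.(t3)) by ring.
have D0 : (pi ^ a.(t3) - x * pi ^ a.(t3) != 0) = (x - 1 != 0).
  by rewrite DE oppr_eq0 mulf_eq0 negb_or C0 andbT.
have Cv : valk (pi ^ a.(t3)) = a.(t3) by rewrite -CE ABv.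
(* Both sides exclude x = 1: it means D = 0, and its truncated valuation [acd'] exceeds [acd' - L]
   as L > 0. *)
rewrite CE D0; have [x1|x1] := eqVneq (x - 1) 0.
  split=> [[[h _]|[h _]|[_ _]]|[]//]; [by lia|by lia|].
  by rewrite /Defs.tval x1 eqxx; move: (acd' c d a) => e; lia.
have -> : valk (pi ^ a.(t3) - x * pi ^ a.(t3)) = valk (x - 1) + a.(t3).
  by rewrite DE valkN valkM // Cv.
rewrite /Defs.tval (negPf x1).
have i0 : 0 <= valk (x - 1).
  by apply/(idl_neq0 _ x1); have := runit_idl ux; have := @idl1 k => *; idl_tac.
move: (valk (x - 1)) i0 => v i0; clear - p1 p2 p3 p4 a12 i0 L0.
split=> [[[h _]|[h _]|[_ H h]]|[_ h1 h2 [h3 h4 h5 h6]]]; [by lia|by lia| |].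
  move: H => /andP[q1 /andP[q2 /andP[q3 /andP[q4 /andP[q5 q6]]]]].
  have [] := @acd'_gt0 c d a (v + L); [lia|by move: h; move: (acd' c d a) => e; lia|].
  move=> r1 r2 r3 r4; clear h; by split=> //; solve [lia | split; lia].
constructor 3; split=> //.
  by do !(apply/andP; split); lia.
have : v + L <= acd' c d a.
  rewrite /acd' le_max le_mins //= andbT; apply/orP; right.
  by apply/and4P; split; lia.
by move: (acd' c d a) => e; lia.
Qed.

End SuppCond.

(** * Separation in the cells of s_1 and s_2, and between cells *)

Section Separation.
Context {k : padicField} {c d : triple}.
Hypotheses (Tc : TT c) (Td : TT d).
Hypotheses (c1 : 1 <= c.(t1)) (d1 : 1 <= d.(t1)).
Hypotheses (c2 : 1 <= c.(t2)) (c3 : 1 <= c.(t3)) (d2 : 1 <= d.(t2)) (d3 : 1 <= d.(t3)).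
Implicit Types A B Z : k.

Lemma dceq_s1form_le A B A' B' : A != 0 -> B != 0 -> A' != 0 -> B' != 0 ->
  1 <= valk A' <= Num.min d.(t2) c.(t3) -> 1 <= valk B' <= Num.min c.(t2) d.(t3) ->
  - c.(t1) <= valk B' - valk A' <= d.(t1) ->
  dceq c d (s1form A B) (s1form A' B') -> valk A' <= valk A /\ valk B' <= valk B.
Proof.
move=> A0 B0 A0' B0' a1 b1 ab [h [h' [Ch Ch' /s1form_eqs]]].
move=> [[e00 e01 e02] [[e10 e11 e12] [e20 e21 e22]]].
have [_ _ u22] := Cgrp_diag_unit c2 c3 c1 Ch.
have [[h00 h01 h02] [[h10 h11 h12] [h20 h21 h22]]] := Cgrp_idl Ch.
have [[h00' h01' h02'] [[h10' h11' h12'] [h20' h21' h22']]] := Cgrp_idl Ch'.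
split.
  have u : runit (h 2 2 - B' * h 1 2) by apply: runitD => //; idl_tac.
  apply/(idl_neq0 _ A0); apply: (idl_unitl u).
  (* Subtracting B' times the (1,1) equation trades [B' * h' 0 1], possibly too shallow, for
     [B' * h 1 0]. *)
  have -> : (h 2 2 - B' * h 1 2) * A = B' * h 1 0 + A' * h' 1 1 + h' 2 1 - h 2 0.
    transitivity (h 2 0 + h 2 2 * A - h 2 0 - B' * (h 1 0 + h 1 2 * A) + B' * h 1 0); first by ring.
    by rewrite e21 e11; ring.
  idl_tac.
apply/(idl_neq0 _ B0); apply: (idl_unitl u22).
have -> : h 2 2 * B = B' * h' 0 0 + A' * h' 1 0 + h' 2 0 - h 2 1 by rewrite -e20; ring.
idl_tac.
Qed.

Lemma dceq_s2form_le A B A' B' : A != 0 -> B != 0 -> A' != 0 -> B' != 0 ->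
  1 <= valk A <= Num.min d.(t1) c.(t3) -> 1 <= valk B <= Num.min c.(t1) d.(t3) ->
  - c.(t2) <= valk B - valk A <= d.(t2) -> 1 <= valk B' ->
  dceq c d (s2form A B) (s2form A' B') -> valk A <= valk A' /\ valk B <= valk B'.
Proof.
move=> A0 B0 A0' B0' a1 b1 ab b1' [h [h' [Ch Ch' /s2form_eqs]]].
move=> [[e00 e01 e02] [[e10 e11 e12] [e20 e21 e22]]].
have [u00 _ _] := Cgrp_diag_unit d2 d3 d1 Ch'.
have [[h00 h01 h02] [[h10 h11 h12] [h20 h21 h22]]] := Cgrp_idl Ch.
have [[h00' h01' h02'] [[h10' h11' h12'] [h20' h21' h22']]] := Cgrp_idl Ch'.
split.
  apply/(idl_neq0 _ A0'); apply: (idl_unitl u00).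
  have -> : h' 0 0 * A' = h 2 0 + h 2 1 * B + h 2 2 * A - h' 1 0 by rewrite e20; ring.
  idl_tac.
have u : runit (h' 0 0 - A * h' 0 1) by apply: runitD => //; idl_tac.
apply/(idl_neq0 _ B0'); apply: (idl_unitl u).
(* The (1,1) equation removes [A * h 1 2], which may be shallower than B. *)
have -> : (h' 0 0 - A * h' 0 1) * B' = h 1 0 + h 1 1 * B + A * h' 2 1 - h' 2 0.
  transitivity (B' * h' 0 0 + h' 2 0 - h' 2 0 - A * (B' * h' 0 1 + h' 2 1) + A * h' 2 1); first by ring.
  by rewrite -e10 -e11; ring.
idl_tac.
Qed.

Lemma not_dceq_t_s1 A B Z A' B' : idl 1 A -> idl 1 Z ->
  ~ dceq c d (tform A B Z) (s1form A' B').
Proof.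
move=> iA iZ [h [h' [Ch Ch' /mulmx3_eq E]]].
have := E 0 0; rewrite !mxE /= ?(mulr1, mul1r, mulr0, mul0r, addr0, add0r) => e.
have [u00 _ _] := Cgrp_diag_unit c2 c3 c1 Ch.
have [[h00 h01 h02] _] := Cgrp_idl Ch; have [_ [[h10' _ _] _]] := Cgrp_idl Ch'.
have eq : h 0 0 = h' 1 0 - h 0 1 * A - h 0 2 * Z by rewrite -e; ring.
by apply: (runit_idl1 u00); rewrite eq; idl_tac.
Qed.

Lemma not_dceq_t_s2 A B Z A' B' : idl 1 B -> idl 1 A' ->
  ~ dceq c d (tform A B Z) (s2form A' B').
Proof.
move=> iB iA' [h [h' [Ch Ch' /mulmx3_eq E]]].
have := E 2 1; rewrite !mxE /= ?(mulr1, mul1r, mulr0, mul0r, addr0, add0r) => e.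
have [_ u11 _] := Cgrp_diag_unit d2 d3 d1 Ch'.
have [_ [_ [_ h21 h22]]] := Cgrp_idl Ch; have [[_ h01' _] _] := Cgrp_idl Ch'.
have eq : h' 1 1 = h 2 1 + h 2 2 * B - A' * h' 0 1 by rewrite e; ring.
by apply: (runit_idl1 u11); rewrite eq; idl_tac.
Qed.

Lemma not_dceq_s1_s2 A B A' B' : idl 1 A -> idl 1 A' ->
  ~ dceq c d (s1form A B) (s2form A' B').
Proof.
move=> iA iA' [h [h' [Ch Ch' /mulmx3_eq E]]].
have := E 2 1; rewrite !mxE /= ?(mulr1, mul1r, mulr0, mul0r, addr0, add0r) => e.
have [_ u11 _] := Cgrp_diag_unit d2 d3 d1 Ch'.
have [_ [_ [h20 _ h22]]] := Cgrp_idl Ch; have [[_ h01' _] _] := Cgrp_idl Ch'.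
have eq : h' 1 1 = h 2 0 + h 2 2 * A - A' * h' 0 1 by rewrite e; ring.
by apply: (runit_idl1 u11); rewrite eq; idl_tac.
Qed.

End Separation.

(** * The supporting double cosets *)

Section Weyl.

Lemma s1_neq1 : Defs.s1 != 1%g.
Proof. by apply/eqP => /permP /(_ 0); rewrite tpermL perm1. Qed.

Lemma s2_neq1 : Defs.s2 != 1%g.
Proof. by apply/eqP => /permP /(_ 1); rewrite tpermL perm1. Qed.

Lemma s2_neq_s1 : Defs.s2 != Defs.s1.
Proof. by apply/eqP => /permP /(_ 0); rewrite tpermL tpermD. Qed.

Lemma s1_neq_w0 : Defs.s1 != w0.
Proof. by apply/eqP => /permP /(_ 0); rewrite !tpermL. Qed.

End Weyl.

Section Forms.
Context {k : padicField} { pi : k} {c d : triple}.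
Hypothesis hpi : uniformizer pi.

Lemma GL3R_M3 (x00 x01 x02 x10 x11 x12 x20 x21 x22 : k) :
  idl 0 x00 -> idl 0 x01 -> idl 0 x02 -> idl 0 x10 -> idl 0 x11 -> idl 0 x12 ->
  idl 0 x20 -> idl 0 x21 -> idl 0 x22 ->
  runit (det3 x00 x01 x02 x10 x11 x12 x20 x21 x22) ->
  GL3R (M3 x00 x01 x02 x10 x11 x12 x20 x21 x22).
Proof.
move=> *; split; first by apply: int_mx3; rewrite mxE.
by rewrite det_M3 !mxE.
Qed.

Lemma GL3R_tform (A B Z : k) : idl 0 A -> idl 0 B -> idl 0 Z -> GL3R (tform A B Z).
Proof.
move=> *; have i0 := @idl0 k 0; have i1 := @idl1 k; apply: GL3R_M3 => //.
by rewrite /det3 (_ : _ + _ = 1); [exact: runit1|ring].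
Qed.

Lemma GL3R_s1form (A B : k) : idl 0 A -> idl 0 B -> GL3R (s1form A B).
Proof.
move=> *; have i0 := @idl0 k 0; have i1 := @idl1 k; apply: GL3R_M3 => //.
by rewrite /det3 (_ : _ + _ = - 1); [apply: runitN; exact: runit1|ring].
Qed.

Lemma GL3R_s2form (A B : k) : idl 0 A -> idl 0 B -> GL3R (s2form A B).
Proof.
move=> *; have i0 := @idl0 k 0; have i1 := @idl1 k; apply: GL3R_M3 => //.
by rewrite /det3 (_ : _ + _ = - 1); [apply: runitN; exact: runit1|ring].
Qed.

Lemma Cgrp_swap e : e.(t1) = 0 -> Cgrp e (M3 0 1 0 1 0 0 0 0 1 : 'M[k]_3).
Proof.
move=> e1; split; [|by rewrite mxE e1; exact: idl1|by rewrite mxE; exact: idl0..].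
by apply: GL3R_s1form; exact: idl0.
Qed.

(** If c_1 = 0 or d_1 = 0, the matrix of s_1 belongs to C_c or C_d, so the s_1 cell consists of
    lower unipotent double cosets; this is why s_1 is then absent from [Wcd]. *)
Lemma s1form_tform (A B : k) : c.(t1) = 0 \/ d.(t1) = 0 ->
  dceq c d (s1form A B) (tform 0 A B) \/ dceq c d (s1form A B) (tform 0 B A).
Proof.
case=> [/Cgrp_swap C|/Cgrp_swap C]; [left|right].
  exists (M3 0 1 0 1 0 0 0 0 1), 1%:M; split=> //; first exact: Cgrp1.
  by rewrite mulmx1 M3_mul; congr (M3 _ _ _ _ _ _ _ _ _); ring.
exists 1%:M, (M3 0 1 0 1 0 0 0 0 1); split=> //; first exact: Cgrp1.
by rewrite mul1mx M3_mul; congr (M3 _ _ _ _ _ _ _ _ _); ring.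
Qed.

Lemma idl_pi (n m : int) : n <= m -> idl n (pi ^ m).
Proof. by move=> nm; right; rewrite (valk_pi hpi). Qed.

End Forms.

Section Main.
Context {R : realType} {k : padicField} { pi : k} {chi2 chi3 : k -> R[i]} {M N : nat}.
Hypotheses (hpi : uniformizer pi) (u2 : runit (1 + 1 : k)).
Hypotheses (hchi2 : mul_char chi2) (hchi3 : mul_char chi3).
Hypotheses (hM : conductor chi2 M) (hN : conductor chi3 N).
Hypotheses (hMN : (M <= N)%N) (hN0 : (0 < N)%N).
Hypothesis (h23 : conductor (fun x => chi2 x / chi3 x) N).
Context {c d : triple}.
Hypotheses (hc : TTm (Triple M N N) c) (hd : TTm (Triple M N N) d).
Context {X : triple -> set k}.
Hypothesis hX : Xreps c d X.
Local Notation compat := (@compat R k chi2 chi3 M c d).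
Local Notation S1 := (S1 pi X c d M N).
Local Notation Ss1 := (Ss1 pi c d M N).
Local Notation Ss2 := (Ss2 pi c d N).
Local Notation Scd := (Scd pi X c d M N).

Lemma ScdP g : Scd g <->
  [\/ S1 g, [/\ 0 < c.(t1), 0 < d.(t1) & Ss1 g] | [/\ 0 < c.(t1), 0 < d.(t1) & Ss2 g]].
Proof.
have [[c2 c3 d2 d3] [[? ? ? ?] [? ? ? ?]]] := level_facts hMN hN0 hc hd.
have W1 : Wcd c d 1%g.
  by rewrite /Wcd; case: ifP => // _; case: ifP => _; rewrite /= inE eqxx.
have WT : 0 < c.(t1) -> 0 < d.(t1) -> Wcd c d = setT.
  by move=> c1 d1; rewrite /Wcd mulr_gt0.
split=> [[w Ww]|[Sg|[c1 d1 Sg]|[c1 d1 Sg]]]; last 1 first.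
- exists Defs.s2; first by rewrite WT.
  by rewrite /Sw (negPf s2_neq1) (negPf s2_neq_s1) eqxx.
- rewrite /Sw; case: eqP => _; first by constructor 1.
  have pos : 0 < c.(t1) * d.(t1) -> 0 < c.(t1) /\ 0 < d.(t1).
    move=> h; have cn0 : c.(t1) != 0 by apply: contraTneq h => ->; rewrite mul0r ltxx.
    have dn0 : d.(t1) != 0 by apply: contraTneq h => ->; rewrite mulr0 ltxx.
    by clear h; lia.
  case: eqP => [wE|_].
    move: Ww; rewrite /Wcd; case: ifP => [/pos [? ?] _ Sg|_]; first by constructor 2.
    rewrite wE; case: ifP => _; rewrite /= !inE (negPf s1_neq1) (negPf s1_neq_w0) ?orbF //.
    by rewrite eq_sym (negPf s2_neq_s1).
  (* [Wcd] may contain s_2 although c_1 or d_1 is 0, but N <= al <= d_1 - N and N <= be <= c_1 - N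
     with N > 0 make both positive. *)
  case: eqP => // _ Sg; constructor 3; split=> //.
    by case: Sg => al [be [? ? ? _]]; lia.
  by case: Sg => al [be [? ? ? _]]; lia.
- by exists 1%g => //; rewrite /Sw eqxx.
- exists Defs.s1; first by rewrite WT.
  by rewrite /Sw (negPf s1_neq1) eqxx.
Qed.

Lemma Sw_Rw w : Wcd c d w -> Sw pi X c d M N w `<=` Rw pi X c d w.
Proof.
move=> _ g; rewrite /Sw /Rw; case: eqP => _.
  by move=> [a [x [Ta Xx -> _]]]; exists a, x.
case: eqP => _.
  move=> [al [be [h1 h2 h3 ->]]]; exists al, be.
  by rewrite /under; split=> //; lia.
case: eqP => // _ [al [be [h1 h2 h3 ->]]]; exists al, be.
by rewrite /under; split=> //; lia.
Qed.

Lemma X_unit a x : Tcd c d a -> X a x -> runit x.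
Proof. by move=> Ta Xx; have [sub _] := hX Ta; apply: sub. Qed.

Lemma S1_compat a x : Tcd c d a -> runit x ->
  compat (tmx pi a x) <->
  [\/ M%:Z <= a.(t1) /\ N%:Z <= a.(t2),
      [/\ a.(t1) < M%:Z, N%:Z <= a.(t2) & suppcond c d M a x]
    | [/\ N%:Z <= a.(t1), a.(t2) < N%:Z & suppcond c d N a x]].
Proof.
have [[c2 c3 d2 d3] [[? ? ? ?] [? ? ? ?]]] := level_facts hMN hN0 hc hd.
move=> Ta ux.
have [[p1 p2 p3 p4] [p5 p6 p7 p8] [p9 p10 p11 p12] p13] := Tcd_facts hc.1 hd.1 c2 c3 d2 d3 Ta.
have A0 := pi_neq0 hpi a.(t1); have Av := valk_pi hpi a.(t1).
have B0 := pi_neq0 hpi a.(t2); have Bv := valk_pi hpi a.(t2).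
have C0 := pi_neq0 hpi a.(t3).
have Z0 : x * pi ^ a.(t3) != 0 by rewrite mulf_neq0 // runit_neq0.
have Zv : valk (x * pi ^ a.(t3)) = a.(t3) by rewrite val_mul_unit // (valk_pi hpi).
have sc L := @suppcondP _ _ _ _ hpi hc.1 hd.1 c2 c3 d2 d3 a x L Ta ux.
split=> [Hc|H]; last first.
  apply: (compat_tform hchi2 hchi3 hM hN hMN hN0 hc hd A0 B0 Z0);
    rewrite ?Av ?Bv ?Zv //; first by lia.
  case: H => [[? ?]|[h1 h2 /sc h3]|[h1 h2 /sc h3]]; [by constructor 1| |].
    by constructor 2; split=> //; apply: h3; lia.
  by constructor 3; split=> //; apply: h3; lia.
have H1 := compat_t_max hchi2 hchi3 hN hMN hN0 hc hd A0 B0 Z0.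
have H2 := compat_t_deep2 hchi2 hchi3 hM hMN hN0 u2 hc hd A0 B0 Z0.
have H3 := compat_t_deep3 hchi2 hchi3 hM hN hMN hN0 h23 u2 hc hd A0 B0 Z0.
rewrite Av Bv Zv in H1 H2 H3.
have {}H1 := H1 p1 p5 p2 p6 p7 p8 p9 p10 Hc.
have {}H2 := H2 p1 p5 p2 p6 p7 p8 p9 p10 Hc.
have {}H3 := H3 p1 p5 p2 p6 p7 p8 p9 p10 Hc.
have [bN|bN] := lerP N%:Z a.(t2).
  have [aM|aM] := lerP M%:Z a.(t1); first by constructor 1.
  by constructor 2; split=> //; apply/sc; [lia|exact: H2].
have aN : N%:Z <= a.(t1) by lia.
(* From a_1 >= N > a_2 >= 1 it follows that a_1 >= 2, so bounds by max(c_1, 1) and max(d_1, 1) are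
   bounds by c_1 and d_1. *)
rewrite /under in p3 p4.
by constructor 3; split=> //; apply/sc; [lia|apply: H3 => //; lia].
Qed.

Lemma Scd_GL g : Scd g -> GL3R g.
Proof.
have [[c2 c3 d2 d3] [[? ? ? ?] [? ? ? ?]]] := level_facts hMN hN0 hc hd.
move=> /ScdP [[a [x [Ta Xx -> _]]]|[_ _ [al [be [h1 h2 h3 ->]]]]|[_ _ [al [be [h1 h2 h3 ->]]]]].
- have [[? ? ? ?] [? ? ? ?] _ _] := Tcd_facts hc.1 hd.1 c2 c3 d2 d3 Ta.
  have ix := runit_idl (X_unit Ta Xx).
  have iC : idl 0 (pi ^ a.(t3)) by apply: idl_pi => //; lia.
  by apply: GL3R_tform; [apply: idl_pi => //; lia|apply: idl_pi => //; lia|idl_tac].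
- by apply: GL3R_s1form; apply: idl_pi => //; lia.
- by apply: GL3R_s2form; apply: idl_pi => //; lia.
Qed.

Lemma Scd_compat g : Scd g -> compat g.
Proof.
have P0 n := pi_neq0 hpi n; have Pv n := valk_pi hpi n.
move=> /ScdP [[a [x [Ta Xx -> H]]]|[_ _ [al [be [h1 h2 h3 ->]]]]|[_ _ [al [be [h1 h2 h3 ->]]]]].
- by apply/(S1_compat Ta (X_unit Ta Xx)).
- by apply: (compat_s1form hchi2 hchi3 hM hN hMN hN0 hc hd); rewrite ?P0 ?Pv.
- by apply: (compat_s2form hchi2 hchi3 hM hN hMN hN0 hc hd); rewrite ?P0 ?Pv.
Qed.

Lemma compat_Scd g : GL3R g -> (forall g', dceq c d g g' -> compat g') ->
  exists2 s, Scd s & dceq c d g s.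
Proof.
have [[c2 c3 d2 d3] [[? ? ? ?] [? ? ? ?]]] := level_facts hMN hN0 hc hd.
move=> Gg H; have trans g2 g3 := @rtrans _ _ _ hc.1 hd.1 g g2 g3.
have P0 n := pi_neq0 hpi n; have Pv n := valk_pi hpi n.
have fromT A B Z : idl 1 A -> idl 1 B -> idl 1 Z -> dceq c d g (tform A B Z) ->
    exists2 s, Scd s & dceq c d g s.
  move=> iA iB iZ e.
  have [a [x [Ta ux ex]]] := tform_reduce hpi u2 hc.1 hd.1 c2 c3 d2 d3 iA iB iZ.
  have [_ /(_ x ux) [y [[Xy xy] _]]] := hX Ta.
  have uy := X_unit Ta Xy.
  have ey := Xeq_dceq hpi hc.1 hd.1 c2 c3 d2 d3 Ta ux uy xy.
  have eg := trans _ _ (trans _ _ e ex) ey.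
  exists (tmx pi a y) => //; apply/ScdP; constructor 1; exists a, y; split=> //.
  by apply/(S1_compat Ta uy); apply: H.
have [A B Z iA iB iZ e|A B iA iB e|A B iA iB e|A iA e|A iA e|e] :=
  bruhat hc.1 hd.1 c2 c3 d2 d3 Gg.
- exact: fromT e.
- have [cd|cd] : (c.(t1) = 0 \/ d.(t1) = 0) \/ (1 <= c.(t1) /\ 1 <= d.(t1)) by lia.
    have [e'|e'] := s1form_tform A B cd; have e2 := trans _ _ e e'; apply: fromT e2 => //;
      exact: idl0.
  have [c1 d1] := cd.
  have [al [be [h1 h2 h3 e']]] := s1form_reduce hpi hc.1 hd.1 c2 c3 d2 d3 iA iB c1 d1.
  have eg := trans _ _ e e'; exists (s1form (pi ^ al) (pi ^ be)) => //.
  apply/ScdP; constructor 2; split; [lia|lia|exists al, be].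
  have := compat_s1 hchi2 hchi3 hM hN hMN hN0 hc hd (P0 al) (P0 be) _ _ _ _ _ _ _ _ (H _ eg).
  by rewrite !Pv => -[]; try lia; split.
- have [cd|cd] : (c.(t1) = 0 \/ d.(t1) = 0) \/ (1 <= c.(t1) /\ 1 <= d.(t1)) by lia.
    by case: (not_compat_s2 hchi2 hchi3 hN hMN hN0 hc hd iA iB cd (H _ e)).
  have [c1 d1] := cd.
  have [al [be [h1 h2 h3 e']]] := s2form_reduce hpi hc.1 hd.1 c2 c3 d2 d3 iA iB c1 d1.
  have eg := trans _ _ e e'; exists (s2form (pi ^ al) (pi ^ be)) => //.
  apply/ScdP; constructor 3; split; [lia|lia|exists al, be].
  have := compat_s2 hchi2 hchi3 hM hN hMN hN0 h23 hc hd (P0 al) (P0 be) _ _ _ _ _ _ _ _ (H _ eg).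
  by rewrite !Pv => -[]; try lia; split.
- by case: (not_compat_s12 hchi2 hchi3 hN hMN hN0 hc hd iA (H _ e)).
- by case: (not_compat_s21 hchi2 hchi3 hN hMN hN0 hc hd iA (H _ e)).
- by case: (not_compat_w0 hchi2 hchi3 hN hMN hN0 hc hd (H _ e)).
Qed.

Lemma Scd_inj s s' : Scd s -> Scd s' -> dceq c d s s' -> s = s'.
Proof.
have [[c2 c3 d2 d3] [[? ? ? ?] [? ? ? ?]]] := level_facts hMN hN0 hc hd.
have P0 n := pi_neq0 hpi n; have Pv n := valk_pi hpi n.
have iS1 g : S1 g -> exists A B Z, [/\ g = tform A B Z, idl 1 A, idl 1 B & idl 1 Z].
  move=> [a [x [Ta Xx -> _]]].
  have [[? ? ? ?] [? ? ? ?] _ _] := Tcd_facts hc.1 hd.1 c2 c3 d2 d3 Ta.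
  have ix := runit_idl (X_unit Ta Xx).
  have iC : idl 1 (pi ^ a.(t3)) by apply: idl_pi => //; lia.
  exists (pi ^ a.(t1)), (pi ^ a.(t2)), (x * pi ^ a.(t3)).
  by split=> //; [apply: idl_pi => //; lia|apply: idl_pi => //; lia|idl_tac].
have iSs1 g : Ss1 g -> exists A B, [/\ g = s1form A B, idl 1 A & idl 1 B].
  by move=> [al [be [? ? ? ->]]]; exists (pi ^ al), (pi ^ be); split=> //; apply: idl_pi => //; lia.
have iSs2 g : Ss2 g -> exists A B, [/\ g = s2form A B, idl 1 A & idl 1 B].
  by move=> [al [be [? ? ? ->]]]; exists (pi ^ al), (pi ^ be); split=> //; apply: idl_pi => //; lia.
have sym g g' := @dceq_sym k c d g g' hc.1 hd.1.
have ts1 g g' : 0 < c.(t1) -> 0 < d.(t1) -> S1 g -> Ss1 g' -> ~ dceq c d g g'.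
  move=> c1 d1 /iS1 [A [B [Z [-> iA iB iZ]]]] /iSs1 [A' [B' [-> iA' iB']]].
  by apply: not_dceq_t_s1.
have ts2 g g' : 0 < c.(t1) -> 0 < d.(t1) -> S1 g -> Ss2 g' -> ~ dceq c d g g'.
  move=> c1 d1 /iS1 [A [B [Z [-> iA iB iZ]]]] /iSs2 [A' [B' [-> iA' iB']]].
  by apply: not_dceq_t_s2.
have s12 g g' : 0 < c.(t1) -> 0 < d.(t1) -> Ss1 g -> Ss2 g' -> ~ dceq c d g g'.
  move=> c1 d1 /iSs1 [A [B [-> iA iB]]] /iSs2 [A' [B' [-> iA' iB']]].
  by apply: not_dceq_s1_s2.
move=> /ScdP [Sg|[c1 d1 Sg]|[c1 d1 Sg]] /ScdP [Sg'|[c1' d1' Sg']|[c1' d1' Sg']] e.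
- case: Sg Sg' e => a [x [Ta Xx -> _]] [a' [x' [Ta' Xx' -> _]]] e.
  have [ux ux'] := (X_unit Ta Xx, X_unit Ta' Xx').
  have aE := tmx_triple hpi hc.1 hd.1 c2 c3 d2 d3 Ta Ta' ux ux' e.
  subst a'; congr tmx.
  have xx' := dceq_Xeq hpi hc.1 hd.1 c2 c3 d2 d3 Ta ux ux' e.
  (* Reflexivity of [Xeq] comes from that of [dceq]; both x and x' then represent the class of x in
     [X], hence coincide. *)
  have xx := dceq_Xeq hpi hc.1 hd.1 c2 c3 d2 d3 Ta ux ux (dceq_refl _ _ _).
  have [_ /(_ x ux) [y [_ yuniq]]] := hX Ta.
  by rewrite -(yuniq x) // -(yuniq x').
- by case: (ts1 _ _ c1' d1' Sg Sg' e).
- by case: (ts2 _ _ c1' d1' Sg Sg' e).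
- by case: (ts1 _ _ c1 d1 Sg' Sg (sym _ _ e)).
- case: Sg Sg' e => al [be [h1 h2 h3 ->]] [al' [be' [h1' h2' h3' ->]]] e.
  have := dceq_s1form_le c1 d1 c2 c3 d2 d3 (P0 _) (P0 _) (P0 _) (P0 _) _ _ _ e.
  have := dceq_s1form_le c1 d1 c2 c3 d2 d3 (P0 _) (P0 _) (P0 _) (P0 _) _ _ _ (sym _ _ e).
  rewrite !Pv => q1 q2.
  have [? ?] := q1 ltac:(lia) ltac:(lia) ltac:(lia).
  have [? ?] := q2 ltac:(lia) ltac:(lia) ltac:(lia).
  by congr s1mx; lia.
- by case: (s12 _ _ c1 d1 Sg Sg' e).
- by case: (ts2 _ _ c1 d1 Sg' Sg (sym _ _ e)).
- by case: (s12 _ _ c1 d1 Sg' Sg (sym _ _ e)).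
- case: Sg Sg' e => al [be [h1 h2 h3 ->]] [al' [be' [h1' h2' h3' ->]]] e.
  have := dceq_s2form_le c1 d1 c2 c3 d2 d3 (P0 _) (P0 _) (P0 _) (P0 _) _ _ _ _ e.
  have := dceq_s2form_le c1 d1 c2 c3 d2 d3 (P0 _) (P0 _) (P0 _) (P0 _) _ _ _ _ (sym _ _ e).
  rewrite !Pv => q1 q2.
  have [? ?] := q1 ltac:(lia) ltac:(lia) ltac:(lia) ltac:(lia).
  have [? ?] := q2 ltac:(lia) ltac:(lia) ltac:(lia) ltac:(lia).
  by congr s2mx; lia.
Qed.

End Main.

Unset Implicit Arguments.

Theorem theorem3p1 (R : realType) (k : padicField) (p : nat)
  (hp : p \in [pchar (residue k)]) (hp2 : (2 < p)%N)
  (hq : (3 < #|residue k|)%N)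
  (pi : k) (hpi : uniformizer pi)
  (chi2 chi3 : k -> R[i]) (hchi2 : mul_char chi2) (hchi3 : mul_char chi3)
  (M N : nat) (hM : conductor chi2 M) (hN : conductor chi3 N)
  (hMN : (M <= N)%N) (hN0 : (0 < N)%N)
  (h23 : conductor (fun x => chi2 x / chi3 x) N)
  (c d : triple)
  (hc : TTm (Triple M N N) c) (hd : TTm (Triple M N N) d)
  (X : triple -> set k) (hX : Xreps c d X) :
  (forall w, Wcd c d w -> Sw pi X c d M N w `<=` Rw pi X c d w) /\
  reps_of_support chi2 chi3 M c d (Scd pi X c d M N).
Proof.
have u2 := runit2 hp hp2.
split; first by move=> w Ww; exact: Sw_Rw.
split=> g.
  move=> Sg; have Gg := Scd_GL hpi hMN hN0 hc hd hX Sg; split=> //.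
  apply: (compat_supports hchi2 hchi3 hM hN hMN hN0 hc hd) => //.
  exact: (Scd_compat hpi u2 hchi2 hchi3 hM hN hMN hN0 h23 hc hd hX).
move=> Gg sg.
have H g' := supports_compat hchi2 hchi3 hM hN hMN hN0 hc hd Gg sg (g' := g').
have [s Ss gs] := compat_Scd hpi u2 hchi2 hchi3 hM hN hMN hN0 h23 hc hd hX Gg H.
exists s; split; first by split=> //; apply/(dcosetP _ _ hc.1 hd.1).
move=> s' [Ss' /(dcosetP _ _ hc.1 hd.1) gs'].
apply: (Scd_inj hpi hMN hN0 hc hd hX) => //.
by apply: (rtrans hc.1 hd.1) gs'; exact: dceq_sym hc.1 hd.1 gs.
Qed.
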